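(* Let $G$ be a $3$-dimensional unimodular Lie group with a left invariant Riemannian metric, and let $\{e_1,e_2,e_3\}$ be an orthonormal basis of its Lie algebra $\mathfrak g$ satisfying $$[e_1,e_2]=c_3e_3,\quad [e_2,e_3]=c_1e_1,\quad [e_3,e_1]=c_2e_2,\qquad c_1\ge c_2\ge c_3 .$$ Let $\mathcal S$ be the unit sphere of $\mathfrak g$ centered at the origin, write $\langle e_i,e_j\rangle_{\mathbb R}$ for the linear span, and for $q\in\mathbb R$ let $\mathcal M_q\subset\mathcal S$ be the set of left invariant unit vector fields on $G$ that are magnetic with charge $q$. Then $\mathcal M_q$ is given by the following list (where ''type'' means that $\mathfrak g$ is isomorphic to the Lie algebra of the named group). 1. $c_1=c_2=c_3\ne0$ (type $\mathbb S^3=\mathrm{SU}(2)$): $\mathcal M_q=\mathcal S$ for all $q$. 2. $c_1=c_2=c_3=0$ (type $\mathbb R^3$): $\mathcal M_q=\mathcal S$ for all $q$. 3. $c_1>c_2=c_3\neq0$ (type $\mathrm{SU}(2)$ or $\mathrm{SL}_2\mathbb R$, or $\mathrm E(2)$ if $c_1=0$): $\mathcal M_q=\{\pm e_1\}\cup(\mathcal S\cap\langle e_2,e_3\rangle_{\mathbb R})$ for all $q$. 4. $c_1>c_2=c_3=0$ (type Heisenberg group): $\mathcal M_q=\{\pm e_1\}\cup(\mathcal S\cap\langle e_2,e_3\rangle_{\mathbb R})$ for $q\ne-\frac{c_1^2}{4}$, and $\mathcal M_q=\mathcal S$ for $q=-\frac{c_1^2}{4}$. 5. $0\ne c_1=c_2>c_3$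 (type $\mathrm{SU}(2)$ or $\mathrm{SL}_2\mathbb R$, or $\mathrm E(2)$ if $c_3=0$): $\mathcal M_q=\{\pm e_3\}\cup(\mathcal S\cap\langle e_1,e_2\rangle_{\mathbb R})$ for all $q$. 6. $0=c_1=c_2>c_3$ (type Heisenberg group): $\mathcal M_q=\{\pm e_3\}\cup(\mathcal S\cap\langle e_1,e_2\rangle_{\mathbb R})$ for $q\neq-\frac{c_3^2}{4}$, and $\mathcal M_q=\mathcal S$ for $q=-\frac{c_3^2}{4}$. 7. $c_1>c_2>c_3>0$ (type $\mathrm{SU}(2)$), or $c_1>c_2>0>c_3$ (type $\mathrm{SL}_2\mathbb R$), or $c_1>0>c_2>c_3$ (type $\mathrm{SL}_2\mathbb R$), or $0>c_1>c_2>c_3$ (type $\mathrm{SU}(2)$): $\mathcal M_q=\{\pm e_1,\pm e_2,\pm e_3\}$ for all $q$. 8. $c_1>c_2>c_3=0$ (type $\mathrm E(2)$): $\mathcal M_q=\{\pm e_1,\pm e_2,\pm e_3\}$ for $q\neq-\frac{(c_1-c_2)^2}{4}$, and $\mathcal M_q=\{\pm e_3\}\cup(\mathcal S\cap\langle e_1,e_2\rangle_{\mathbb R})$ for $q=-\frac{(c_1-c_2)^2}{4}$. 9. $c_1>c_2=0>c_3$ (type $\mathrm E(1,1)$): $\mathcal M_q=\{\pm e_1,\pm e_2,\pm e_3\}$ for $q\neq-\frac{(c_3-c_1)^2}{4}$, and $\mathcal M_q=\{\pm e_2\}\cup(\mathcal S\cap\langle e_1,e_3\rangle_{\mathbb R})$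 for $q=-\frac{(c_3-c_1)^2}{4}$. 10. $0=c_1>c_2>c_3$ (type $\mathrm E(2)$): $\mathcal M_q=\{\pm e_1,\pm e_2,\pm e_3\}$ for $q\neq-\frac{(c_2-c_3)^2}{4}$, and $\mathcal M_q=\{\pm e_1\}\cup(\mathcal S\cap\langle e_2,e_3\rangle_{\mathbb R})$ for $q=-\frac{(c_2-c_3)^2}{4}$.
   Context: Elements of $\mathfrak g$ are identified with left invariant vector fields on $G$. $\mathrm E(2)$ is the group of orientation-preserving isometries of the Euclidean plane and $\mathrm E(1,1)$ that of the Minkowski plane. Magnetic unit vector fields. Let $(M,g)$ be a Riemannian manifold with Levi-Civita connection $\nabla$. For $u,Y\in T_pM$, let $Y^{\mathsf v}_u=\frac{d}{dt}|_{t=0}(u+tY)\in T_u(TM)$ be the vertical lift, and let $Y^{\mathsf h}_u\in T_u(TM)$ be the horizontal lift, i.e. the initial velocity of the parallel transport of $u$ along a curve in $M$ with initial velocity $Y$. The Sasaki metric $g_S$ and the almost complex structure $J$ on $TM$ are given by $g_S(Y^{\mathsf h},Z^{\mathsf h})=g_S(Y^{\mathsf v},Z^{\mathsf v})=g(Y,Z)$, $g_S(Y^{\mathsf h},Z^{\mathsf v})=0$, $JY^{\mathsf h}=Y^{\mathsf v}$, $JY^{\mathsf v}=-Y^{\mathsf h}$. The unit tangent sphere bundle $UM\subset TM$ carries the induced metric, also denoted $g_S$; its unit normal is $\boldsymbol{U}_u=u^{\mathsf v}_u$. Put $\xi=-J\boldsymbol{U}$, $\eta=g_S(\xi,\cdot)$,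 and define $\phi$ on $T(UM)$ by $JV=\phi V+\eta(V)\boldsymbol{U}$. A unit vector field $X$ on $M$, regarded as a map $X:(M,g)\to(UM,g_S)$ with tension field $\tau_1(X)=\mathrm{tr}_g(\nabla dX)$, is magnetic with charge (strength) $q\in\mathbb R$ if it is a magnetic map into $UM$, i.e. $\tau_1(X)=q\,\phi(X_*X)$, where $X_*X$ is the section $p\mapsto dX_p(X_p)$ of $X^*T(UM)$. Here $M=G$ with the given left invariant metric. *)

(* Defs.v *)
From HB Require Import structures.
From mathcomp Require Import all_boot all_order all_algebra.
From mathcomp Require Import complex.
From mathcomp Require Import all_classical all_reals all_analysis.
Set Implicit Arguments.
Unset Strict Implicit.
Unset Printing Implicit Defensive.
Import Order.TTheory GRing.Theory Num.Theory.
Import numFieldNormedType.Exports.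
Local Open Scope classical_set_scope.
Local Open Scope ring_scope.

Fixpoint Ck_on (R : realType) (V W : normedModType R) (k : nat) (U : set V)
    (f : V -> W) : Prop :=
  match k with
  | 0%N => forall x, U x -> {for x, continuous f}
  | k'.+1 => (forall x, U x -> differentiable f x) /\
             (forall v, Ck_on k' U (fun x => 'D_v f x))
  end.

Definition smooth_on (R : realType) (V W : normedModType R) (U : set V)
    (f : V -> W) : Prop := forall k, Ck_on k U f.

Record chart (R : realType) (n : nat) (T : Type) := Chart {
  cdom : set T;
  cmap :> T -> 'rV[R]_n;
  cinv : 'rV[R]_n -> T
}.

Definition cimg (R : realType) (n : nat) (T : Type) (c : chart R n T) :
  set 'rV[R]_n := c @` cdom c.

(* [cmap] is a homeomorphism from the open set [cdom] onto the open set [cimg],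
   with inverse [cinv]; values outside of these sets are irrelevant. *)
Definition chart_axiom (R : realType) (n : nat) (T : topologicalType)
    (c : chart R n T) : Prop :=
  [/\ open (cdom c), open (cimg c),
      forall p, cdom c p -> cinv c (c p) = p,
      forall p, cdom c p -> {for p, continuous c} &
      forall x, cimg c x -> {for x, continuous (cinv c)}].

(* [chart_at p] is a selected chart around [p]; it only serves to represent
   tangent vectors at [p] by elements of ['rV_n], see [tcoord] below. *)
Record smooth_manifold (R : realType) (n : nat) (T : topologicalType) :=
  SmoothManifold {
  atlas : set (chart R n T);
  chart_at : T -> chart R n T;
  manifold_hausdorff : hausdorff_space T;
  manifold_second_countable : @second_countable T;
  atlas_chart : forall c, atlas c -> chart_axiom c;
  chart_atP : forall p, atlas (chart_at p) /\ cdom (chart_at p) p;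
  atlas_compatible : forall c d, atlas c -> atlas d ->
        smooth_on (c @` (cdom c `&` cdom d)) (d \o cinv c)
}.

(* A tangent vector at [p] is given by its components in [chart_at p], and a
   (not necessarily smooth) vector field is a function [T -> 'rV_n]; these are
   the components of the vector [v] at [p] in the chart [c]. *)
Definition tcoord (R : realType) (n : nat) (T : topologicalType)
    (M : smooth_manifold R n T) (c : chart R n T) (p : T) (v : 'rV[R]_n) :
    'rV[R]_n :=
  'd (c \o cinv (chart_at M p)) (chart_at M p p) v.

Definition vf_in (R : realType) (n : nat) (T : topologicalType)
    (M : smooth_manifold R n T) (c : chart R n T) (X : T -> 'rV[R]_n)
    (x : 'rV[R]_n) : 'rV[R]_n :=
  tcoord M c (cinv c x) (X (cinv c x)).

Definition smooth_vf (R : realType) (n : nat) (T : topologicalType)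
    (M : smooth_manifold R n T) (X : T -> 'rV[R]_n) : Prop :=
  forall c, atlas M c -> smooth_on (cimg c) (vf_in M c X).

Definition tangent_map (R : realType) (n : nat) (T : topologicalType)
    (M : smooth_manifold R n T) (f : T -> T) (p : T) (v : 'rV[R]_n) :
    'rV[R]_n :=
  'd (chart_at M (f p) \o f \o cinv (chart_at M p)) (chart_at M p p) v.

(* Coordinate expression X(Y^k) - Y(X^k), evaluated at [p] in [chart_at p]. *)
Definition lie_bracket (R : realType) (n : nat) (T : topologicalType)
    (M : smooth_manifold R n T) (X Y : T -> 'rV[R]_n) (p : T) : 'rV[R]_n :=
  let c := chart_at M p in
  let X' := vf_in M c X in
  let Y' := vf_in M c Y in
  'D_(X' (c p)) Y' (c p) - 'D_(Y' (c p)) X' (c p).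

Definition bil (R : realType) (n : nat) (A : 'M[R]_n) (v w : 'rV[R]_n) : R :=
  (v *m A *m w^T) ord0 ord0.

Definition bvec (R : realType) (n : nat) (i : 'I_n) : 'rV[R]_n :=
  delta_mx ord0 i.
Arguments bvec {R n} i.

(* [g p] is the Gram matrix of the metric in [chart_at p]; [metric_in M c g x]
   is its Gram matrix at [cinv c x] in the chart [c]. *)
Definition metric_in (R : realType) (n : nat) (T : topologicalType)
    (M : smooth_manifold R n T) (c : chart R n T) (g : T -> 'M[R]_n)
    (x : 'rV[R]_n) : 'M[R]_n :=
  let p := cinv c x in
  let back v := 'd (chart_at M p \o cinv c) x v in
  \matrix_(i, j) bil (g p) (back (bvec i)) (back (bvec j)).

Definition riemannian_metric (R : realType) (n : nat) (T : topologicalType)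
    (M : smooth_manifold R n T) (g : T -> 'M[R]_n) : Prop :=
  [/\ forall p, (g p)^T = g p,
      forall p v, v != 0 -> 0 < bil (g p) v v &
      forall c, atlas M c -> smooth_on (cimg c) (metric_in M c g)].

(* From here to [is_UM_tension], [g : 'rV_n -> 'M_n] is the Gram matrix of a
   metric in a chart.  [christoffel g x v w] is the vector with components
   Gamma^k_ij v^i w^j. *)
Definition christoffel (R : realType) (n : nat) (g : 'rV[R]_n -> 'M[R]_n)
    (x v w : 'rV[R]_n) : 'rV[R]_n :=
  (\row_l (2^-1 * (bil ('D_v g x) w (bvec l) + bil ('D_w g x) v (bvec l)
                   - bil ('D_(bvec l) g x) v w))) *m invmx (g x).

(* (nabla df)(v, w) for f : (R^m, g) -> (R^n, h). *)
Definition nabla_d (R : realType) (m n : nat) (g : 'rV[R]_m -> 'M[R]_m)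
    (h : 'rV[R]_n -> 'M[R]_n) (f : 'rV[R]_m -> 'rV[R]_n) (x v w : 'rV[R]_m) :
    'rV[R]_n :=
  'D_v (fun z => 'D_w f z) x - 'D_(christoffel g x v w) f x
  + christoffel h (f x) ('D_v f x) ('D_w f x).

Definition tension (R : realType) (m n : nat) (g : 'rV[R]_m -> 'M[R]_m)
    (h : 'rV[R]_n -> 'M[R]_n) (f : 'rV[R]_m -> 'rV[R]_n) (x : 'rV[R]_m) :
    'rV[R]_n :=
  \sum_i \sum_j invmx (g x) i j *: nabla_d g h f x (bvec i) (bvec j).

(* A chart of M induces a chart of TM: the point z : 'rV_(n + n) is the tangent
   vector with components [rsubmx z] at the point with coordinates
   [lsubmx z]. *)

Definition vlift (R : realType) (n : nat) (Y : 'rV[R]_n) : 'rV[R]_(n + n) :=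
  row_mx 0 Y.

(* Parallel transport along x(t) is u' = - Gamma_x(x', u); this is the initial
   velocity (x', u') of (x(t), u(t)). *)
Definition hlift (R : realType) (n : nat) (g : 'rV[R]_n -> 'M[R]_n)
    (z : 'rV[R]_(n + n)) (Y : 'rV[R]_n) : 'rV[R]_(n + n) :=
  row_mx Y (- christoffel g (lsubmx z) Y (rsubmx z)).

(* V = hlift g z (hpart V) + vlift (vpart g z V) is the decomposition of a
   tangent vector V of TM at z. *)
Definition hpart (R : realType) (n : nat) (V : 'rV[R]_(n + n)) : 'rV[R]_n :=
  lsubmx V.

Definition vpart (R : realType) (n : nat) (g : 'rV[R]_n -> 'M[R]_n)
    (z V : 'rV[R]_(n + n)) : 'rV[R]_n :=
  rsubmx V + christoffel g (lsubmx z) (lsubmx V) (rsubmx z).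

Definition sasaki (R : realType) (n : nat) (g : 'rV[R]_n -> 'M[R]_n)
    (z V W : 'rV[R]_(n + n)) : R :=
  bil (g (lsubmx z)) (hpart V) (hpart W)
  + bil (g (lsubmx z)) (vpart g z V) (vpart g z W).

Definition Jop (R : realType) (n : nat) (g : 'rV[R]_n -> 'M[R]_n)
    (z V : 'rV[R]_(n + n)) : 'rV[R]_(n + n) :=
  vlift (hpart V) - hlift g z (vpart g z V).

Definition unit_tangent (R : realType) (n : nat) (U : set 'rV[R]_n)
    (g : 'rV[R]_n -> 'M[R]_n) : set 'rV[R]_(n + n) :=
  [set z | U (lsubmx z) /\ bil (g (lsubmx z)) (rsubmx z) (rsubmx z) = 1].

Definition unormal (R : realType) (n : nat) (z : 'rV[R]_(n + n)) :
  'rV[R]_(n + n) := vlift (rsubmx z).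

Definition xi (R : realType) (n : nat) (g : 'rV[R]_n -> 'M[R]_n)
    (z : 'rV[R]_(n + n)) : 'rV[R]_(n + n) := - Jop g z (unormal z).

Definition eta (R : realType) (n : nat) (g : 'rV[R]_n -> 'M[R]_n)
    (z V : 'rV[R]_(n + n)) : R := sasaki g z (xi g z) V.

Definition phi (R : realType) (n : nat) (g : 'rV[R]_n -> 'M[R]_n)
    (z V : 'rV[R]_(n + n)) : 'rV[R]_(n + n) :=
  Jop g z V - eta g z V *: unormal z.

(* Local coordinates s on the (2n-1)-dimensional manifold UM: an immersion of an
   open subset of R^(2n-1) into UM is a local diffeomorphism onto an open subset
   of UM, so that its local inverses are charts of UM. *)
Definition UM_param (R : realType) (n : nat) (U : set 'rV[R]_n)
    (g : 'rV[R]_n -> 'M[R]_n) (W : set 'rV[R]_((n + n).-1))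
    (psi : 'rV[R]_((n + n).-1) -> 'rV[R]_(n + n)) : Prop :=
  [/\ open W, smooth_on W psi,
      forall s, W s -> unit_tangent U g (psi s) &
      forall s v, W s -> 'd psi s v = 0 -> v = 0].

Definition UM_metric (R : realType) (n : nat) (g : 'rV[R]_n -> 'M[R]_n)
    (psi : 'rV[R]_((n + n).-1) -> 'rV[R]_(n + n)) (s : 'rV[R]_((n + n).-1)) :
    'M[R]_((n + n).-1) :=
  \matrix_(a, b) sasaki g (psi s) ('d psi s (bvec a)) ('d psi s (bvec b)).

Definition sect (R : realType) (n : nat) (X : 'rV[R]_n -> 'rV[R]_n)
    (x : 'rV[R]_n) : 'rV[R]_(n + n) := row_mx x (X x).

(* [tau] is the tension field at x of the unit vector field X, as a map into UM:
   f is the expression of X in some local coordinates of UM, and the tension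
   field of f, which does not depend on their choice as a tangent vector of UM,
   is mapped into the tangent space of TM. *)
Definition is_UM_tension (R : realType) (n : nat) (U : set 'rV[R]_n)
    (g : 'rV[R]_n -> 'M[R]_n) (X : 'rV[R]_n -> 'rV[R]_n) (x : 'rV[R]_n)
    (tau : 'rV[R]_(n + n)) : Prop :=
  exists (W : set 'rV[R]_((n + n).-1))
         (psi : 'rV[R]_((n + n).-1) -> 'rV[R]_(n + n))
         (O : set 'rV[R]_n) (f : 'rV[R]_n -> 'rV[R]_((n + n).-1)),
    [/\ UM_param U g W psi, open O /\ O x, smooth_on O f,
        forall y, O y -> W (f y) /\ psi (f y) = sect X y &
        tau = 'd psi (f x) (tension g (UM_metric g psi) f x)].

Definition unit_vf (R : realType) (n : nat) (T : topologicalType)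
    (g : T -> 'M[R]_n) (X : T -> 'rV[R]_n) : Prop :=
  forall p, bil (g p) (X p) (X p) = 1.

(* tau_1(X) = q phi(X_* X), checked in every chart. *)
Definition magnetic (R : realType) (n : nat) (T : topologicalType)
    (M : smooth_manifold R n T) (g : T -> 'M[R]_n) (q : R)
    (X : T -> 'rV[R]_n) : Prop :=
  [/\ smooth_vf M X, unit_vf g X &
    forall c, atlas M c -> forall x, cimg c x ->
      let g' := metric_in M c g in
      let X' := vf_in M c X in
      is_UM_tension (cimg c) g' X' x
        (q *: phi g' (sect X' x) ('d (sect X') x (X' x)))].

#[short(type="ptopGroupType")]
HB.structure Definition PTopGroup := {G of PointedTopological G & Group G}.

Definition lie_group (R : realType) (n : nat) (G : ptopGroupType)
    (M : smooth_manifold R n G) : Prop :=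
  [/\ continuous (fun p : G * G => (p.1 * p.2)%g),
      continuous (fun p : G => (p^-1)%g),
      forall c d k, atlas M c -> atlas M d -> atlas M k ->
        let m (w : 'rV[R]_(n + n)) :=
          (cinv c (lsubmx w) * cinv d (rsubmx w))%g in
        smooth_on [set w | [/\ cimg c (lsubmx w), cimg d (rsubmx w) &
                               cdom k (m w)]]
          (fun w => k (m w)) &
      forall c k, atlas M c -> atlas M k ->
        smooth_on [set x | cimg c x /\ cdom k ((cinv c x)^-1)%g]
          (fun x => k ((cinv c x)^-1)%g)].

(* Every left Haar measure is right invariant.  (On a second countable locally
   compact group, Borel measures finite on compact sets are regular.) *)
Definition unimodular (R : realType) (G : ptopGroupType) : Prop :=
  forall mu : {measure set (g_sigma_algebraType (@open G)) -> \bar R},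
    (forall K : set G, compact K -> (mu K < +oo)%E) ->
    (forall (a : G) (A : set G), <<s @open G >> A ->
       mu [set (a * x)%g | x in A] = mu A) ->
    forall (a : G) (A : set G), <<s @open G >> A ->
       mu [set (x * a)%g | x in A] = mu A.

Definition left_invariant_vf (R : realType) (n : nat) (G : ptopGroupType)
    (M : smooth_manifold R n G) (X : G -> 'rV[R]_n) : Prop :=
  forall a p : G, tangent_map M (fun x => (a * x)%g) p (X p) = X (a * p)%g.

Definition left_invariant_metric (R : realType) (n : nat) (G : ptopGroupType)
    (M : smooth_manifold R n G) (g : G -> 'M[R]_n) : Prop :=
  forall (a p : G) (v w : 'rV[R]_n),
    bil (g (a * p)%g) (tangent_map M (fun x => (a * x)%g) p v)
                      (tangent_map M (fun x => (a * x)%g) p w)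
    = bil (g p) v w.

Definition lie_algebra (R : realType) (n : nat) (G : ptopGroupType)
    (M : smooth_manifold R n G) : set (G -> 'rV[R]_n) :=
  [set X | smooth_vf M X /\ left_invariant_vf M X].

Definition ip (R : realType) (n : nat) (G : ptopGroupType)
    (g : G -> 'M[R]_n) (X Y : G -> 'rV[R]_n) : R :=
  bil (g 1%g) (X 1%g) (Y 1%g).

Definition lspan (R : realType) (V : lmodType R) (s : seq V) : set V :=
  [set v | exists a : 'I_(size s) -> R, v = \sum_i a i *: s`_i].

Definition orthonormal_basis (R : realType) (n : nat) (G : ptopGroupType)
    (M : smooth_manifold R n G) (g : G -> 'M[R]_n) (s : seq (G -> 'rV[R]_n)) :
    Prop :=
  lspan s = lie_algebra M /\
  forall i j : 'I_(size s), ip g s`_i s`_j = (i == j)%:R.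

Definition unit_sphere (R : realType) (n : nat) (G : ptopGroupType)
    (M : smooth_manifold R n G) (g : G -> 'M[R]_n) : set (G -> 'rV[R]_n) :=
  [set X | lie_algebra M X /\ ip g X X = 1].

Definition magnetic_set (R : realType) (n : nat) (G : ptopGroupType)
    (M : smooth_manifold R n G) (g : G -> 'M[R]_n) (q : R) :
    set (G -> 'rV[R]_n) :=
  [set X | unit_sphere M g X /\ magnetic M g q X].

Definition pm (V : zmodType) (v : V) : set V := [set v; - v].

(* The velocities at 1 of the curves in H. *)
Definition matrix_lie (R : realType) (m : nat) (H : set 'M[R[i]]_m) :
    set 'M[R[i]]_m :=
  [set A | exists gamma : R -> 'M[R[i]]_m,
     [/\ gamma 0 = 1%:M, forall t, H (gamma t) &
      forall i j,
        is_derive (0 : R) (1 : R) (fun t => complex.Re (gamma t i j))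
          (complex.Re (A i j)) /\
        is_derive (0 : R) (1 : R) (fun t => complex.Im (gamma t i j))
          (complex.Im (A i j))]].

Definition of_real (R : realType) (m : nat) (H : set 'M[R]_m) :
  set 'M[R[i]]_m := map_mx (real_complex R) @` H.

Definition SU2 (R : realType) : set 'M[R[i]]_2 :=
  [set A | A *m (map_mx (@conjc R) A)^T = 1%:M /\ \det A = 1].

Definition SL2 (R : realType) : set 'M[R[i]]_2 :=
  of_real [set A : 'M[R]_2 | \det A = 1].

(* Affine maps x |-> A x + b with linear part A in H. *)
Definition affine (R : realType) (k : nat) (H : set 'M[R]_k) :
    set 'M[R[i]]_(k + 1) :=
  of_real [set B | exists (A : 'M[R]_k) (b : 'cV[R]_k),
             H A /\ B = block_mx A b 0 1%:M].

Definition SO_form (R : realType) (k : nat) (S : 'M[R]_k) : set 'M[R]_k :=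
  [set A | A^T *m S *m A = S /\ \det A = 1].

Definition E2 (R : realType) : set 'M[R[i]]_(2 + 1) :=
  affine (SO_form (1%:M : 'M[R]_2)).

Definition minkowski (R : realType) : 'M[R]_2 :=
  \matrix_(i, j) (if i == j then (-1) ^+ i else 0).

Definition E11 (R : realType) : set 'M[R[i]]_(2 + 1) :=
  affine (SO_form (minkowski R)).

Definition R3 (R : realType) : set 'M[R[i]]_(3 + 1) :=
  affine [set (1%:M : 'M[R]_3)].

Definition Heisenberg (R : realType) : set 'M[R[i]]_3 :=
  of_real [set A : 'M[R]_3 | forall i j : 'I_3, (j <= i)%N ->
             A i j = (i == j)%:R].

Definition has_type (R : realType) (n : nat) (G : ptopGroupType)
    (M : smooth_manifold R n G) (m : nat) (H : set 'M[R[i]]_m) : Prop :=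
  exists F : (G -> 'rV[R]_n) -> 'M[R[i]]_m,
    [/\ set_bij (lie_algebra M) (matrix_lie H) F,
        forall (a : R) X Y, lie_algebra M X -> lie_algebra M Y ->
          F (a *: X + Y) = a%:C%C *: F X + F Y &
        forall X Y, lie_algebra M X -> lie_algebra M Y ->
          F (lie_bracket M X Y) = F X *m F Y - F Y *m F X].

(* Main.v *)
Require Import Defs.
From HB Require Import structures.
From mathcomp Require Import all_boot all_order all_algebra.
From mathcomp Require Import complex.
From mathcomp Require Import all_classical all_reals all_analysis.
From mathcomp Require Import ring lra.
Set Implicit Arguments.
Unset Strict Implicit.
Unset Printing Implicit Defensive.
Import Order.TTheory GRing.Theory Num.Theory.
Import numFieldNormedType.Exports.
Local Open Scope classical_set_scope.
Local Open Scope ring_scope.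

(** Fix a left invariant unit field X = sum_i a_i e_i. In the orthonormal frame
    e_i all structure is constant: the brackets, hence by the Koszul formula the
    connection, nabla_(e_j) e_i = sum_k (Gamma_j)_ik e_k. So the equation
    tau_1(X) = q phi(X_* X) should become algebra in a, and it does:
    - X_* X is the horizontal lift of X plus the vertical lift of nabla_X X, so
      phi(X_* X) = - (nabla_X X)^h ([phi_sect]).
    - For a parametrization psi of UM let Omega be the matrix of the pulled back
      orthonormal coframe of the Sasaki metric: its two blocks are the
      components of the horizontal part and of the vertical part. The pulled
      back metric is Omega Omega^T, and the exterior derivative of Omega is
      given by the structure equations [hform_structure], [vform_structure].
      If f represents X, then Omega has the constant value (e_k, nabla_(e_k) X)
      on df(e_k). Writing the Christoffel symbols of Omega Omega^T with
      derivatives of Omega ([gram_koszul]), all second derivatives of f cancel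
      against this constancy, and what remains is
      <tau, l> = sum_k Omega(df e_k) . dOmega(df e_k, l) - <df(sum_k nabla_(e_k) e_k), l>,
      whose last term vanishes because tr(ad) = 0 ([tension_pairing]).
    - As df and the directions tangent to the fibre fill the tangent space of
      UM, this pairing determines tau_1(X), and the magnetic equation is a
      quadratic condition on a that mentions neither the point nor psi
      ([is_UM_tensionP], [magneticP]). A psi through X exists by stereographic
      projection in the fibres.

    With mu_i = (c_1 + c_2 + c_3) / 2 - c_i one has Gamma_i = mu_i (e_i x .) in
    dimension 3, and the condition says, for each pair i <> j with third index
    k, that (c_i - c_j) c_k a_i a_j = 0, from the directions tangent to the
    fibre, and (c_i - c_j) (mu_i mu_j - q) a_i a_j = 0, from the horizontal
    ones ([magnetic_condition3]). So a pair imposes a_i a_j = 0 unless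
    c_i = c_j, or c_k = 0 and q = mu_i mu_j = - (c_i - c_j)^2 / 4; going
    through the signs of the c_i gives the list.

    For the types, the Lie algebra of each matrix group is found by
    differentiating the defining equations and by exhibiting curves, with a
    basis whose brackets are again cyclic, [T_i, T_j] = d_k T_k. Rescaling such
    a basis to l_i T_i turns d_k into any c_k with l_i l_j d_k = c_k l_k
    ([has_typeI]). *)

Section AbelianGroups.

Lemma addr_swap (V : zmodType) (a b c d : V) : a + b = c + d -> a - c = d - b.
Proof.
by move=> abcd; apply/eqP; rewrite subr_eq addrAC eq_sym subr_eq abcd addrC.
Qed.

Lemma addr_cancel (V : zmodType) (a b c a' b' c' : V) : a = a' ->
  (a + (b + c)) - (a' + (b' + c')) = (c - c') + b - b'.
Proof.
move=> ->; rewrite opprD addrACA subrr add0r opprD addrACA addrC.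
by rewrite addrA.
Qed.

Lemma addr_balance (V : zmodType) (a b c d : V) :
  a + b + c = 0 -> a - d + c = - (d + b).
Proof.
move/eqP; rewrite addrAC addr_eq0 => /eqP acb.
by rewrite addrAC acb opprD addrC.
Qed.

Lemma addr_diag (V : zmodType) (a b s s' : V) :
  s = s' -> (a + s) - (b + s') = a - b.
Proof. by move=> ->; rewrite opprD addrACA subrr addr0. Qed.

End AbelianGroups.

(** * Directional derivatives of matrix valued functions *)

Section Calculus.
Context {R : realType}.
Implicit Types (V W : normedModType R).

(** The derivative is determined by the germ: the expansion of f at x is one of
    g, and the two differentials agree by uniqueness. *)
Lemma differentiable_near V W (f g : V -> W) x :
  (\forall y \near x, f y = g y) -> differentiable f x -> differentiable g x.
Proof.
move=> fg /diff_locallyP[dc df].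
have gE : g \o shift x = cst (g x) + 'd f x +o_ 0 id.
  apply/eqaddoP => e e0.
  move/eqaddoP : df => /(_ e e0) fe.
  have gx := nbhs_singleton fg.
  have fg0 : \forall y \near (0 : V), f (y + x) = g (y + x).
    by move: fg; rewrite (near_shift 0) subr0.
  near=> y.
  have -> : (g \o shift x - (cst (g x) + 'd f x)) y = (f \o shift x - (cst (f x) + 'd f x)) y.
    rewrite !fctE /= gx; congr (_ - _); apply/esym.
    by near: y.
  by near: y.
have dg : 'd g x = 'd f x :> (V -> W) by exact: diff_unique.
by apply/diff_locallyP; rewrite dg.
Unshelve. all: by end_near. Qed.

Lemma derive_comp V W (U : normedModType R) (f : U -> V) (g : V -> W) x v :
  differentiable f x -> differentiable g (f x) ->
  'D_v (fun y => g (f y)) x = 'D_('D_v f x) g (f x).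
Proof.
move=> df dg; rewrite !deriveE //; last exact: differentiable_comp.
by rewrite (diff_comp df dg).
Qed.

Lemma deriveDv V W (f : V -> W) x v w : differentiable f x ->
  'D_(v + w) f x = 'D_v f x + 'D_w f x.
Proof. by move=> df; rewrite !deriveE // linearD. Qed.

Lemma deriveZv V W (f : V -> W) x (a : R) v : differentiable f x ->
  'D_(a *: v) f x = a *: 'D_v f x.
Proof. by move=> df; rewrite !deriveE // linearZ. Qed.

Lemma derive_sumv V W I (s : seq I) (f : V -> W) x (v : I -> V) :
  differentiable f x ->
  'D_(\sum_(i <- s) v i) f x = \sum_(i <- s) 'D_(v i) f x.
Proof.
move=> df; rewrite deriveE // linear_sum; apply: eq_bigr => i _.
by rewrite deriveE.
Qed.

Lemma derive_row n W (f : 'rV[R]_n -> W) x v : differentiable f x ->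
  'D_v f x = \sum_i v ord0 i *: 'D_(bvec i) f x.
Proof.
move=> df; rewrite {1}(row_sum_delta v) derive_sumv //.
by apply: eq_bigr => i _; rewrite deriveZv.
Qed.

Lemma differentiable_mx V m n (M : V -> 'M[R]_(m, n)) x :
  (forall i j, differentiable (fun y => M y i j) x) -> differentiable M x.
Proof.
move=> dM.
have -> : M = \sum_i \sum_j (fun y => M y i j *: delta_mx i j).
  apply/funext => y; rewrite [LHS]matrix_sum_delta fct_sumE.
  by apply: eq_bigr => i _; rewrite fct_sumE.
by apply: differentiable_sum => i; apply: differentiable_sum => j;
  apply: differentiableZl.
Qed.

Lemma differentiable_entry V m n (M : V -> 'M[R]_(m, n)) x i j :
  differentiable M x -> differentiable (fun y => M y i j) x.
Proof.
move=> dM; apply: (@differentiable_comp _ _ _ _ M (fun N => N i j)) => //.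
exact: differentiable_coord.
Qed.

Lemma derive_entry V m n (M : V -> 'M[R]_(m, n)) x v i j :
  differentiable M x -> 'D_v (fun y => M y i j) x = ('D_v M x) i j.
Proof. by move=> dM; rewrite derive_mx ?mxE //; exact: diff_derivable. Qed.

Lemma differentiable_fsum V W n (f : 'I_n -> V -> W) x :
  (forall i, differentiable (f i) x) ->
  differentiable (fun y => \sum_i f i y) x.
Proof.
move=> df; have -> : (fun y => \sum_i f i y) = \sum_i f i.
  by apply/funext => y; rewrite fct_sumE.
exact: differentiable_sum.
Qed.

Lemma derive_fsum V W n (f : 'I_n -> V -> W) x v :
  (forall i, differentiable (f i) x) ->
  'D_v (fun y => \sum_i f i y) x = \sum_i 'D_v (f i) x.
Proof.
move=> df; have -> : (fun y => \sum_i f i y) = \sum_i f i.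
  by apply/funext => y; rewrite fct_sumE.
by apply: derive_sum => i; exact: diff_derivable.
Qed.

Lemma differentiable_mulmx V m n p (A : V -> 'M[R]_(m, n))
    (B : V -> 'M[R]_(n, p)) x :
  differentiable A x -> differentiable B x ->
  differentiable (fun y => A y *m B y) x.
Proof.
move=> dA dB; apply: differentiable_mx => i j.
have -> : (fun y => (A y *m B y) i j) = fun y => \sum_k A y i k * B y k j.
  by apply/funext => y; rewrite mxE.
apply: differentiable_fsum => k.
by apply: differentiableM; exact: differentiable_entry.
Qed.

Lemma derive_mulmx V m n p (A : V -> 'M[R]_(m, n))
    (B : V -> 'M[R]_(n, p)) x v :
  differentiable A x -> differentiable B x ->
  'D_v (fun y => A y *m B y) x = 'D_v A x *m B x + A x *m 'D_v B x.
Proof.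
move=> dA dB.
have dAB := differentiable_mulmx dA dB.
apply/matrixP => i j; rewrite -derive_entry // !mxE -big_split /=.
have -> : (fun y => (A y *m B y) i j) = fun y => \sum_k A y i k * B y k j.
  by apply/funext => y; rewrite mxE.
rewrite derive_fsum => [|k]; last first.
  by apply: differentiableM; exact: differentiable_entry.
apply: eq_bigr => k _.
have dAk : differentiable (fun y => A y i k) x by exact: differentiable_entry.
have dBk : differentiable (fun y => B y k j) x by exact: differentiable_entry.
rewrite -!derive_entry // (deriveM (f := fun y => A y i k)
  (g := fun y => B y k j)) //; try exact: diff_derivable.
by rewrite addrC; congr (_ + _); rewrite /GRing.scale /= mulrC.
Qed.

Lemma differentiable_mulmxr V m n p (A : V -> 'M[R]_(m, n))
    (B : 'M[R]_(n, p)) x :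
  differentiable A x -> differentiable (fun y => A y *m B) x.
Proof. by move=> dA; apply: differentiable_mulmx. Qed.

Lemma derive_mulmxr V m n p (A : V -> 'M[R]_(m, n)) (B : 'M[R]_(n, p)) x v :
  differentiable A x -> 'D_v (fun y => A y *m B) x = 'D_v A x *m B.
Proof.
by move=> dA; rewrite derive_mulmx // derive_cst mulmx0 addr0.
Qed.

Lemma derive_mulmxl V m n p (A : 'M[R]_(m, n)) (B : V -> 'M[R]_(n, p)) x v :
  differentiable B x -> 'D_v (fun y => A *m B y) x = A *m 'D_v B x.
Proof.
by move=> dB; rewrite derive_mulmx // derive_cst mul0mx add0r.
Qed.

Lemma differentiable_trmx V m n (A : V -> 'M[R]_(m, n)) x :
  differentiable A x -> differentiable (fun y => (A y)^T) x.
Proof.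
move=> dA; apply: differentiable_mx => i j.
under eq_fun do rewrite mxE.
exact: differentiable_entry.
Qed.

Lemma derive_trmx V m n (A : V -> 'M[R]_(m, n)) x v :
  differentiable A x -> 'D_v (fun y => (A y)^T) x = ('D_v A x)^T.
Proof.
move=> dA; apply/matrixP => i j.
rewrite -derive_entry; last exact: differentiable_trmx.
by under eq_fun do rewrite mxE; rewrite mxE derive_entry.
Qed.

Lemma differentiable_row_mx V m n p (A : V -> 'M[R]_(m, n))
    (B : V -> 'M[R]_(m, p)) x :
  differentiable A x -> differentiable B x ->
  differentiable (fun y => row_mx (A y) (B y)) x.
Proof.
move=> dA dB; apply: differentiable_mx => i j.
by case: (split_ordP j) => k ->;
  [under eq_fun do rewrite row_mxEl|under eq_fun do rewrite row_mxEr];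
  exact: differentiable_entry.
Qed.

Lemma derive_row_mx V m n p (A : V -> 'M[R]_(m, n))
    (B : V -> 'M[R]_(m, p)) x v :
  differentiable A x -> differentiable B x ->
  'D_v (fun y => row_mx (A y) (B y)) x = row_mx ('D_v A x) ('D_v B x).
Proof.
move=> dA dB; apply/matrixP => i j.
rewrite -derive_entry; last exact: differentiable_row_mx.
by case: (split_ordP j) => k ->;
  [under eq_fun do rewrite row_mxEl|under eq_fun do rewrite row_mxEr];
  rewrite derive_entry // ?row_mxEl ?row_mxEr.
Qed.

Lemma differentiable_scalemx V m n (k : V -> R) (f : V -> 'M[R]_(m, n)) x :
  differentiable k x -> differentiable f x ->
  differentiable (fun y => k y *: f y) x.
Proof.
move=> dk df; apply: differentiable_mx => i j.
under eq_fun do rewrite mxE.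
by apply: differentiableM => //; exact: differentiable_entry.
Qed.

Lemma derive_scalemx V m n (k : V -> R) (f : V -> 'M[R]_(m, n)) x v :
  differentiable k x -> differentiable f x ->
  'D_v (fun y => k y *: f y) x = 'D_v k x *: f x + k x *: 'D_v f x.
Proof.
move=> dk df; apply/matrixP => i j.
rewrite -derive_entry; last exact: differentiable_scalemx.
under eq_fun do rewrite mxE.
have dfij : differentiable (fun y => f y i j) x by exact: differentiable_entry.
rewrite (deriveM (f := k) (g := fun y => f y i j)); try exact: diff_derivable.
by rewrite derive_entry // !mxE addrC /GRing.scale /=; congr (_ + _); exact: mulrC.
Qed.

End Calculus.

(** * Symmetry of second derivatives *)

Section Schwarz.
Context {R : realType}.
Implicit Types (V W : normedModType R).

Lemma is_derive_line V W (f : V -> W) z v (t : R) : derivable f (z + t *: v) v ->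
  is_derive t (1 : R) (fun s : R => f (z + s *: v)) ('D_v f (z + t *: v)).
Proof.
rewrite /derivable => df.
have E : (fun h : R => h^-1 *: (f (z + (h *: (1 : R) + t) *: v) - f (z + t *: v))) =
         (fun h : R => h^-1 *: (f (h *: v + (z + t *: v)) - f (z + t *: v))).
  apply/funext => h; congr (_ *: (f _ - _)).
  by rewrite scalerDl addrCA /GRing.scale /= mulr1.
by apply: DeriveDef; rewrite /derivable /derive /= E.
Qed.

(* Otherwise comparing two directional derivatives along different vectors
   unfolds limits. *)
Local Opaque derive diff.

(** The second difference is estimated by one application of the mean value
    theorem in the direction v; the differentiability of D_v f at the single
    point x then suffices. *)
Lemma second_difference V (f : V -> R) x v w (e : R) : 0 < e ->
  (\forall z \near x, differentiable f z) ->
  differentiable (fun z => 'D_v f z) x ->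
  \forall h \near 0^'+,
    `|f (x + h *: v + h *: w) - f (x + h *: v) - f (x + h *: w) + f x
      - h ^+ 2 * 'D_w (fun z => 'D_v f z) x| <= e * h ^+ 2.
Proof.
move=> e0 df dF; set F := fun z => 'D_v f z in dF *.
(* K bounds the two error terms below; the summand 1 makes it positive. *)
pose K := `|w| + 2 * `|v| + 1.
have K0 : 0 < K by rewrite ltr_wpDl // addr_ge0 // mulr_ge0.
have eK : 0 < e / K by rewrite divr_gt0.
have /diff_locallyP[_ /eqaddoP /(_ _ eK)] := dF.
move=> /nbhs_normP[d1 /= d10 H1].
have /nbhs_normP[d2 /= d20 H2] := df.
pose d := Num.min d1 d2.
have d0 : 0 < d by rewrite lt_min d10 d20.
exists (d / K); first by rewrite /= divr_gt0.
move=> h /=; rewrite sub0r normrN => hd h0.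
have hK : h * K < d by move: hd; rewrite gtr0_norm // ltr_pdivlMr.
have small y : `|y| <= h * K ->
    differentiable f (x + y) /\
    `|F (x + y) - F x - 'd F x y| <= e / K * `|y|.
  move=> yhK; have yd : `|y| < d by exact: le_lt_trans hK.
  split.
    apply: H2; rewrite /= opprD addNKr normrN.
    by apply: lt_le_trans yd _; rewrite ge_min lexx orbT.
  have := H1 y; rewrite /= sub0r normrN => /(_ _).
  rewrite !fctE /= (addrC y x) opprD addrA; apply.
  by apply: lt_le_trans yd _; rewrite ge_min lexx.
have bound1 t : 0 <= t <= h -> `|h *: w + t *: v| <= h * K /\
    `|t *: v| <= h * K /\ `|h *: w + t *: v| + `|t *: v| <= h * K.
  move=> /andP[t0 th].
  have tv : `|t *: v| <= h * `|v|.
    by rewrite normrZ ger0_norm // ler_wpM2r.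
  have hw : `|h *: w| = h * `|w| by rewrite normrZ gtr0_norm.
  have hwtv : `|h *: w + t *: v| <= h * `|w| + h * `|v|.
    by apply: le_trans (ler_normD _ _) _; rewrite hw lerD2l.
  have hv0 : 0 <= h * `|v| by rewrite mulr_ge0 // ltW.
  have hw0 : 0 <= h * `|w| by rewrite mulr_ge0 // ltW.
  by split; [|split]; rewrite /K; lra.
pose phi t := f (x + (h *: w + t *: v)) - f (x + t *: v).
have dphi t : 0 <= t <= h ->
    is_derive t 1 phi (F (x + (h *: w + t *: v)) - F (x + t *: v)).
  move=> /bound1[b1 [b2 _]].
  have [df1 _] := small _ b1; have [df2 _] := small _ b2.
  have -> : phi = (fun s => f ((x + h *: w) + s *: v)) - (fun s => f (x + s *: v)).
    by apply/funext => s; rewrite /phi !fctE addrA.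
  rewrite addrA in df1 *.
  by apply: is_deriveB; apply: is_derive_line; exact: diff_derivable.
have [c c0h ->] : exists2 c, 0 <= c <= h &
  f (x + h *: v + h *: w) - f (x + h *: v) - f (x + h *: w) + f x =
    (F (x + (h *: w + c *: v)) - F (x + c *: v)) * h.
  have [t||c] := @MVT_segment R phi
    (fun t => F (x + (h *: w + t *: v)) - F (x + t *: v)) 0 h (ltW h0).
  - rewrite in_itv /= => /andP[t0 th]; apply: dphi.
    by rewrite !ltW.
  - apply: derivable_within_continuous => t; rewrite in_itv /= => t0h.
    by have [] := dphi t t0h.
  rewrite in_itv /= subr0 => c0h E; exists c => //; rewrite -E /phi.
  rewrite !scale0r !addr0 (addrAC x) (addrA x (h *: w)); ring.
have [b1 [b2 b3]] := bound1 _ c0h.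
have [_ s1] := small _ b1; have [_ s2] := small _ b2.
rewrite (_ : 'D_w F x = 'd F x w); last by rewrite deriveE.
have hne : `|h| = h by rewrite gtr0_norm.
set A := F (x + (h *: w + c *: v)) in s1 *; set B := F (x + c *: v) in s2 *.
have dlin : 'd F x (h *: w + c *: v) = h * 'd F x w + 'd F x (c *: v).
  by rewrite linearD linearZ.
have -> : (A - B) * h - h ^+ 2 * 'd F x w =
  ((A - F x - 'd F x (h *: w + c *: v)) - (B - F x - 'd F x (c *: v))) * h.
  by rewrite dlin; ring.
rewrite normrM hne expr2 mulrA ler_pM2r //.
apply: le_trans (ler_normB _ _) _; apply: le_trans (lerD s1 s2) _.
rewrite -mulrDr; apply: le_trans (ler_wpM2l (ltW eK) b3) _.
by rewrite mulrCA mulrC divfK ?gt_eqF.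
Qed.

(** The second difference is symmetric in v and w, and both second derivatives
    are its limits after division by h^2. *)
Lemma schwarz_scalar V (f : V -> R) x v w :
  (\forall z \near x, differentiable f z) ->
  differentiable (fun z => 'D_v f z) x -> differentiable (fun z => 'D_w f z) x ->
  'D_w (fun z => 'D_v f z) x = 'D_v (fun z => 'D_w f z) x.
Proof.
move=> df dv dw; apply/eqP; rewrite -subr_eq0 -normr_le0.
apply/ler_addgt0Pr => e e0; rewrite add0r.
have e20 : 0 < e / 2 by rewrite divr_gt0.
set P := 'D_w _ x; set Q := 'D_v _ x.
have H1 := second_difference w e20 df dv.
have H2 := second_difference v e20 df dw.
have [h [h0 B1 B2]] : exists h : R, [/\ 0 < h,
  `|f (x + h *: v + h *: w) - f (x + h *: v) - f (x + h *: w) + f x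
      - h ^+ 2 * P| <= e / 2 * h ^+ 2 &
  `|f (x + h *: w + h *: v) - f (x + h *: w) - f (x + h *: v) + f x
      - h ^+ 2 * Q| <= e / 2 * h ^+ 2].
  have [h [h0 [B1 B2]]] := filter_ex (filterI (nbhs_right_gt 0) (filterI H1 H2)).
  by exists h; split; [exact: h0|exact: B1|exact: B2].
have h20 : 0 < h ^+ 2 by rewrite exprn_gt0.
rewrite (addrAC x) in B2.
rewrite -(ler_pM2r h20) -[X in _ * X <= _](gtr0_norm h20) -normrM.
move: B1 B2; set a := f _; set b := f _; set c := f _ => B1 B2.
have -> : (P - Q) * h ^+ 2 = (a - c - b + f x - h ^+ 2 * Q) -
    (a - b - c + f x - h ^+ 2 * P) by ring.
apply: le_trans (ler_normB _ _) _; apply: le_trans (lerD B2 B1) _.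
by rewrite -mulrDl -splitr.
Qed.

Lemma schwarz_mx V m n (f : V -> 'M[R]_(m, n)) x v w :
  (\forall z \near x, differentiable f z) ->
  differentiable (fun z => 'D_v f z) x -> differentiable (fun z => 'D_w f z) x ->
  'D_w (fun z => 'D_v f z) x = 'D_v (fun z => 'D_w f z) x.
Proof.
move=> df dv dw; apply/matrixP => i j.
apply: (etrans (esym (derive_entry w i j dv))).
apply: (etrans _ (derive_entry v i j dw)).
have Dij u : \forall z \near x, ('D_u f z) i j = 'D_u (fun y => f y i j) z.
  by near=> z; rewrite derive_entry //; near: z.
rewrite (near_eq_derive _ (Dij v)) (near_eq_derive _ (Dij w)).
apply: schwarz_scalar.
- by near=> z; apply: differentiable_entry; near: z.
- by apply: differentiable_near (Dij v) _; exact: differentiable_entry.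
- by apply: differentiable_near (Dij w) _; exact: differentiable_entry.
Unshelve. all: by end_near. Qed.

End Schwarz.

(** * Closure properties of smooth functions *)

Section Smooth.
Context {R : realType}.
Implicit Types (V W : normedModType R).

Lemma Ck_le V W k (U : set V) (f : V -> W) : Ck_on k.+1 U f -> Ck_on k U f.
Proof.
elim: k f => [f [df _] x Ux|k IH f [df Df]].
  by apply: differentiable_continuous; exact: df.
by split=> // v; apply: IH; exact: Df.
Qed.

Lemma smooth_differentiable V W (U : set V) (f : V -> W) x :
  smooth_on U f -> U x -> differentiable f x.
Proof. by move=> /(_ 1)[df _] /df. Qed.

Lemma Ck_eq V W k (U : set V) (f g : V -> W) : open U ->
  (forall x, U x -> f x = g x) -> Ck_on k U f -> Ck_on k U g.
Proof.
move=> oU; elim: k f g => [f g fg cf x Ux|k IH f g fg [df Df]].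
  have fgx : \forall y \near x, f y = g y.
    by apply: filterS (open_nbhs_nbhs (conj oU Ux)).
  have : g @ x --> f x by exact: cvg_trans (near_eq_cvg fgx) (cf _ Ux).
  by rewrite (fg _ Ux).
have fgx x : U x -> \forall y \near x, f y = g y.
  by move=> Ux; apply: filterS (open_nbhs_nbhs (conj oU Ux)).
split=> [x Ux|v].
  by apply: differentiable_near (fgx x Ux) _; exact: df.
by apply: IH (Df v) => x Ux; apply: near_eq_derive; exact: fgx.
Qed.

Lemma Ck_cst V W k (U : set V) (a : W) : Ck_on k U (fun=> a).
Proof.
elim: k a => [a x _|k IH a]; first exact: cst_continuous.
split=> [x _|v]; first exact: differentiable_cst.
have -> : (fun x => 'D_v (fun=> a) x) = (fun=> 0 : W).
  by apply/funext => x; exact: derive_cst.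
exact: IH.
Qed.

Lemma Ck_add V W k (U : set V) (f g : V -> W) : open U ->
  Ck_on k U f -> Ck_on k U g -> Ck_on k U (fun x => f x + g x).
Proof.
move=> oU; elim: k f g => [f g cf cg x Ux|k IH f g [df Df] [dg Dg]].
  by apply: continuousD; [exact: cf|exact: cg].
split=> [x Ux|v]; first by apply: differentiableD; [exact: df|exact: dg].
apply: Ck_eq oU _ (IH _ _ (Df v) (Dg v)) => x Ux.
by rewrite -deriveD //; apply: diff_derivable; [exact: df|exact: dg].
Qed.

Lemma Ck_sum V W k (U : set V) n (f : 'I_n -> V -> W) : open U ->
  (forall i, Ck_on k U (f i)) -> Ck_on k U (fun x => \sum_i f i x).
Proof.
move=> oU cf; have -> : (fun x => \sum_i f i x) = \sum_i f i.
  by apply/funext => x; rewrite fct_sumE.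
elim/big_rec : _ => [|i g _]; first exact: Ck_cst.
by apply: Ck_add.
Qed.

Lemma continuous_mx V m n (M : V -> 'M[R]_(m, n)) x :
  (forall i j, {for x, continuous (fun y => M y i j)}) -> {for x, continuous M}.
Proof.
move=> cM; apply/cvgrPdist_lt => e e0; near=> y.
rewrite /Num.Def.normr /= mx_normrE (bigmax_lt _ e0) //= => -[i j] _ /=.
rewrite !mxE /=; move: i j.
near: y.
apply: filter_forall => i; apply: filter_forall => j.
by move/cvgrPdist_lt : (cM i j); exact.
Unshelve. all: by end_near. Qed.

Lemma continuous_entry V m n (M : V -> 'M[R]_(m, n)) x i j :
  {for x, continuous M} -> {for x, continuous (fun y => M y i j)}.
Proof.
move=> cM.
by apply: (continuous_comp (f := M) (g := fun N => N i j)) => //; exact: coord_continuous.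
Qed.

Lemma Ck_mx V m n k (U : set V) (M : V -> 'M[R]_(m, n)) : open U ->
  (forall i j, Ck_on k U (fun y => M y i j)) -> Ck_on k U M.
Proof.
move=> oU; elim: k M => [M cM x Ux|k IH M cM].
  by apply: continuous_mx => i j; exact: cM.
have dM x : U x -> differentiable M x.
  by move=> Ux; apply: differentiable_mx => i j; have [+ _] := cM i j; exact.
split=> // v; apply: IH => i j; have [_ /(_ v)] := cM i j.
by apply: Ck_eq => // x Ux; rewrite derive_entry //; exact: dM.
Qed.

Lemma Ck_entry V m n k (U : set V) (M : V -> 'M[R]_(m, n)) i j : open U ->
  Ck_on k U M -> Ck_on k U (fun y => M y i j).
Proof.
move=> oU; elim: k M => [M cM x Ux|k IH M [dM DM]].
  by apply: continuous_entry; exact: cM.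
split=> [x Ux|v]; first by apply: differentiable_entry; exact: dM.
by apply: Ck_eq (IH _ (DM v)) => // x Ux; rewrite derive_entry //; exact: dM.
Qed.

Lemma Ck_mul V k (U : set V) (f g : V -> R) : open U ->
  Ck_on k U f -> Ck_on k U g -> Ck_on k U (fun x => f x * g x).
Proof.
move=> oU; elim: k f g => [f g cf cg x Ux|k IH f g cf cg].
  by apply: continuousM; [exact: cf|exact: cg].
have [[df Df] [dg Dg]] := (cf, cg).
split=> [x Ux|v]; first by apply: differentiableM; [exact: df|exact: dg].
have := Ck_add oU (IH _ _ (Ck_le cf) (Dg v)) (IH _ _ (Ck_le cg) (Df v)).
apply: Ck_eq => // x Ux.
by rewrite (deriveM (f := f) (g := g)) //; apply: diff_derivable;
  [exact: df|exact: dg].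
Qed.

Lemma Ck_inv V k (U : set V) (f : V -> R) : open U ->
  (forall x, U x -> f x != 0) ->
  Ck_on k U f -> Ck_on k U (fun x => (f x)^-1).
Proof.
move=> oU f0; elim: k => [cf x Ux|k IH cf].
  by apply: continuousV; [exact: f0|exact: cf].
have [df Df] := cf; have ci := IH (Ck_le cf).
split=> [x Ux|v]; first by apply: differentiableV; [exact: df|exact: f0].
have := Ck_mul oU (Ck_mul oU (@Ck_cst _ _ k U (-1 : R)) (Ck_mul oU ci ci)) (Df v).
apply: Ck_eq => // x Ux.
rewrite (deriveV (f := f)) ?f0 //; last by apply: diff_derivable; exact: df.
by rewrite /GRing.scale /= mulN1r expr2 invfM.
Qed.

Lemma Ck_scalemx V m n k (U : set V) (a : V -> R) (M : V -> 'M[R]_(m, n)) :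
  open U -> Ck_on k U a -> Ck_on k U M -> Ck_on k U (fun x => a x *: M x).
Proof.
move=> oU ca cM; apply: Ck_mx => // i j.
under eq_fun do rewrite mxE.
by apply: Ck_mul => //; exact: Ck_entry.
Qed.

Lemma Ck_mulmx V m n p k (U : set V) (A : V -> 'M[R]_(m, n))
    (B : V -> 'M[R]_(n, p)) : open U ->
  Ck_on k U A -> Ck_on k U B -> Ck_on k U (fun x => A x *m B x).
Proof.
move=> oU cA cB; apply: Ck_mx => // i j.
under eq_fun do rewrite mxE.
by apply: Ck_sum => // l; apply: Ck_mul => //; exact: Ck_entry.
Qed.

Lemma Ck_trmx V m n k (U : set V) (A : V -> 'M[R]_(m, n)) : open U ->
  Ck_on k U A -> Ck_on k U (fun x => (A x)^T).
Proof.
move=> oU cA; apply: Ck_mx => // i j.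
under eq_fun do rewrite mxE.
exact: Ck_entry.
Qed.

Lemma Ck_row_mx V m n p k (U : set V) (A : V -> 'M[R]_(m, n))
    (B : V -> 'M[R]_(m, p)) : open U ->
  Ck_on k U A -> Ck_on k U B -> Ck_on k U (fun x => row_mx (A x) (B x)).
Proof.
move=> oU cA cB; apply: Ck_mx => // i j.
by case: (split_ordP j) => l ->;
  [under eq_fun do rewrite row_mxEl|under eq_fun do rewrite row_mxEr];
  exact: Ck_entry.
Qed.

Lemma Ck_id V k (U : set V) : Ck_on k U (id : V -> V).
Proof.
case: k => [x _|k]; first exact: cvg_id.
split=> [x _|v]; first exact: ex_diff.
have -> : (fun x : V => 'D_v id x) = (fun=> v).
  by apply/funext => x; exact: derive_id.
exact: Ck_cst.
Qed.

(** The outer function has a row vector as argument, so that the chain rule is a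
    finite sum of products of entries and partial derivatives, to which the
    induction hypothesis applies. *)
Lemma Ck_comp V n p q k (U : set V) (U' : set 'rV[R]_n) (f : V -> 'rV[R]_n)
    (F : 'rV[R]_n -> 'M[R]_(p, q)) : open U ->
  (forall x, U x -> U' (f x)) -> Ck_on k U f -> Ck_on k U' F ->
  Ck_on k U (fun x => F (f x)).
Proof.
move=> oU UU'; elim: k f F UU' => [f F UU' cf cF x Ux|k IH f F UU' cf cF].
  by apply: (continuous_comp (f := f) (g := F)); [exact: cf|apply: cF; exact: UU'].
have [[df Df] [dF DF]] := (cf, cF).
split=> [x Ux|v].
  by apply: (differentiable_comp (f := f) (g := F)); [exact: df|apply: dF; exact: UU'].
have : Ck_on k U (fun x => \sum_i ('D_v f x) ord0 i *: 'D_(bvec i) F (f x)).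
  apply: Ck_sum => // i; apply: Ck_scalemx => //.
    by apply: Ck_entry => //; exact: Df.
  apply: (IH f (fun z => 'D_(bvec i) F z)) => //; first exact: Ck_le.
  exact: DF.
apply: Ck_eq => // x Ux.
rewrite (derive_comp (f := f) (g := F)); [|exact: df|by apply: dF; exact: UU'].
by rewrite -derive_row //; apply: dF; exact: UU'.
Qed.

End Smooth.

(** * The Euclidean inner product of row vectors *)

Section Algebra.
Context {R : realType}.

Definition dot n (v w : 'rV[R]_n) : R := (v *m w^T) ord0 ord0.

Lemma dotE n (v w : 'rV[R]_n) : dot v w = \sum_i v ord0 i * w ord0 i.
Proof. by rewrite /dot mxE; apply: eq_bigr => i _; rewrite mxE. Qed.

Lemma dot_mx n (v w : 'rV[R]_n) : v *m w^T = (dot v w)%:M.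
Proof. exact: mx11_scalar. Qed.

Lemma derive_dot (V : normedModType R) n (a b : V -> 'rV[R]_n) x v :
  differentiable a x -> differentiable b x ->
  'D_v (fun y => dot (a y) (b y)) x = dot ('D_v a x) (b x) + dot (a x) ('D_v b x).
Proof.
move=> da db; have dbT := differentiable_trmx db.
have dab := differentiable_mulmx da dbT.
by rewrite /dot (derive_entry v _ _ dab) derive_mulmx // derive_trmx // mxE.
Qed.

Lemma dotC n (v w : 'rV[R]_n) : dot v w = dot w v.
Proof. by rewrite !dotE; apply: eq_bigr => i _; rewrite mulrC. Qed.

Lemma dotDl n (u v w : 'rV[R]_n) : dot (u + v) w = dot u w + dot v w.
Proof. by rewrite /dot mulmxDl mxE. Qed.

Lemma dotDr n (u v w : 'rV[R]_n) : dot u (v + w) = dot u v + dot u w.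
Proof. by rewrite !(dotC u) dotDl. Qed.

Lemma dotZl n a (v w : 'rV[R]_n) : dot (a *: v) w = a * dot v w.
Proof. by rewrite /dot -scalemxAl mxE. Qed.

Lemma dotZr n a (v w : 'rV[R]_n) : dot v (a *: w) = a * dot v w.
Proof. by rewrite dotC dotZl dotC. Qed.

Lemma dotNl n (v w : 'rV[R]_n) : dot (- v) w = - dot v w.
Proof. by rewrite -scaleN1r dotZl mulN1r. Qed.

Lemma dotNr n (v w : 'rV[R]_n) : dot v (- w) = - dot v w.
Proof. by rewrite dotC dotNl dotC. Qed.

Lemma dot0l n (w : 'rV[R]_n) : dot 0 w = 0.
Proof. by rewrite /dot mul0mx mxE. Qed.

Lemma dot0r n (w : 'rV[R]_n) : dot w 0 = 0.
Proof. by rewrite dotC dot0l. Qed.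

Lemma dot_sumr n I (s : seq I) (v : 'rV[R]_n) (w : I -> 'rV[R]_n) :
  dot v (\sum_(i <- s) w i) = \sum_(i <- s) dot v (w i).
Proof. by elim/big_rec2: _ => [|i x y _ <-]; rewrite ?dot0r ?dotDr. Qed.

Lemma dot_suml n I (s : seq I) (v : 'rV[R]_n) (w : I -> 'rV[R]_n) :
  dot (\sum_(i <- s) w i) v = \sum_(i <- s) dot (w i) v.
Proof. by rewrite dotC dot_sumr; apply: eq_bigr => i _; rewrite dotC. Qed.

Lemma dot_mulmxl m n (v : 'rV[R]_m) (A : 'M[R]_(m, n)) (w : 'rV[R]_n) :
  dot (v *m A) w = dot v (w *m A^T).
Proof. by rewrite /dot trmx_mul trmxK mulmxA. Qed.

Lemma dot_row_mx m n (a : 'rV[R]_m) (b : 'rV[R]_n) c d :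
  dot (row_mx a b) (row_mx c d) = dot a c + dot b d.
Proof. by rewrite /dot tr_row_mx mul_row_col mxE. Qed.

Lemma dot_eq0 n (v : 'rV[R]_n) : dot v v = 0 -> v = 0.
Proof.
rewrite dotE => /eqP; rewrite psumr_eq0 => [|i _]; last by rewrite -expr2 sqr_ge0.
move=> /allP h; apply/rowP => i; rewrite mxE.
by have := h i (mem_index_enum _); rewrite mulf_eq0 orbb => /eqP.
Qed.

Lemma dot_bvec n (v : 'rV[R]_n) k : dot (bvec k) v = v ord0 k.
Proof.
rewrite dotE (bigD1 k) //= big1 => [|i ik]; rewrite /bvec mxE ?eqxx ?mul1r ?addr0 //.
by rewrite (negPf ik) andbF mul0r.
Qed.

Lemma bilE n (A : 'M[R]_n) v w : bil A v w = dot (v *m A) w.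
Proof. by []. Qed.

Lemma linear_sum_fun (V W : lmodType R) (f : V -> W) : linear f ->
  forall n (a : 'I_n -> R) (v : 'I_n -> V),
  f (\sum_i a i *: v i) = \sum_i a i *: f (v i).
Proof.
move=> fl n a v; pose fM := GRing.isLinear.Build _ _ _ _ _ fl.
pose fL : {linear V -> W} := HB.pack f fM.
rewrite -[f]/(fL : V -> W) linear_sum.
by apply: eq_bigr => i _; rewrite linearZ.
Qed.

Lemma row_sum n (v : 'rV[R]_n) : v = \sum_i v ord0 i *: bvec i.
Proof. exact: row_sum_delta. Qed.

Lemma bvec_mul m n (A : 'M[R]_(m, n)) k : bvec k *m A = row k A.
Proof. by rewrite rowE. Qed.

(** The Gram matrix of independent rows is positive definite. *)
Lemma gram_unitmx m n (A : 'M[R]_(m, n)) :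
  (forall v : 'rV_m, v *m A = 0 -> v = 0) -> A *m A^T \in unitmx.
Proof.
move=> Ainj; rewrite -row_free_unit -kermx_eq0; apply/eqP/row_matrixP => i.
rewrite row0; apply: Ainj; apply: dot_eq0; set u := row i _.
have u0 : u *m (A *m A^T) = 0 by rewrite -row_mul mulmx_ker row0.
by rewrite /dot trmx_mul -mulmxA (mulmxA A) mulmxA u0 mul0mx mxE.
Qed.

End Algebra.

Local Opaque bil dot.

(** * Christoffel symbols *)

Section Christoffel.
Context {R : realType} {n : nat}.
Implicit Types (h : 'rV[R]_n -> 'M[R]_n) (x u v w l : 'rV[R]_n).

(** The Koszul formula for the basis vectors extends by linearity to all l; D i
    stands for the derivative of the metric in the i-th direction. *)
Lemma koszul_row (A B : 'M[R]_n) (D : 'I_n -> 'M[R]_n) v w l :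
  dot (\row_i (2^-1 * (bil A w (bvec i) + bil B v (bvec i) - bil (D i) v w))) l
  = 2^-1 * (bil A w l + bil B v l - bil (\sum_i l ord0 i *: D i) v w).
Proof.
have lE M z : bil M z l = \sum_i l ord0 i * bil M z (bvec i).
  by rewrite {1}(row_sum l) bilE dot_sumr; apply: eq_bigr => i _; rewrite dotZr.
rewrite (lE A w) (lE B v).
have -> : bil (\sum_i l ord0 i *: D i) v w = \sum_i l ord0 i * bil (D i) v w.
  rewrite bilE mulmx_sumr dot_suml; apply: eq_bigr => i _.
  by rewrite -scalemxAr dotZl.
rewrite dotE -big_split /= -sumrB mulr_sumr; apply: eq_bigr => i _.
rewrite mxE; move: (bil _ _ _) (bil _ _ _) (bil _ _ _) => a b c; ring.
Qed.

(** The inverse matrix in the definition of the Christoffel symbols cancels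
    when they are paired by the metric. *)
Lemma christoffel_dot h x v w l : h x \in unitmx -> differentiable h x ->
  bil (h x) (christoffel h x v w) l =
  2^-1 * (bil ('D_v h x) w l + bil ('D_w h x) v l - bil ('D_l h x) v w).
Proof.
move=> hu dh; rewrite bilE /christoffel mulmxKV // koszul_row.
by rewrite -derive_row.
Qed.

Lemma christoffel_linl h x w : differentiable h x ->
  linear (fun v => christoffel h x v w).
Proof.
move=> dh a u v; rewrite /christoffel scalemxAl -mulmxDl; congr (_ *m _).
apply/rowP => i; rewrite !mxE deriveDv // deriveZv //.
move: ('D_u h x) ('D_v h x) ('D_w h x) ('D_(bvec i) h x) => A B D K.
rewrite !bilE !mulmxDr !mulmxDl -!scalemxAr -!scalemxAl !dotDl !dotZl.
move: (dot _ _) (dot _ _) (dot _ _) (dot _ _) (dot _ _) (dot _ _) => ? ? ? ? ? ?; ring.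
Qed.

Lemma christoffel_linr h x v : differentiable h x ->
  linear (fun w => christoffel h x v w).
Proof.
move=> dh a u w; rewrite /christoffel scalemxAl -mulmxDl; congr (_ *m _).
apply/rowP => i; rewrite !mxE deriveDv // deriveZv //.
move: ('D_u h x) ('D_v h x) ('D_w h x) ('D_(bvec i) h x) => A B D K.
rewrite !bilE !mulmxDr !mulmxDl -!scalemxAr -!scalemxAl !dotDl !dotDr !dotZl !dotZr.
move: (dot _ _) (dot _ _) (dot _ _) (dot _ _) (dot _ _) (dot _ _) => ? ? ? ? ? ?; ring.
Qed.

Lemma christoffel0l h x w : differentiable h x -> christoffel h x 0 w = 0.
Proof.
move=> dh; have := linear_sum_fun (christoffel_linl w dh)
  (fun i : 'I_0 => 0) (fun i : 'I_0 => 0).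
by rewrite !big_ord0.
Qed.

End Christoffel.

(** * Orthonormal frames with constant structure functions *)

(** Row i of [E x] is the i-th vector of the frame at x, and [C i j] is the row
    of components of the bracket of the vectors i and j. *)
Record orthonormal_frame (R : realType) (n : nat) (U : set 'rV[R]_n)
    (g E : 'rV[R]_n -> 'M[R]_n) (C : 'I_n -> 'I_n -> 'rV[R]_n) : Prop :=
  OrthonormalFrame {
  frame_open : open U;
  frame_metric_smooth : smooth_on U g;
  frame_smooth : smooth_on U E;
  frame_metric_sym : forall x, U x -> (g x)^T = g x;
  frame_gram : forall x, U x -> E x *m g x *m (E x)^T = 1%:M;
  frame_bracket : forall x, U x -> forall i j,
    row j ('D_(row i (E x)) E x) - row i ('D_(row j (E x)) E x) = C i j *m E x
}.

(** Row i of this matrix is nabla_(e_j) e_i, by the Koszul formula for an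
    orthonormal frame. *)
Definition connection_coef (R : realType) (n : nat)
    (C : 'I_n -> 'I_n -> 'rV[R]_n) (j : 'I_n) : 'M[R]_n :=
  \matrix_(i, k) (2^-1 * (C j i ord0 k + C k j ord0 i + C k i ord0 j)).

Definition connection (R : realType) (n : nat)
    (C : 'I_n -> 'I_n -> 'rV[R]_n) (t : 'rV[R]_n) : 'M[R]_n :=
  \sum_j t ord0 j *: connection_coef C j.

Definition lie_op (R : realType) (n : nat)
    (C : 'I_n -> 'I_n -> 'rV[R]_n) (t u : 'rV[R]_n) : 'rV[R]_n :=
  \sum_i \sum_j (t ord0 i * u ord0 j) *: C i j.

Section Frame.
Context {R : realType} {n : nat}.
Variables (U : set 'rV[R]_n) (g E : 'rV[R]_n -> 'M[R]_n).
Variable (C : 'I_n -> 'I_n -> 'rV[R]_n).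
Hypothesis F : orthonormal_frame U g E C.

Let oU := frame_open F.

(** The components of v in the frame are [v *m coframe x]. *)
Definition coframe x : 'M[R]_n := g x *m (E x)^T.

Lemma frameK x : U x -> E x *m coframe x = 1%:M.
Proof. by move=> Ux; rewrite /coframe mulmxA (frame_gram F). Qed.

Lemma coframeK x : U x -> coframe x *m E x = 1%:M.
Proof. by move=> Ux; apply: mulmx1C; exact: frameK. Qed.

Lemma smooth_coframe : smooth_on U coframe.
Proof.
move=> k; apply: Ck_mulmx => //; first exact: (frame_metric_smooth F).
by apply: Ck_trmx => //; exact: (frame_smooth F).
Qed.

Lemma frame_differentiable x : U x -> differentiable E x.
Proof. by case: (frame_smooth F 1) => dE _; exact: dE. Qed.

Lemma metric_differentiable x : U x -> differentiable g x.
Proof. by case: (frame_metric_smooth F 1) => dE _; exact: dE. Qed.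

Lemma coframe_gram x : U x -> coframe x *m (coframe x)^T = g x.
Proof.
move=> Ux; rewrite {2}/coframe trmx_mul trmxK (frame_metric_sym F) //.
by rewrite mulmxA coframeK // mul1mx.
Qed.

Lemma metric_dot x v w : U x ->
  bil (g x) v w = dot (v *m coframe x) (w *m coframe x).
Proof.
by move=> Ux; rewrite bilE -coframe_gram // mulmxA dot_mulmxl trmxK.
Qed.

Lemma metric_unitmx x : U x -> g x \in unitmx.
Proof.
move=> Ux; have := frame_gram F Ux; rewrite -mulmxA => /mulmx1C.
by rewrite -mulmxA => /mulmx1_unit[].
Qed.

Lemma metric_inv x : U x -> invmx (g x) = (E x)^T *m E x.
Proof.
move=> Ux; have gu := metric_unitmx Ux.
by rewrite -[RHS](mulKmx gu) (mulmxA (g x)) -/(coframe x) coframeK // mulmx1.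
Qed.

Lemma bracket_antisym x i j : U x -> C i j = - C j i.
Proof.
move=> Ux.
have h k l : C k l =
    (row l ('D_(row k (E x)) E x) - row k ('D_(row l (E x)) E x)) *m coframe x.
  by rewrite (frame_bracket F) // -mulmxA frameK // mulmx1.
by rewrite (h i j) (h j i) -mulNmx opprB.
Qed.

(** Obtained by differentiating the orthonormality of the frame. *)
Lemma gram_derive x v : U x -> E x *m 'D_v g x *m (E x)^T =
  - ('D_v E x *m coframe x + ('D_v E x *m coframe x)^T).
Proof.
move=> Ux.
have dE := frame_differentiable Ux; have dg := metric_differentiable Ux.
have : 'D_v (fun y => E y *m g y *m (E y)^T) x = 0.
  rewrite (near_eq_derive (g := cst 1%:M)) ?derive_cst //.
  apply: filterS (open_nbhs_nbhs (conj oU Ux)) => y; exact: (frame_gram F).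
rewrite derive_mulmx; first last.
- exact: differentiable_trmx.
- exact: differentiable_mulmx.
rewrite derive_mulmx // derive_trmx // mulmxDl => /eqP.
rewrite (addrC (_ *m g x *m _)) -addrA addr_eq0 => /eqP ->.
rewrite /coframe !trmx_mul trmxK (frame_metric_sym F) //.
by rewrite !mulmxA.
Qed.

(** The derivatives of the metric are expressed by those of the frame, which
    then combine to the six terms of three brackets. *)
Lemma christoffel_frame x i j : U x ->
  christoffel g x (row j (E x)) (row i (E x)) + row i ('D_(row j (E x)) E x)
  = row i (connection_coef C j) *m E x.
Proof.
move=> Ux; have gu := metric_unitmx Ux; have dg := metric_differentiable Ux.
(* The derivatives are replaced by variables, which are compared faster. *)
have [DE hDE] : exists DE, forall k, 'D_(row k (E x)) E x = DE k.
  by exists (fun k => 'D_(row k (E x)) E x).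
have [Dg hDg] : exists Dg, forall k, 'D_(row k (E x)) g x = Dg k.
  by exists (fun k => 'D_(row k (E x)) g x).
pose B j := DE j *m coframe x.
have CB k l m : C k l ord0 m = B k l m - B l k m.
  have := frame_bracket F Ux k l; rewrite !hDE.
  move/(congr1 (mulmx^~ (coframe x))).
  rewrite -mulmxA frameK // mulmx1 mulmxBl -!row_mul -/(B k) -/(B l) => <-.
  by rewrite !mxE.
have gB k l m : bil (Dg k) (row l (E x)) (row m (E x)) = - (B k l m + B k m l).
  have := gram_derive (row k (E x)) Ux; rewrite hDE hDg => /matrixP/(_ l m).
  rewrite -/(B k) [RHS]mxE [X in - X]mxE [X in _ + X]mxE => <-.
  rewrite bilE dotE -row_mul mxE; apply: eq_bigr => s _.
  by rewrite !mxE.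
have cE := christoffel_dot (row j (E x)) (row i (E x)) _ gu dg.
rewrite hDE; move: (christoffel g x _ _) cE => w cE.
rewrite -[LHS]mulmx1 -(coframeK Ux) mulmxA; congr (_ *m _).
apply/rowP => k.
have wk : (w *m coframe x) ord0 k = bil (g x) w (row k (E x)).
  by rewrite bilE dotE /coframe mulmxA mxE; apply: eq_bigr => s _; rewrite !mxE.
have -> : ((w + row i (DE j)) *m coframe x) ord0 k =
    (w *m coframe x) ord0 k + B j i k.
  by rewrite mulmxDl mxE -row_mul; congr (_ + _); rewrite mxE.
rewrite wk cE !hDg !gB [RHS]mxE [RHS]mxE !CB.
move: (B j i k) (B j k i) (B i j k) (B i k j) (B k j i) (B k i j) => *; by field.
Qed.

Lemma christoffel_connection x (t u : 'rV[R]_n) : U x ->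
  christoffel g x (t *m E x) (u *m E x) + u *m 'D_(t *m E x) E x =
  u *m connection C t *m E x.
Proof.
move=> Ux; have dg := metric_differentiable Ux.
have dE := frame_differentiable Ux.
rewrite (mulmx_sum_row t (E x)) (mulmx_sum_row u (E x)).
rewrite (linear_sum_fun (christoffel_linl _ dg)).
rewrite derive_sumv // mulmx_sumr -big_split /=.
rewrite /connection mulmx_sumr mulmx_suml; apply: eq_bigr => j _.
rewrite (linear_sum_fun (christoffel_linr _ dg)) deriveZv // -!scalemxAr -scalemxAl.
rewrite -scalerDr; congr (_ *: _).
rewrite mulmx_sum_row (mulmx_sum_row u (connection_coef C j)) mulmx_suml -big_split /=.
apply: eq_bigr => i _.
by rewrite -scalerDr christoffel_frame // -scalemxAl.
Qed.

Lemma frame_lie_op x (t u : 'rV[R]_n) : U x ->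
  u *m 'D_(t *m E x) E x - t *m 'D_(u *m E x) E x = lie_op C t u *m E x.
Proof.
move=> Ux; have dE := frame_differentiable Ux.
have H (a b : 'rV[R]_n) : b *m 'D_(a *m E x) E x =
    \sum_i \sum_j (a ord0 i * b ord0 j) *: row j ('D_(row i (E x)) E x).
  rewrite (mulmx_sum_row a) derive_sumv // mulmx_sumr; apply: eq_bigr => i _.
  rewrite deriveZv // -scalemxAr mulmx_sum_row scaler_sumr.
  by apply: eq_bigr => j _; rewrite scalerA.
rewrite !H [X in _ - X]exchange_big /= -sumrB /lie_op mulmx_suml.
apply: eq_bigr => i _; rewrite -sumrB mulmx_suml; apply: eq_bigr => j _.
by rewrite (mulrC (u _ _)) -scalerBr (frame_bracket F) // scalemxAl.
Qed.

(** The connection is metric. *)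
Lemma connection_antisym x t (u : 'rV[R]_n) : U x -> dot (u *m connection C t) u = 0.
Proof.
move=> Ux.
suff : (connection C t)^T = - connection C t.
  move=> h; have := dot_mulmxl u (connection C t) u.
  rewrite h mulmxN dotNr (dotC u) => /eqP.
  by rewrite -addr_eq0 -mulr2n mulrn_eq0 /= => /eqP.
rewrite /connection linear_sum -sumrN; apply: eq_bigr => j _.
rewrite linearZ /= -scalerN; congr (_ *: _); apply/matrixP => i k; rewrite !mxE.
rewrite (bracket_antisym j i Ux) (bracket_antisym k j Ux) (bracket_antisym k i Ux).
rewrite !mxE; ring.
Qed.

(** The sum of the nabla_(e_k) e_k is the trace of ad, which vanishes for a
    unimodular algebra. *)
Lemma sum_connection x : U x -> (forall j, \sum_k C j k ord0 k = 0) ->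
  \sum_k row k (connection_coef C k) = 0.
Proof.
move=> Ux uni; apply/rowP => j; rewrite summxE mxE.
transitivity (\sum_k C j k ord0 k); last exact: uni.
apply: eq_bigr => k _; rewrite !mxE.
have -> : C k k ord0 j = 0.
  have /rowP/(_ j) := bracket_antisym k k Ux; rewrite mxE => h; lra.
by field.
Qed.

End Frame.

(** * The Sasaki metric in a frame *)

Lemma derive_lsubmx (R : realType) (V : normedModType R) m n1 n2
    (M : V -> 'M[R]_(m, n1 + n2)) x v : differentiable M x ->
  'D_v (fun y => lsubmx (M y)) x = lsubmx ('D_v M x) /\
  differentiable (fun y => lsubmx (M y)) x.
Proof.
move=> dM.
have dl : differentiable (fun y => lsubmx (M y)) x.
  apply: differentiable_mx => i j; under eq_fun do rewrite mxE.
  exact: differentiable_entry.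
split=> //; apply/matrixP => i j; rewrite mxE -derive_entry // -derive_entry //.
by under eq_fun do rewrite mxE.
Qed.

Lemma derive_rsubmx (R : realType) (V : normedModType R) m n1 n2
    (M : V -> 'M[R]_(m, n1 + n2)) x v : differentiable M x ->
  'D_v (fun y => rsubmx (M y)) x = rsubmx ('D_v M x) /\
  differentiable (fun y => rsubmx (M y)) x.
Proof.
move=> dM.
have dl : differentiable (fun y => rsubmx (M y)) x.
  apply: differentiable_mx => i j; under eq_fun do rewrite mxE.
  exact: differentiable_entry.
split=> //; apply/matrixP => i j; rewrite mxE -derive_entry // -derive_entry //.
by under eq_fun do rewrite mxE.
Qed.

Section Submx.
Context {R : realType} {V : normedModType R} {m n1 n2 : nat}.

Lemma Ck_lsubmx k (U : set V) (M : V -> 'M[R]_(m, n1 + n2)) : open U ->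
  Ck_on k U M -> Ck_on k U (fun x => lsubmx (M x)).
Proof.
move=> oU cM; apply: Ck_mx => // i j.
under eq_fun do rewrite mxE.
exact: Ck_entry.
Qed.

Lemma Ck_rsubmx k (U : set V) (M : V -> 'M[R]_(m, n1 + n2)) : open U ->
  Ck_on k U M -> Ck_on k U (fun x => rsubmx (M x)).
Proof.
move=> oU cM; apply: Ck_mx => // i j.
under eq_fun do rewrite mxE.
exact: Ck_entry.
Qed.

End Submx.

Section Connection.
Context {R : realType} {n : nat}.
Variable (C : 'I_n -> 'I_n -> 'rV[R]_n).

Lemma connectionD t u : connection C (t + u) = connection C t + connection C u.
Proof.
rewrite /connection -big_split /=; apply: eq_bigr => j _.
by rewrite mxE scalerDl.
Qed.

Lemma connectionZ a t : connection C (a *: t) = a *: connection C t.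
Proof.
rewrite /connection scaler_sumr; apply: eq_bigr => j _.
by rewrite mxE scalerA.
Qed.

Lemma connectionB t u : connection C (t - u) = connection C t - connection C u.
Proof. by rewrite connectionD -scaleN1r connectionZ scaleN1r. Qed.

Lemma connection_bvec k : connection C (bvec k) = connection_coef C k.
Proof.
rewrite /connection (bigD1 k) //= big1 => [|j jk]; rewrite /bvec mxE eqxx /=.
  by rewrite eqxx scale1r addr0.
by rewrite (negPf jk) scale0r.
Qed.

Lemma differentiable_connection (V : normedModType R) (t : V -> 'rV[R]_n) x :
  differentiable t x -> differentiable (fun y => connection C (t y)) x.
Proof.
move=> dt; apply: differentiable_fsum => j; apply: differentiable_scalemx => //.
exact: differentiable_entry.
Qed.

Lemma derive_connection (V : normedModType R) (t : V -> 'rV[R]_n) x v :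
  differentiable t x ->
  'D_v (fun y => connection C (t y)) x = connection C ('D_v t x).
Proof.
move=> dt; have dtj j : differentiable (fun y => t y ord0 j) x.
  exact: differentiable_entry.
rewrite derive_fsum => [|j]; last exact: differentiable_scalemx.
apply: eq_bigr => j _.
rewrite derive_scalemx // derive_cst scaler0 addr0.
by rewrite (derive_entry v ord0 j dt).
Qed.

Lemma Ck_connection (V : normedModType R) k (W : set V) (t : V -> 'rV[R]_n) :
  open W -> Ck_on k W t -> Ck_on k W (fun y => connection C (t y)).
Proof.
move=> oW ct; apply: Ck_sum => // j; apply: Ck_scalemx => //.
  exact: Ck_entry.
exact: Ck_cst.
Qed.

End Connection.

Section SasakiFrame.
Context {R : realType} {n : nat}.
Variables (U : set 'rV[R]_n) (g E : 'rV[R]_n -> 'M[R]_n).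
Variable (C : 'I_n -> 'I_n -> 'rV[R]_n).
Hypothesis F : orthonormal_frame U g E C.

Local Notation coframe := (coframe g E).

(** The components of V in the orthonormal frame of T(TM) formed by the
    horizontal and vertical lifts of the frame. *)
Definition frame_coord (z V : 'rV[R]_(n + n)) : 'rV[R]_(n + n) :=
  row_mx (hpart V *m coframe (lsubmx z)) (vpart g z V *m coframe (lsubmx z)).

Lemma sasaki_dot z V W : U (lsubmx z) ->
  sasaki g z V W = dot (frame_coord z V) (frame_coord z W).
Proof.
by move=> Uz; rewrite /sasaki !(metric_dot F) // -dot_row_mx.
Qed.

Lemma frame_coord_inj z V W : U (lsubmx z) ->
  frame_coord z V = frame_coord z W -> V = W.
Proof.
move=> Uz /eq_row_mx[h v].
have K (a b : 'rV[R]_n) : a *m coframe (lsubmx z) = b *m coframe (lsubmx z) -> a = b.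
  by move=> hab; rewrite -[a]mulmx1 -[b]mulmx1 -(coframeK F Uz) !(mulmxA _ (coframe _)) hab.
move: (K _ _ v); rewrite /vpart -/(hpart V) -/(hpart W) (K _ _ h) => /addIr rV.
by rewrite -[V]hsubmxK -[W]hsubmxK rV; congr (row_mx _ _); exact: K.
Qed.

Lemma frame_coord_hlift z Y :
  frame_coord z (hlift g z Y) = row_mx (Y *m coframe (lsubmx z)) 0.
Proof.
rewrite /frame_coord /hpart /vpart /hlift row_mxKl row_mxKr.
by rewrite addNr mul0mx.
Qed.

Lemma frame_coord0 z : U (lsubmx z) -> frame_coord z 0 = 0.
Proof.
move=> Uz; have dg := metric_differentiable F Uz.
by rewrite /frame_coord /hpart /vpart !linear0 christoffel0l // addr0 !mul0mx row_mx0.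
Qed.

End SasakiFrame.

(** * Structure equations of the unit tangent bundle *)

Section Parametrization.
Context {R : realType} {n : nat}.
Variables (U : set 'rV[R]_n) (g E : 'rV[R]_n -> 'M[R]_n).
Variable (C : 'I_n -> 'I_n -> 'rV[R]_n).
Hypothesis F : orthonormal_frame U g E C.
Let N := (n + n).-1.
Variables (W : set 'rV[R]_N) (psi : 'rV[R]_N -> 'rV[R]_(n + n)).
Hypothesis P : UM_param U g W psi.

Local Notation coframe := (coframe g E).

Let oW : open W. Proof. by case: P. Qed.
Let psi_smooth : smooth_on W psi. Proof. by case: P. Qed.
Let base s : 'rV[R]_n := lsubmx (psi s).
Let baseU s : W s -> U (base s).
Proof. by case: P => _ _ PU _ /PU[]. Qed.

(** With psi(s) = (x(s), sum_i u_i(s) e_i(x(s))), these are the components u,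
    and then those of the horizontal and of the vertical part of dpsi(v): the
    pull-backs of the canonical 1-forms and of the connection form. *)
Definition fibre s : 'rV[R]_n := rsubmx (psi s) *m coframe (lsubmx (psi s)).
Definition hform v s : 'rV[R]_n :=
  'D_v (fun s' => lsubmx (psi s')) s *m coframe (lsubmx (psi s)).
Definition vform v s : 'rV[R]_n :=
  'D_v fibre s + fibre s *m connection C (hform v s).

Let base_smooth : smooth_on W base.
Proof. by move=> k; exact: Ck_lsubmx. Qed.

Let coframe_base_smooth : smooth_on W (fun s => coframe (base s)).
Proof.
by move=> k; apply: (Ck_comp (U' := U)) => //; exact: (smooth_coframe F).
Qed.

Let frame_base_smooth : smooth_on W (fun s => E (base s)).
Proof.
by move=> k; apply: (Ck_comp (U' := U)) => //; exact: (frame_smooth F).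
Qed.

Lemma fibre_smooth : smooth_on W fibre.
Proof.
by move=> k; apply: Ck_mulmx => //; exact: Ck_rsubmx.
Qed.

Lemma hform_smooth v : smooth_on W (hform v).
Proof.
move=> k; apply: Ck_mulmx => //.
by have [_] := base_smooth k.+1; exact.
Qed.

Lemma vform_smooth v : smooth_on W (vform v).
Proof.
move=> k; apply: Ck_add => //; first by have [_] := fibre_smooth k.+1; exact.
apply: Ck_mulmx => //; first exact: (fibre_smooth k).
by apply: Ck_connection => //; exact: (hform_smooth v k).
Qed.

Let near_W s : W s -> \forall s' \near s, W s'.
Proof. by move=> Ws; exact: open_nbhs_nbhs. Qed.

Let schwarz m p (f : 'rV[R]_N -> 'M[R]_(m, p)) s v l : smooth_on W f -> W s ->
  'D_v (fun z => 'D_l f z) s = 'D_l (fun z => 'D_v f z) s.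
Proof.
move=> sf Ws; have [_ Df] := sf 2.
apply: schwarz_mx.
- by apply: filterS (near_W Ws) => z Wz; exact: smooth_differentiable sf Wz.
- by have [+ _] := Df l; exact.
- by have [+ _] := Df v; exact.
Qed.

Lemma base_derive s v : W s -> 'D_v base s = hform v s *m E (base s).
Proof.
by move=> Ws; rewrite /hform -mulmxA (coframeK F) ?mulmx1 //; exact: baseU.
Qed.

Lemma rsub_fibre s : W s -> rsubmx (psi s) = fibre s *m E (base s).
Proof.
by move=> Ws; rewrite /fibre -mulmxA (coframeK F) ?mulmx1 //; exact: baseU.
Qed.

Lemma frame_base_derive s v : W s ->
  'D_v (fun s' => E (base s')) s = 'D_(hform v s *m E (base s)) E (base s).
Proof.
move=> Ws; rewrite (derive_comp (f := base)) ?base_derive //.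
  exact: smooth_differentiable base_smooth Ws.
exact: smooth_differentiable (frame_smooth F) (baseU Ws).
Qed.

Lemma fibre_derive s v : W s -> 'D_v (fun s' => rsubmx (psi s')) s =
  'D_v fibre s *m E (base s) + fibre s *m 'D_(hform v s *m E (base s)) E (base s).
Proof.
move=> Ws; rewrite -frame_base_derive // -derive_mulmx.
- apply: near_eq_derive; apply: filterS (near_W Ws) => z Wz; exact: rsub_fibre.
- exact: smooth_differentiable fibre_smooth Ws.
- exact: smooth_differentiable frame_base_smooth Ws.
Qed.

(** The derivative of the frame in dpsi(v) and the Christoffel symbols of the
    vertical part combine to the connection of the frame. *)
Lemma frame_coord_psi s v : W s ->
  frame_coord g E (psi s) ('D_v psi s) = row_mx (hform v s) (vform v s).
Proof.
move=> Ws; have dpsi := smooth_differentiable psi_smooth Ws.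
rewrite /frame_coord /hpart /vpart.
rewrite -(derive_lsubmx v dpsi).1 -(derive_rsubmx v dpsi).1; congr row_mx.
rewrite fibre_derive // -/base base_derive // rsub_fibre //.
rewrite -addrA [X in _ + X]addrC (christoffel_connection F) ?baseU //.
rewrite -mulmxDl -mulmxA (frameK F) ?mulmx1 //; exact: baseU.
exact: baseU.
Qed.

(** The first structure equation, without torsion: it is the symmetry of the
    second derivatives of the base point of psi. *)
Lemma hform_structure s v l : W s ->
  'D_v (hform l) s - 'D_l (hform v) s = - lie_op C (hform v s) (hform l s).
Proof.
move=> Ws; have Us := baseU Ws.
have D a b : 'D_a (fun z => 'D_b base z) s =
    'D_a (hform b) s *m E (base s) + hform b s *m 'D_(hform a s *m E (base s)) E (base s).
  rewrite -frame_base_derive // -derive_mulmx.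
  - apply: near_eq_derive; apply: filterS (near_W Ws) => z Wz; exact: base_derive.
  - exact: smooth_differentiable (hform_smooth b) Ws.
  - exact: smooth_differentiable frame_base_smooth Ws.
have S := etrans (esym (D v l)) (etrans (schwarz v l base_smooth Ws) (D l v)).
have L := frame_lie_op F (hform v s) (hform l s) Us.
have K (a b : 'rV[R]_n) : a *m E (base s) = b *m E (base s) -> a = b.
  move=> ab; rewrite -[a]mulmx1 -[b]mulmx1 -(frameK F Us) !(mulmxA _ (E _)).
  by rewrite ab.
apply: K; rewrite mulmxBl mulNmx -L opprB.
exact: addr_swap S.
Qed.

(** The exterior derivative of du + u Gamma, by the symmetry of the second
    derivatives of u and the first structure equation. *)
Lemma vform_structure s v l : W s ->
  'D_v (vform l) s - 'D_l (vform v) s =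
  fibre s *m connection C (- lie_op C (hform v s) (hform l s))
  + 'D_v fibre s *m connection C (hform l s)
  - 'D_l fibre s *m connection C (hform v s).
Proof.
move=> Ws.
have D a b : 'D_a (vform b) s = 'D_a (fun z => 'D_b fibre z) s +
   ('D_a fibre s *m connection C (hform b s) + fibre s *m connection C ('D_a (hform b) s)).
  have dh := smooth_differentiable (hform_smooth b) Ws.
  have df := smooth_differentiable fibre_smooth Ws.
  have dc := differentiable_connection C dh.
  rewrite /vform deriveD; first last.
  - by apply: diff_derivable; exact: differentiable_mulmx.
  - apply: diff_derivable; have [_ /(_ b)[+ _]] := fibre_smooth 2; exact.
  by rewrite derive_mulmx // derive_connection.
rewrite -hform_structure // connectionB mulmxBr.
apply: etrans (congr2 (fun p q => p - q) (D v l) (D l v)) _.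
exact: addr_cancel (schwarz v l fibre_smooth Ws).
Qed.

Let hform_linear s : W s -> linear (fun v => hform v s).
Proof.
move=> Ws a u v; have db := smooth_differentiable base_smooth Ws.
by rewrite /hform deriveDv // deriveZv // mulmxDl scalemxAl.
Qed.

Let vform_linear s : W s -> linear (fun v => vform v s).
Proof.
move=> Ws a u v; have df := smooth_differentiable fibre_smooth Ws.
rewrite /vform hform_linear // deriveDv // deriveZv //.
move: ('D_u fibre s) ('D_v fibre s) => A B.
move: (hform u s) (hform v s) (fibre s) => hu hv w.
by rewrite connectionD connectionZ mulmxDr -scalemxAr scalerDr addrACA.
Qed.

(** Row a holds the components of the a-th partial derivative of psi, so that
    [v *m Omega s] are those of dpsi(v). *)
Definition Omega s : 'M[R]_(N, n + n) :=
  \matrix_(a, b) (row_mx (hform (bvec a) s) (vform (bvec a) s) : 'rV[R]_(n + n)) ord0 b.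

Lemma Omega_mul s v : W s -> v *m Omega s = row_mx (hform v s) (vform v s).
Proof.
move=> Ws; have lin : linear (fun v => row_mx (hform v s) (vform v s)).
  move=> a u w; rewrite hform_linear // vform_linear //.
  by rewrite scale_row_mx add_row_mx.
rewrite [in RHS](row_sum v) (linear_sum_fun lin) mulmx_sum_row.
apply: eq_bigr => i _; congr (_ *: _).
by apply/rowP => j; rewrite !mxE.
Qed.

Lemma Omega_smooth : smooth_on W Omega.
Proof.
move=> k; apply: Ck_mx => // a b.
under eq_fun do rewrite mxE.
apply: Ck_entry => //; apply: Ck_row_mx => //.
  exact: (hform_smooth _ k).
exact: (vform_smooth _ k).
Qed.

Lemma diff_psi s v : W s -> 'd psi s v = 'D_v psi s.
Proof. by move=> Ws; rewrite deriveE //; exact: smooth_differentiable psi_smooth Ws. Qed.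

Lemma frame_coord_dpsi s v : W s ->
  frame_coord g E (psi s) ('d psi s v) = v *m Omega s.
Proof. by move=> Ws; rewrite diff_psi // frame_coord_psi // Omega_mul. Qed.

Lemma UM_metricE s : W s -> UM_metric g psi s = Omega s *m (Omega s)^T.
Proof.
move=> Ws; apply/matrixP => a b; rewrite mxE.
rewrite (sasaki_dot F) ?frame_coord_dpsi //; last exact: baseU.
by rewrite !bvec_mul dotE mxE; apply: eq_bigr => i _; rewrite !mxE.
Qed.

Lemma Omega_inj s (v : 'rV[R]_N) : W s -> v *m Omega s = 0 -> v = 0.
Proof.
move=> Ws v0; case: P => _ _ _; apply; first exact: Ws.
apply: (frame_coord_inj F (baseU Ws)).
by rewrite frame_coord_dpsi // v0 (frame_coord0 F) //; exact: baseU.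
Qed.

Lemma UM_metric_unitmx s : W s -> UM_metric g psi s \in unitmx.
Proof.
by move=> Ws; rewrite UM_metricE //; apply: gram_unitmx => v; exact: Omega_inj.
Qed.

Lemma UM_metric_derive s v : W s -> differentiable (UM_metric g psi) s /\
  'D_v (UM_metric g psi) s =
    'D_v Omega s *m (Omega s)^T + Omega s *m ('D_v Omega s)^T.
Proof.
move=> Ws; have dO := smooth_differentiable Omega_smooth Ws.
have dOT := differentiable_trmx dO.
have E' : \forall z \near s, Omega z *m (Omega z)^T = UM_metric g psi z.
  by apply: filterS (near_W Ws) => z Wz; rewrite UM_metricE.
split.
  by apply: differentiable_near E' _; exact: differentiable_mulmx.
by rewrite -(near_eq_derive _ E') derive_mulmx // derive_trmx.
Qed.

Lemma fibre_unit s : W s -> dot (fibre s) (fibre s) = 1.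
Proof.
move=> Ws; case: P => _ _ PU _; have [Us <-] := PU s Ws.
by rewrite (metric_dot F).
Qed.

(** The vertical part of a vector tangent to UM is orthogonal to the fibre
    coordinate u, since u has constant length and the connection is metric. *)
Lemma vform_fibre s v : W s -> dot (vform v s) (fibre s) = 0.
Proof.
move=> Ws; rewrite /vform dotDl (connection_antisym F _ _ (baseU Ws)) addr0.
have df := smooth_differentiable fibre_smooth Ws.
have : 'D_v (fun z => dot (fibre z) (fibre z)) s = 0.
  apply: etrans (derive_cst (1 : R) s v); apply: near_eq_derive.
  by apply: filterS (near_W Ws) => z Wz; rewrite fibre_unit.
rewrite derive_dot // [X in _ + X]dotC => /eqP.
by rewrite -mulr2n mulrn_eq0 => /eqP.
Qed.

(** The derivative of psi is injective, so its image has dimension 2n - 1 and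
    fills the hyperplane found in [vform_fibre]. *)
Lemma Omega_sub s (c : 'rV[R]_(n + n)) : W s -> dot (rsubmx c) (fibre s) = 0 ->
  exists v : 'rV[R]_N, v *m Omega s = c.
Proof.
move=> Ws c0; pose K : 'M[R]_(n + n, 1) := col_mx 0 (fibre s)^T.
have rOm : \rank (Omega s) = N.
  apply/eqP; rewrite eqn_leq rank_leq_row /=.
  have := UM_metric_unitmx Ws; rewrite UM_metricE // => /mxrank_unit rN.
  by rewrite -[X in (X <= _)%N]rN; exact: mxrankM_maxl.
have K0 : K != 0.
  apply/eqP => /(congr1 dsubmx); rewrite col_mxKd linear0 => f0.
  by have := fibre_unit Ws; rewrite -[fibre s]trmxK f0 trmx0 dot0l => /eqP; rewrite eq_sym oner_eq0.
have rK : \rank K = 1%N.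
  by apply/eqP; rewrite eqn_leq rank_leq_col lt0n mxrank_eq0.
have OmK : (Omega s <= kermx K)%MS.
  apply/sub_kermxP/row_matrixP => a; rewrite row0 -bvec_mul mulmxA Omega_mul //.
  by rewrite mul_row_col mulmx0 add0r dot_mx vform_fibre // raddf0.
have cK : (c <= kermx K)%MS.
  by apply/sub_kermxP; rewrite -[c]hsubmxK mul_row_col mulmx0 add0r dot_mx c0 raddf0.
have : (kermx K <= Omega s)%MS.
  by rewrite -(geq_leqif (mxrank_leqif_sup OmK)) mxrank_ker rK rOm subn1.
by move=> /(submx_trans cK)/submxP[v ->]; exists v.
Qed.

End Parametrization.

(** * The trace in the tension field *)

Section NablaTrace.
Context {R : realType} {n p : nat}.
Variables (g : 'rV[R]_n -> 'M[R]_n) (h : 'rV[R]_p -> 'M[R]_p).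
Variables (O : set 'rV[R]_n) (f : 'rV[R]_n -> 'rV[R]_p) (x : 'rV[R]_n).
Hypotheses (oO : open O) (fO : smooth_on O f) (Ox : O x).
Hypotheses (dg : differentiable g x) (dh : differentiable h (f x)).

Let df z : O z -> differentiable f z.
Proof. by case: (fO 1) => + _; exact. Qed.

Let ddf v : differentiable (fun z => 'D_v f z) x.
Proof. by case: (fO 2) => _ /(_ v)[+ _]; exact. Qed.

Let linear_comb (v1 v2 v3 : 'rV[R]_n -> 'rV[R]_p) :
  linear v1 -> linear v2 -> linear v3 -> linear (fun v => v1 v - v2 v + v3 v).
Proof.
move=> l1 l2 l3 a u v; rewrite l1 l2 l3.
by rewrite opprD [LHS](AC (2*2*2) ((1*3*5)*(2*4*6))) /= -scalerN -!scalerDr.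
Qed.

Lemma nabla_d_linl w : linear (fun v => nabla_d g h f x v w).
Proof.
have dfx := df Ox; apply: linear_comb => a u v.
- by rewrite deriveDv // deriveZv.
- by rewrite christoffel_linl // deriveDv // deriveZv.
- by rewrite deriveDv // deriveZv // christoffel_linl.
Qed.

Lemma nabla_d_linr v : linear (fun w => nabla_d g h f x v w).
Proof.
have dfx := df Ox; apply: linear_comb => a u w.
- have E : \forall z \near x, 'D_(a *: u + w) f z = (a *: (fun z => 'D_u f z) + (fun z => 'D_w f z)) z.
    apply: filterS (open_nbhs_nbhs (conj oO Ox)) => z Oz.
    by rewrite deriveDv ?deriveZv //; exact: df.
  rewrite (near_eq_derive _ E) deriveD ?deriveZ //; first exact: diff_derivable.
  + by apply: derivableZ; exact: diff_derivable.
  + exact: diff_derivable.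
- by rewrite christoffel_linr // deriveDv // deriveZv.
- by rewrite deriveDv // deriveZv // christoffel_linr.
Qed.

(** The trace may be taken in any basis A in which the inverse metric is
    A^T A. *)
Lemma tension_frame (A : 'M[R]_n) : invmx (g x) = A^T *m A ->
  tension g h f x = \sum_k nabla_d g h f x (row k A) (row k A).
Proof.
move=> gA; rewrite /tension gA.
have E k : nabla_d g h f x (row k A) (row k A) =
    \sum_i \sum_j (A k i * A k j) *: nabla_d g h f x (bvec i) (bvec j).
  have -> : row k A = \sum_i A k i *: bvec i.
    by rewrite [LHS]row_sum; apply: eq_bigr => i _; rewrite mxE.
  rewrite (linear_sum_fun (nabla_d_linl _)); apply: eq_bigr => i _.
  rewrite (linear_sum_fun (nabla_d_linr _)) scaler_sumr; apply: eq_bigr => j _.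
  by rewrite scalerA.
under [RHS]eq_bigr do rewrite E.
rewrite [RHS]exchange_big; apply: eq_bigr => i _ /=.
rewrite [RHS]exchange_big; apply: eq_bigr => j _ /=.
rewrite -scaler_suml mxE; congr (_ *: _); apply: eq_bigr => k _.
by rewrite mxE.
Qed.

End NablaTrace.

(** * The tension field of a unit field with constant components *)

(** The inner product of the tension field with a vector tangent to UM at
    sum_i a_i e_i whose horizontal part is t and whose vertical part is
    nabla_t a + b. *)
Definition tension_form (R : realType) (n : nat)
    (C : 'I_n -> 'I_n -> 'rV[R]_n) (a t b : 'rV[R]_n) : R :=
  \sum_k (dot (bvec k) (- lie_op C (bvec k) t) +
    dot (a *m connection_coef C k)
      (a *m connection C (- lie_op C (bvec k) t) - b *m connection_coef C k)).

(** If a metric is M M^T, its Christoffel symbols are given by the derivatives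
    of M: here Q and Q' are the derivatives of M in the directions v and l. The
    second inner product is v against the exterior derivative of M. *)
Lemma gram_koszul (R : realType) N m (M Q Q' : 'M[R]_(N, m)) (p v l : 'rV[R]_N) :
  bil (M *m M^T) p l +
    2^-1 * (bil (Q *m M^T + M *m Q^T) v l + bil (Q *m M^T + M *m Q^T) v l
            - bil (Q' *m M^T + M *m Q'^T) v v) =
  dot (p *m M + v *m Q) (l *m M) + dot (v *m M) (l *m Q - v *m Q').
Proof.
have H (A B : 'M[R]_(N, m)) u w : dot (u *m (A *m B^T)) w = dot (u *m A) (w *m B).
  by rewrite mulmxA dot_mulmxl trmxK.
rewrite !bilE !mulmxDr !H !dotDl !H dotDr dotNr (dotC (v *m Q') (v *m M)).
move: (dot _ _) (dot _ _) (dot _ _) (dot _ _) => w x y z; lra.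
Qed.

Section UnitField.
Context {R : realType} {n : nat}.
Variables (U : set 'rV[R]_n) (g E : 'rV[R]_n -> 'M[R]_n).
Variable (C : 'I_n -> 'I_n -> 'rV[R]_n).
Hypothesis F : orthonormal_frame U g E C.
Let N := (n + n).-1.
Variables (W : set 'rV[R]_N) (psi : 'rV[R]_N -> 'rV[R]_(n + n)).
Hypothesis P : UM_param U g W psi.
Variables (a : 'rV[R]_n) (O : set 'rV[R]_n) (f : 'rV[R]_n -> 'rV[R]_N).
Hypotheses (oO : open O) (fO : smooth_on O f).
Hypothesis fP : forall z, O z -> W (f z) /\ psi (f z) = row_mx z (a *m E z).

Let near_O z : O z -> \forall z' \near z, O z'.
Proof. by move=> Oz; exact: open_nbhs_nbhs. Qed.

Let fW z : O z -> W (f z). Proof. by case/fP. Qed.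

Lemma base_f z : O z -> lsubmx (psi (f z)) = z.
Proof. by case/fP => _ ->; rewrite row_mxKl. Qed.

Let OU z : O z -> U z.
Proof.
move=> Oz; case: P => _ _ PU _; have [] := PU _ (fW Oz).
by rewrite base_f.
Qed.

Lemma fibre_f z : O z -> fibre g E psi (f z) = a.
Proof.
move=> Oz; have [_ e] := fP Oz.
by rewrite /fibre e row_mxKl row_mxKr -mulmxA (frameK F) ?mulmx1 //; exact: OU.
Qed.

Let dpsi_base s : W s -> differentiable (fun s => lsubmx (psi s)) s.
Proof.
move=> Ws; case: P => _ spsi _ _; have dpsi := smooth_differentiable spsi Ws.
exact: (derive_lsubmx 0 dpsi).2.
Qed.

Lemma hform_f z t : O z ->
  hform g E psi ('D_(t *m E z) f z) (f z) = t.
Proof.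
move=> Oz; have df := smooth_differentiable fO Oz.
rewrite /hform -(derive_comp (f := f)) //; last exact/dpsi_base/fW.
have H : \forall z' \near z, lsubmx (psi (f z')) = id z'.
  by apply: filterS (near_O Oz) => z' Oz'; rewrite base_f.
rewrite (near_eq_derive _ H) derive_id base_f //.
by rewrite -mulmxA (frameK F) ?mulmx1 //; exact: OU.
Qed.

Lemma fibre_derive_f z v : O z -> 'D_('D_v f z) (fibre g E psi) (f z) = 0.
Proof.
move=> Oz; have df := smooth_differentiable fO Oz.
rewrite -(derive_comp (f := f)) //; last first.
  exact: smooth_differentiable (fibre_smooth F P) (fW Oz).
apply: etrans (derive_cst a z v); apply: near_eq_derive.
by apply: filterS (near_O Oz) => z' Oz'; rewrite fibre_f.
Qed.

Lemma vform_f z t : O z ->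
  vform g E C psi ('D_(t *m E z) f z) (f z) = a *m connection C t.
Proof.
by move=> Oz; rewrite /vform fibre_derive_f // fibre_f // hform_f // add0r.
Qed.

Local Notation Om := (Omega g E C psi).

Lemma Omega_f z t : O z -> 'D_(t *m E z) f z *m Om (f z) = row_mx t (a *m connection C t).
Proof.
by move=> Oz; rewrite (Omega_mul F P) ?hform_f ?vform_f //; exact: fW.
Qed.

(** Differentiating along e_k the constant components of df(e_k) given by
    [Omega_f]: this eliminates the second derivative of f. *)
Lemma Omega_f_derive x k : O x ->
  let w := row k (E x) in
  ('D_w (fun z => 'D_w f z) x + 'D_(row k ('D_w E x)) f x) *m Om (f x)
  + 'D_w f x *m 'D_('D_w f x) Om (f x) = 0.
Proof.
move=> Ox w.
(* The Jacobian matrix makes the varying direction a matrix factor. *)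
pose J z := \matrix_(i, j) ('D_(bvec i) f z) ord0 j.
have JE z v : O z -> v *m J z = 'D_v f z.
  move=> Oz; rewrite mulmx_sum_row (derive_row v (smooth_differentiable fO Oz)).
  by apply: eq_bigr => i _; congr (_ *: _); apply/rowP => j; rewrite !mxE.
have ddf v : differentiable (fun z => 'D_v f z) x.
  by case: (fO 2) => _ /(_ v)[+ _]; exact.
have dJ : differentiable J x.
  apply: differentiable_mx => i j; under eq_fun do rewrite mxE.
  exact: differentiable_entry.
have dE := smooth_differentiable (frame_smooth F) (OU Ox).
have dOm : differentiable (fun z => Om (f z)) x.
  apply: (differentiable_comp (f := f)); first exact: smooth_differentiable fO Ox.
  exact: smooth_differentiable (Omega_smooth F P) (fW Ox).
have dDf := differentiable_mulmx dE dJ.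
have dA : differentiable (fun z => bvec k *m (E z *m J z)) x.
  exact: differentiable_mulmx.
have K0 : 'D_w (fun z => bvec k *m (E z *m J z) *m Om (f z)) x = 0.
  apply: etrans (derive_cst (row_mx (bvec k) (a *m connection C (bvec k))) x w).
  apply: near_eq_derive; apply: filterS (near_O Ox) => z Oz.
  by rewrite mulmxA JE // Omega_f.
have E1 := derive_mulmx w dA dOm.
have E2 := etrans (derive_mulmxl (bvec k) w dDf)
  (congr1 (mulmx (bvec k)) (derive_mulmx w dE dJ)).
have dOmf : differentiable Om (f x) by exact: smooth_differentiable (Omega_smooth F P) (fW Ox).
have E3 := derive_comp w (smooth_differentiable fO Ox) dOmf.
have E4 : w *m 'D_w J x = 'D_w (fun z => 'D_w f z) x.
  apply: etrans (esym (derive_mulmxl w w dJ)) _; apply: near_eq_derive.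
  by apply: filterS (near_O Ox) => z Oz; rewrite JE.
have E5 : bvec k *m (E x *m J x) = 'D_w f x.
  by rewrite mulmxA bvec_mul JE.
have E6 : bvec k *m ('D_w E x *m J x) = 'D_(row k ('D_w E x)) f x.
  apply: etrans (mulmxA _ _ _) (etrans _ (JE x _ Ox)).
  exact: (congr1 (fun A => A *m J x) (bvec_mul ('D_w E x) k)).
have E7 : bvec k *m (E x *m 'D_w J x) = 'D_w (fun z => 'D_w f z) x.
  apply: etrans (mulmxA _ _ _) (etrans _ E4).
  have Ew : bvec k *m E x = w by rewrite bvec_mul.
  by rewrite Ew.
have E8 : 'D_w (fun z => 'D_w f z) x + 'D_(row k ('D_w E x)) f x =
    'D_w (fun z => bvec k *m (E z *m J z)) x.
  apply: etrans (esym E2); apply: etrans (esym (mulmxDr _ _ _)).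
  by apply: etrans (addrC _ _) (congr2 +%R (esym E6) (esym E7)).
exact: etrans (congr2 +%R (congr1 (mulmx^~ (Om (f x))) E8)
  (congr2 mulmx (esym E5) (esym E3))) (etrans (esym E1) K0).
Qed.

(** The structure equations, evaluated on df(e_k) and l; the components u are
    constant along the field, so one of the three terms vanishes. *)
Lemma Omega_structure x l k : O x ->
  let v := 'D_(row k (E x)) f x in
  l *m 'D_v Om (f x) - v *m 'D_l Om (f x) =
  row_mx (- lie_op C (bvec k) (hform g E psi l (f x)))
    (a *m connection C (- lie_op C (bvec k) (hform g E psi l (f x)))
     - 'D_l (fibre g E psi) (f x) *m connection_coef C k).
Proof.
move=> Ox v; have Wx := fW Ox.
have dOm := smooth_differentiable (Omega_smooth F P) Wx.
have D (u u' : 'rV[R]_N) : u *m 'D_u' Om (f x) =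
    row_mx ('D_u' (hform g E psi u) (f x)) ('D_u' (vform g E C psi u) (f x)).
  apply: etrans (esym (derive_mulmxl u u' dOm)) _.
  rewrite -derive_row_mx.
  - apply: near_eq_derive; have oW : open W by case: P.
    by apply: filterS (open_nbhs_nbhs (conj oW Wx)) => s Ws; rewrite (Omega_mul F P).
  - exact: smooth_differentiable (hform_smooth F P u) Wx.
  - exact: smooth_differentiable (vform_smooth F P u) Wx.
have hv : hform g E psi v (f x) = bvec k.
  by rewrite /v -bvec_mul hform_f.
have S1 := hform_structure F P v l Wx.
have S2 := vform_structure F P v l Wx.
have fv : 'D_v (fibre g E psi) (f x) = 0 := fibre_derive_f _ Ox.
rewrite hv fv mul0mx addr0 fibre_f // connection_bvec in S2.
rewrite hv in S1.
apply: etrans (congr2 (fun p q => p - q) (D l v) (D v l)) _.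
by rewrite opp_row_mx add_row_mx; apply: congr2 S1 S2.
Qed.

(** For each k, [gram_koszul] leaves the exterior derivative of Omega, which is
    the k-th term of [tension_form], and a term T k; by [Omega_f_derive] the
    latter is minus the inner product of l with df(nabla_(e_k) e_k), and these
    terms sum to 0. *)
Lemma tension_pairing x l : O x -> (forall j, \sum_k C j k ord0 k = 0) ->
  bil (UM_metric g psi (f x)) (tension g (UM_metric g psi) f x) l =
  tension_form C a (hform g E psi l (f x)) ('D_l (fibre g E psi) (f x)).
Proof.
move=> Ox uni; have Ux := OU Ox; have Wx := fW Ox.
have dg := metric_differentiable F Ux.
have [dh _] := UM_metric_derive F P 0 Wx.
have Dh u : 'D_u (UM_metric g psi) (f x) =
    'D_u Om (f x) *m (Om (f x))^T + Om (f x) *m ('D_u Om (f x))^T.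
  by have [] := UM_metric_derive F P u Wx.
have hu := UM_metric_unitmx F P Wx.
rewrite (tension_frame oO fO Ox dg dh (metric_inv F Ux)).
rewrite bilE mulmx_suml dot_suml.
pose r k := row k (connection_coef C k).
pose T k := dot (- row_mx (r k) (a *m connection C (r k))) (l *m Om (f x)).
transitivity (\sum_k (T k + (dot (bvec k) (- lie_op C (bvec k) (hform g E psi l (f x))) +
    dot (a *m connection_coef C k)
      (a *m connection C (- lie_op C (bvec k) (hform g E psi l (f x)))
       - 'D_l (fibre g E psi) (f x) *m connection_coef C k)))); last first.
  rewrite big_split /= [X in X + _](_ : _ = 0) ?add0r //.
  rewrite /T -dot_suml sumrN.
  have -> : \sum_k row_mx (r k) (a *m connection C (r k)) =
      row_mx (\sum_k r k) (a *m connection C (\sum_k r k)).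
    elim/big_rec2 : _ => [|k u v _ ->].
      rewrite (_ : connection C 0 = 0) ?mulmx0 ?row_mx0 //.
      by rewrite -(subrr 0) connectionB subrr.
    by rewrite connectionD mulmxDr add_row_mx.
  rewrite (sum_connection F Ux uni) (_ : connection C 0 = 0).
    by rewrite mulmx0 row_mx0 oppr0 dot0l.
  by rewrite -(subrr 0) connectionB subrr.
apply: eq_bigr => k _; rewrite -bilE.
set w := row k (E x).
have S := Omega_structure l k Ox.
have D := Omega_f_derive k Ox.
have Ow := Omega_f (bvec k) Ox; rewrite bvec_mul in Ow.
have Or := Omega_f (r k) Ox.
rewrite connection_bvec -/w in Ow.
move: S D; rewrite -/w /= => S D.
have Gr : christoffel g x w w + row k ('D_w E x) = r k *m E x.
  exact: (christoffel_frame F k k Ux).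
have dfx := smooth_differentiable fO Ox.
have DG : 'D_(christoffel g x w w) f x + 'D_(row k ('D_w E x)) f x = 'D_(r k *m E x) f x.
  by rewrite -Gr deriveDv.
rewrite /nabla_d bilE mulmxDl dotDl -!bilE.
rewrite (christoffel_dot _ _ _ hu dh) !Dh (UM_metricE F P Wx) gram_koszul S Ow.
rewrite dot_row_mx; congr (_ + _).
rewrite /T -Or -DG; congr (dot _ _).
by move: D; rewrite !mulmxBl !mulmxDl; exact: addr_balance.
Qed.

(** Both sides are tangent to UM, by [Omega_sub], and so are equal when they
    have the same inner products with all tangent vectors. These are
    parametrized by the components t and b of [tension_form], with b
    orthogonal to a. *)
Lemma tension_hliftP x (c : 'rV[R]_n) : O x ->
  (forall j, \sum_k C j k ord0 k = 0) ->
  'd psi (f x) (tension g (UM_metric g psi) f x) = hlift g (psi (f x)) (c *m E x)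
  <-> (forall t b, dot b a = 0 -> dot c t = tension_form C a t b).
Proof.
move=> Ox uni; have Ux := OU Ox; have Wx := fW Ox.
set tau := tension g (UM_metric g psi) f x.
have Upsi : U (lsubmx (psi (f x))) by rewrite base_f.
have bilM (u l : 'rV[R]_N) : bil (UM_metric g psi (f x)) u l =
    dot (u *m Om (f x)) (l *m Om (f x)).
  by rewrite (UM_metricE F P Wx) bilE mulmxA dot_mulmxl trmxK.
have pair l : dot (tau *m Om (f x)) (l *m Om (f x)) =
    tension_form C a (hform g E psi l (f x)) ('D_l (fibre g E psi) (f x)).
  by rewrite -bilM; exact: tension_pairing.
have hc : frame_coord g E (psi (f x)) (hlift g (psi (f x)) (c *m E x)) = row_mx c 0.
  by rewrite frame_coord_hlift // base_f // -mulmxA (frameK F) // mulmx1.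
split=> [tauE t b ba | H].
- have [|l lE] := Omega_sub F P (c := row_mx t (b + a *m connection C t)) Wx.
    by rewrite row_mxKr fibre_f // dotDl ba (connection_antisym F _ _ Ux) addr0.
  have := lE; rewrite (Omega_mul F P) // => /eq_row_mx[ht vt].
  have bE : 'D_l (fibre g E psi) (f x) = b.
    by move: vt; rewrite /vform ht fibre_f // => /addIr.
  have := pair l; rewrite bE ht => <-.
  rewrite -(frame_coord_dpsi F P tau Wx) tauE hc lE dot_row_mx dot0l addr0 //.
- have [|l0 l0E] := Omega_sub F P (c := row_mx c 0) Wx.
    by rewrite row_mxKr dot0l.
  suff -> : tau = l0.
    apply: (frame_coord_inj F Upsi); rewrite hc.
    by rewrite (frame_coord_dpsi F P _ Wx).
  apply/eqP; rewrite -subr_eq0; apply/eqP; apply: (Omega_inj F P Wx).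
  have eqp l : dot ((tau - l0) *m Om (f x)) (l *m Om (f x)) = 0.
    rewrite mulmxBl dotDl dotNl pair l0E -H; last first.
      have := vform_fibre F P l Wx; rewrite /vform dotDl.
      by rewrite (connection_antisym F _ _ Ux) addr0 fibre_f.
    by rewrite (Omega_mul F P) // dot_row_mx dot0l addr0 subrr.
  exact/dot_eq0/eqp.
Qed.

End UnitField.

(** * A parametrization of the unit tangent bundle through a given field *)

Section Stereographic.
Context {R : realType} {n : nat}.
Variables (U : set 'rV[R]_n) (g E : 'rV[R]_n -> 'M[R]_n).
Variable (C : 'I_n -> 'I_n -> 'rV[R]_n).
Hypothesis F : orthonormal_frame U g E C.
Variables (a : 'rV[R]_n).
Hypothesis a1 : dot a a = 1.
Let N := (n + n).-1.

(** The rows of K form a basis of the pairs (y, w) with w orthogonal to a: a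
    linear model of UM at a. *)
Lemma tangent_model : exists K : 'M[R]_(N, n + n),
  [/\ forall v : 'rV[R]_N, v *m K = 0 -> v = 0,
      forall v : 'rV[R]_N, dot (rsubmx (v *m K)) a = 0 &
      forall z : 'rV[R]_n, exists v : 'rV[R]_N, v *m K = row_mx z 0].
Proof.
pose A : 'M[R]_(n + n, 1) := col_mx 0 a^T.
have A0 : A != 0.
  apply/eqP => /(congr1 dsubmx); rewrite col_mxKd linear0 => a0.
  by have := a1; rewrite -[a]trmxK a0 trmx0 dot0l => /eqP; rewrite eq_sym oner_eq0.
have rK : \rank (kermx A) = N.
  have -> : N = (n + n - 1)%N by rewrite subn1.
  rewrite mxrank_ker; congr (_ - _)%N.
  by apply/eqP; rewrite eqn_leq rank_leq_col lt0n mxrank_eq0.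
pose K : 'M[R]_(N, n + n) := castmx (rK, erefl) (row_base (kermx A)).
have KA : (K :=: kermx A)%MS by apply: eqmx_trans (eqmx_cast _ _) (eq_row_base _).
have inK (v : 'rV[R]_(n + n)) : (v <= K)%MS = (dot (rsubmx v) a == 0).
  have vA : v *m A = (dot (rsubmx v) a)%:M.
    by rewrite -[X in X *m _]hsubmxK mul_row_col mulmx0 add0r dot_mx.
  rewrite KA; apply/sub_kermxP/eqP; rewrite vA; last by move=> ->; rewrite raddf0.
  by move/matrixP/(_ ord0 ord0); rewrite !mxE eqxx.
exists K; split=> [v vK|v|z].
- have fK : row_free K by rewrite /row_free KA rK.
  by rewrite -[v](mulmxKp fK) vK mul0mx.
- by apply/eqP; rewrite -inK submxMl.
- have : (row_mx z 0 <= K)%MS by rewrite inK row_mxKr dot0l.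
  by move/submxP => [v ->]; exists v.
Qed.

Variable K : 'M[R]_(N, n + n).
Hypothesis K_inj : forall v : 'rV[R]_N, v *m K = 0 -> v = 0.
Hypothesis K_orth : forall v : 'rV[R]_N, dot (rsubmx (v *m K)) a = 0.
Hypothesis K_base : forall z : 'rV[R]_n, exists v : 'rV[R]_N, v *m K = row_mx z 0.

(** Inverse stereographic projection from - a of the hyperplane orthogonal to
    a: the point - a + 2 (a + w) / (1 + |w|^2) is a for w = 0. *)
Definition stereo_coef s : R := 2 / (1 + dot (s *m rsubmx K) (s *m rsubmx K)).
Definition stereo s : 'rV[R]_n := - a + stereo_coef s *: (a + s *m rsubmx K).
Definition stereo_param s : 'rV[R]_(n + n) :=
  row_mx (s *m lsubmx K) (stereo s *m E (s *m lsubmx K)).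
Definition stereo_dom : set 'rV[R]_N := [set s | U (s *m lsubmx K)].
Definition stereo_section (z : 'rV[R]_n) : 'rV[R]_N := row_mx z 0 *m pinvmx K.

Let lin_smooth m k (W : set 'rV[R]_N) (B : 'M[R]_(N, m)) :
  open W -> Ck_on k W (fun s => s *m B).
Proof. by move=> oW; apply: Ck_mulmx => //; [exact: Ck_id|exact: Ck_cst]. Qed.

Let open_dom : open stereo_dom.
Proof.
apply: open_comp (frame_open F) => s _.
by have := @lin_smooth _ 0 setT (lsubmx K) openT; exact.
Qed.

Let orth s : dot (s *m rsubmx K) a = 0.
Proof. by rewrite -[RHS](K_orth s) -{2}[K]hsubmxK mul_mx_row row_mxKr. Qed.

Let den_gt0 s : 0 < 1 + dot (s *m rsubmx K) (s *m rsubmx K).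
Proof.
rewrite ltr_pwDl // dotE sumr_ge0 // => i _.
by rewrite -expr2 sqr_ge0.
Qed.

Let coef_smooth k : Ck_on k stereo_dom stereo_coef.
Proof.
apply: Ck_mul => //; first exact: Ck_cst.
apply: Ck_inv => // [s _|]; first by rewrite gt_eqF.
apply: Ck_add => //; first exact: Ck_cst.
under eq_fun do rewrite dotE.
apply: Ck_sum => // i; apply: Ck_mul => //; apply: Ck_entry => //; exact: lin_smooth.
Qed.

Let stereo_smooth k : Ck_on k stereo_dom stereo.
Proof.
apply: Ck_add => //; first exact: Ck_cst.
apply: Ck_scalemx => //; apply: Ck_add => //; first exact: Ck_cst.
exact: lin_smooth.
Qed.

Let E_smooth k : Ck_on k stereo_dom (fun s => E (s *m lsubmx K)).
Proof.
apply: (Ck_comp (U' := U)) => //; first exact: lin_smooth.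
exact: (frame_smooth F).
Qed.

Let param_smooth k : Ck_on k stereo_dom stereo_param.
Proof.
apply: Ck_row_mx => //; first exact: lin_smooth.
exact: Ck_mulmx.
Qed.

Lemma stereo_unit s : dot (stereo s) (stereo s) = 1.
Proof.
rewrite /stereo !(dotDl, dotDr, dotZl, dotZr, dotNl, dotNr) a1 (dotC a) orth.
rewrite /stereo_coef; have := den_gt0 s; move: (dot _ _) => w w0.
by field; rewrite gt_eqF.
Qed.

(** Only the injectivity of the derivative needs an argument. A kernel vector
    has no base component; pairing the derivative of the stereographic
    projection with a, to which w is orthogonal, kills the derivative of the
    coefficient, and then the component along w. *)
Lemma stereo_UM_param : UM_param U g stereo_dom stereo_param.
Proof.
split=> // [s Ws|s v Ws].
  rewrite /unit_tangent /= row_mxKl row_mxKr; split=> //.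
  by rewrite (metric_dot F) // -mulmxA (frameK F) // mulmx1 stereo_unit.
have d1 m p (h : 'rV[R]_N -> 'M[R]_(m, p)) :
    (forall k, Ck_on k stereo_dom h) -> differentiable h s.
  by move=> /(_ 1)[+ _]; exact.
have dl m (B : 'M[R]_(N, m)) : differentiable (fun s => s *m B) s.
  by apply: d1 => k; exact: lin_smooth.
have Dl m (B : 'M[R]_(N, m)) : 'D_v (fun s => s *m B) s = v *m B.
  by rewrite derive_mulmxr ?derive_id //; exact: ex_diff.
have dc : differentiable stereo_coef s by have [+ _] := coef_smooth 1; exact.
have dst := d1 _ _ _ stereo_smooth; have dE := d1 _ _ _ E_smooth.
have dsE := differentiable_mulmx dst dE.
rewrite -deriveE; last exact: d1 param_smooth.
rewrite derive_row_mx // Dl -[0](row_mx0 _ 1 n n) => /eq_row_mx[vl vr].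
have DE : 'D_v (fun s => E (s *m lsubmx K)) s = 0.
  rewrite (derive_comp (f := fun s => s *m lsubmx K)) // ?Dl ?vl ?derive0 //.
  exact: (frame_differentiable F).
rewrite derive_mulmx // DE mulmx0 addr0 in vr.
have {vr} st0 : 'D_v stereo s = 0.
  by rewrite -['D_v stereo s]mulmx1 -(frameK F Ws) mulmxA vr mul0mx.
have daw : differentiable (fun s => a + s *m rsubmx K) s.
  by apply: (differentiableD (f := cst a)) => //; exact: dl.
have Daw : 'D_v (fun s => a + s *m rsubmx K) s = v *m rsubmx K.
  rewrite (deriveD (f := cst a)) ?derive_cst ?add0r //.
  exact/diff_derivable/dl.
have st1 : 'D_v stereo s = 'D_v stereo_coef s *: (a + s *m rsubmx K) +
    stereo_coef s *: (v *m rsubmx K).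
  rewrite -Daw -derive_scalemx //.
  rewrite /stereo (deriveD (f := cst (- a))) ?derive_cst ?add0r //.
  exact/diff_derivable/differentiable_scalemx.
have c0 : 'D_v stereo_coef s = 0.
  have := congr1 (fun r : 'rV[R]_n => dot r a) st1.
  by rewrite st0 dot0l dotDl !dotZl dotDl !orth a1 addr0 mulr1 mulr0 addr0.
move: st1; rewrite st0 c0 scale0r add0r => /esym/eqP.
rewrite scaler_eq0 /stereo_coef mulf_eq0 invr_eq0 (gt_eqF (den_gt0 s)) orbF.
rewrite pnatr_eq0 /= => /eqP vr.
by apply: K_inj; rewrite -[K]hsubmxK mul_mx_row vl vr row_mx0.
Qed.

Lemma stereo_sectionP z : stereo_param (stereo_section z) = row_mx z (a *m E z).
Proof.
have [v vK] := K_base z.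
have sK : stereo_section z *m K = row_mx z 0.
  by rewrite /stereo_section mulmxKpV // -vK submxMl.
have := sK; rewrite -{1}[K]hsubmxK mul_mx_row => /eq_row_mx[l r].
rewrite /stereo_param l /stereo /stereo_coef r dot0l !addr0 divr1.
by congr (row_mx _ (_ *m _)); rewrite scaler_nat mulr2n addrA addNr add0r.
Qed.

Lemma stereo_section_smooth (W : set 'rV[R]_n) : open W ->
  smooth_on W stereo_section.
Proof.
move=> oW k; apply: Ck_mulmx => //; last exact: Ck_cst.
by apply: Ck_row_mx => //; [exact: Ck_id|exact: Ck_cst].
Qed.

End Stereographic.

Section TensionCriterion.
Context {R : realType} {n : nat}.
Variables (U : set 'rV[R]_n) (g E : 'rV[R]_n -> 'M[R]_n).
Variable (C : 'I_n -> 'I_n -> 'rV[R]_n).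
Hypothesis F : orthonormal_frame U g E C.
Variables (a : 'rV[R]_n).
Hypothesis a1 : dot a a = 1.
Hypothesis uni : forall j, \sum_k C j k ord0 k = 0.

(** [tension_hliftP] holds for every parametrization of UM in which X can be
    written, so its right hand side is necessary; it is sufficient because the
    stereographic parametrization is one. *)
Lemma is_UM_tensionP (X : 'rV[R]_n -> 'rV[R]_n) x c : U x ->
  (forall z, U z -> X z = a *m E z) ->
  is_UM_tension U g X x (hlift g (sect X x) (c *m E x)) <->
  (forall t b, dot b a = 0 -> dot c t = tension_form C a t b).
Proof.
move=> Ux XE; split.
  move=> [W [psi [D [f [P [oO Ox] fO fP tauE]]]]].
  have fP' z : D z -> W (f z) /\ psi (f z) = row_mx z (a *m E z).
    move=> Oz; have [Wz e] := fP z Oz; split=> //; rewrite e /sect XE //.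
    by case: P => _ _ PU _; have [] := PU _ Wz; rewrite e /sect row_mxKl.
  apply/(tension_hliftP F P oO fO fP' _ Ox uni).
  by rewrite -tauE (fP _ Ox).2.
move=> H.
have [K [K_inj K_orth K_base]] := tangent_model a1.
have P := stereo_UM_param F a1 K_inj K_orth.
exists (stereo_dom U K), (stereo_param E a K), U, (stereo_section K).
have fP z : U z -> stereo_dom U K (stereo_section K z) /\
    stereo_param E a K (stereo_section K z) = row_mx z (a *m E z).
  move=> Uz; have e := stereo_sectionP E a K_base z; split=> //.
  rewrite /stereo_dom /=; have := congr1 lsubmx e.
  by rewrite /stereo_param !row_mxKl => ->.
have sf := stereo_section_smooth K (frame_open F).
split=> //.
- by split=> //; exact: (frame_open F).
- by move=> z Uz; have [Wz e] := fP z Uz; split=> //; rewrite e /sect XE.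
- have := (tension_hliftP F P (frame_open F) sf fP c Ux uni).2 H => ->.
  by rewrite (fP x Ux).2 /sect XE.
Qed.

End TensionCriterion.

(** * Change of charts *)

Lemma diff_chain (R : realType) (U V W : normedModType R) (f : U -> V)
    (g : V -> W) x y v : f x = y -> differentiable f x -> differentiable g y ->
  'd g y ('d f x v) = 'D_v (fun z => g (f z)) x.
Proof.
by move=> <- df dg; rewrite derive_comp // !deriveE.
Qed.

Lemma diff_subv (R : realType) (V W : normedModType R) (f : V -> W) x v w :
  differentiable f x -> 'd f x (v - w) = 'D_v f x - 'D_w f x.
Proof. by move=> df; rewrite linearB !deriveE. Qed.

(** The product rule for a direction that depends on the point. *)
Lemma derive_direction (R : realType) n p q (A : set 'rV[R]_n)
    (f : 'rV[R]_n -> 'M[R]_(p, q)) (v : 'rV[R]_n -> 'rV[R]_n) x w :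
  open A -> smooth_on A f -> A x -> differentiable v x ->
  'D_w (fun z => 'D_(v z) f z) x =
  'D_('D_w v x) f x + 'D_w (fun z => 'D_(v x) f z) x.
Proof.
move=> oA sf Ax dv.
have df z : A z -> differentiable f z by case: (sf 1) => + _; exact.
have ddf u : differentiable (fun z => 'D_u f z) x.
  by case: (sf 2) => _ /(_ u)[+ _]; exact.
have near_A : \forall z \near x, A z by exact: open_nbhs_nbhs.
have dvi i : differentiable (fun z => v z ord0 i) x by exact: differentiable_entry.
have E1 : 'D_w (fun z => 'D_(v z) f z) x =
    \sum_i 'D_w (fun z => v z ord0 i *: 'D_(bvec i) f z) x.
  apply: etrans (derive_fsum w _) => [|i]; last exact: differentiable_scalemx.
  apply: near_eq_derive; apply: filterS near_A => z Az.
  by apply: derive_row; exact: df.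
have E2 : 'D_w (fun z => 'D_(v x) f z) x =
    \sum_i v x ord0 i *: 'D_w (fun z => 'D_(bvec i) f z) x.
  transitivity ('D_w (fun z => \sum_i v x ord0 i *: 'D_(bvec i) f z) x).
    apply: near_eq_derive; apply: filterS near_A => z Az.
    by apply: derive_row; exact: df.
  rewrite derive_fsum => [|i]; last exact: differentiable_scalemx.
  apply: eq_bigr => i _; apply: etrans (derive_scalemx _ _ (ddf _)) _ => //.
  by rewrite derive_cst scale0r add0r.
apply: etrans E1 _; rewrite E2 (derive_row _ (df x Ax)) -big_split /=.
apply: eq_bigr => i _; rewrite derive_scalemx //.
by rewrite (derive_entry w ord0 i dv).
Qed.

Section Charts.
Context {R : realType} {n : nat} {T : topologicalType}.
Variable M : smooth_manifold R n T.
Implicit Types (c d k : chart R n T) (p : T) (x : 'rV[R]_n).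

Lemma cinvK c p : atlas M c -> cdom c p -> cinv c (c p) = p.
Proof. by move=> /atlas_chart[_ _ + _ _]; exact. Qed.

Lemma cimg_cinv c x : atlas M c -> cimg c x -> cdom c (cinv c x) /\ c (cinv c x) = x.
Proof. by move=> ac [p cp <-]; rewrite cinvK. Qed.

Lemma cimg_cmap c p : cdom c p -> cimg c (c p).
Proof. by move=> cp; exists p. Qed.

Lemma open_cimg c : atlas M c -> open (cimg c).
Proof. by move=> /atlas_chart[]. Qed.

Definition overlap c d : set 'rV[R]_n := c @` (cdom c `&` cdom d).

Lemma overlapP c d x : atlas M c -> overlap c d x <-> cimg c x /\ cdom d (cinv c x).
Proof.
move=> ac; split=> [[p [cp dp] <-]|[]].
  by rewrite cinvK //; split=> //; exact: cimg_cmap.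
move=> cx dp; have [cp <-] := cimg_cinv ac cx.
by exists (cinv c x).
Qed.

Lemma overlap_cmap c d p : cdom c p -> cdom d p -> overlap c d (c p).
Proof. by move=> cp dp; exists p. Qed.

Lemma open_overlap c d : atlas M c -> atlas M d -> open (overlap c d).
Proof.
move=> ac ad; rewrite openE => x /overlapP - /(_ ac)[cx dx].
have [_ oc _ _ ci] := atlas_chart ac; have [od _ _ _ _] := atlas_chart ad.
have nc : nbhs x (cimg c) by exact: open_nbhs_nbhs.
have nd : nbhs x (cinv c @^-1` cdom d).
  by apply: (ci x cx); exact: open_nbhs_nbhs.
by apply: filterS2 nc nd => z cz dz; apply/overlapP.
Qed.

Lemma transition_smooth c d : atlas M c -> atlas M d ->
  smooth_on (overlap c d) (d \o cinv c).
Proof. exact: atlas_compatible. Qed.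

Lemma transition_differentiable c d x : atlas M c -> atlas M d ->
  overlap c d x -> differentiable (d \o cinv c) x.
Proof.
by move=> ac ad cdx; have [+ _] := transition_smooth ac ad 1; exact.
Qed.

Lemma transition_chain c d k p v : atlas M c -> atlas M d -> atlas M k ->
  cdom c p -> cdom d p -> cdom k p ->
  'd (k \o cinv c) (c p) v = 'd (k \o cinv d) (d p) ('d (d \o cinv c) (c p) v).
Proof.
move=> ac ad ak cp dp kp.
have dcd := transition_differentiable ac ad (overlap_cmap cp dp).
have dck := transition_differentiable ac ak (overlap_cmap cp kp).
have ddk := transition_differentiable ad ak (overlap_cmap dp kp).
have dcp : (d \o cinv c) (c p) = d p by rewrite /= cinvK.
apply: etrans _ (esym (diff_chain v dcp dcd ddk)).
apply: etrans (esym (deriveE v dck)) _; apply: near_eq_derive.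
have : \forall z \near c p, overlap c d z.
  exact: open_nbhs_nbhs (conj (open_overlap ac ad) (overlap_cmap cp dp)).
apply: filterS => z /overlapP - /(_ ac)[cz dz] /=.
by rewrite (cinvK ad).
Qed.

Lemma transition_id c p v : atlas M c -> cdom c p -> 'd (c \o cinv c) (c p) v = v.
Proof.
move=> ac cp.
rewrite -deriveE; last exact: transition_differentiable (overlap_cmap cp cp).
apply: etrans (derive_id (c p) v); apply: near_eq_derive.
have : \forall z \near c p, cimg c z.
  exact: open_nbhs_nbhs (conj (open_cimg ac) (cimg_cmap cp)).
by apply: filterS => z cz /=; rewrite (cimg_cinv ac cz).2.
Qed.

Lemma tcoord_change c d p v : atlas M c -> atlas M d -> cdom c p -> cdom d p ->
  tcoord M d p v = 'd (d \o cinv c) (c p) (tcoord M c p v).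
Proof.
by move=> ac ad cp dp; have [ak kp] := chart_atP M p; exact: transition_chain.
Qed.

Lemma tcoordK c p v : atlas M c -> cdom c p ->
  'd (chart_at M p \o cinv c) (c p) (tcoord M c p v) = v.
Proof.
move=> ac cp; have [ak kp] := chart_atP M p.
by rewrite -tcoord_change // /tcoord transition_id.
Qed.

Lemma vf_in_change c d X x : atlas M c -> atlas M d -> overlap c d x ->
  vf_in M d X ((d \o cinv c) x) = 'd (d \o cinv c) x (vf_in M c X x).
Proof.
move=> ac ad /overlapP - /(_ ac)[cx dx]; have [cp cK] := cimg_cinv ac cx.
rewrite /vf_in /= (cinvK ad dx) (tcoord_change _ ac ad cp dx).
by rewrite cK.
Qed.

(** The differentials of the two transition maps between c and the selected
    chart at p are inverse to each other. *)
Lemma metric_in_dot g c x v w : atlas M c -> cimg c x ->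
  let p := cinv c x in
  bil (metric_in M c g x) (tcoord M c p v) (tcoord M c p w) = bil (g p) v w.
Proof.
move=> ac cx p; have [cp cK] := cimg_cinv ac cx.
pose back u := 'd (chart_at M p \o cinv c) x u.
have backK u : back (tcoord M c p u) = u.
  by have := tcoordK u ac cp; rewrite cK.
have H (u u' : 'rV[R]_n) : bil (metric_in M c g x) u u' = bil (g p) (back u) (back u').
  rewrite [in RHS](row_sum u) [in RHS](row_sum u') /back !linear_sum.
  rewrite !bilE dotE mulmx_suml dot_suml.
  under [RHS]eq_bigr do rewrite dot_sumr.
  rewrite exchange_big; apply: eq_bigr => j _ /=.
  rewrite mxE mulr_suml; apply: eq_bigr => i _.
  by rewrite mxE !linearZ -scalemxAl dotZl dotZr -bilE mulrA mulrAC.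
by rewrite H !backK.
Qed.

Lemma vf_in_sum c m (a : 'I_m -> R) (X : 'I_m -> T -> 'rV[R]_n) x :
  vf_in M c (\sum_i a i *: X i) x = \sum_i a i *: vf_in M c (X i) x.
Proof.
rewrite /vf_in /tcoord fct_sumE linear_sum; apply: eq_bigr => i _.
by rewrite linearZ.
Qed.

(** The bracket computed in an arbitrary chart instead of the selected one. *)
Definition chart_bracket c (X Y : T -> 'rV[R]_n) x : 'rV[R]_n :=
  'D_(vf_in M c X x) (vf_in M c Y) x - 'D_(vf_in M c Y x) (vf_in M c X) x.

Lemma vf_in_differentiable c X x : atlas M c -> smooth_vf M X -> cimg c x ->
  differentiable (vf_in M c X) x.
Proof. by move=> ac /(_ c ac 1)[+ _]; exact. Qed.

(** The second derivatives of the transition map cancel by symmetry. *)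
Lemma chart_bracket_change c d X Y x : atlas M c -> atlas M d ->
  smooth_vf M X -> smooth_vf M Y -> overlap c d x ->
  chart_bracket d X Y ((d \o cinv c) x) = 'd (d \o cinv c) x (chart_bracket c X Y x).
Proof.
move=> ac ad sX sY cdx; have [cx dx] := (overlapP d x ac).1 cdx.
have oA := open_overlap ac ad; have st := transition_smooth ac ad.
have dt := transition_differentiable ac ad cdx.
have near_A : \forall z \near x, overlap c d z by exact: open_nbhs_nbhs.
set th := d \o cinv c.
have dimg : cimg d (th x) by exact: cimg_cmap.
have key Z : smooth_vf M Z -> forall w,
    'D_('D_w th x) (vf_in M d Z) (th x) =
    'D_('D_w (vf_in M c Z) x) th x + 'D_w (fun z => 'D_(vf_in M c Z x) th z) x.
  move=> sZ w; have dZ := vf_in_differentiable ac sZ cx.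
  rewrite -(derive_direction w oA st cdx dZ).
  apply: etrans (esym (derive_comp w dt (vf_in_differentiable ad sZ dimg))) _.
  apply: near_eq_derive; apply: filterS near_A => z cdz.
  apply: etrans (vf_in_change Z ac ad cdz) _; rewrite deriveE //.
  exact: transition_differentiable cdz.
have dirE Z : vf_in M d Z (th x) = 'D_(vf_in M c Z x) th x.
  by rewrite vf_in_change // deriveE.
rewrite /chart_bracket (dirE X) (dirE Y) (key Y sY) (key X sX).
have S : 'D_(vf_in M c X x) (fun z => 'D_(vf_in M c Y x) th z) x =
    'D_(vf_in M c Y x) (fun z => 'D_(vf_in M c X x) th z) x.
  apply: schwarz_mx.
  - by apply: filterS near_A => z; exact: transition_differentiable.
  - by case: (st 2) => _ /(_ (vf_in M c Y x))[+ _]; exact.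
  - by case: (st 2) => _ /(_ (vf_in M c X x))[+ _]; exact.
exact: etrans (addr_diag _ _ S) (esym (diff_subv _ _ dt)).
Qed.

Lemma chart_bracketE c X Y x : atlas M c -> smooth_vf M X -> smooth_vf M Y ->
  cimg c x -> chart_bracket c X Y x = vf_in M c (lie_bracket M X Y) x.
Proof.
move=> ac sX sY cx; have [cp cK] := cimg_cinv ac cx.
set p := cinv c x; have [ak kp] := chart_atP M p.
have ov := overlap_cmap kp cp.
have := chart_bracket_change ak ac sX sY ov.
by rewrite /= (cinvK ak kp) cK.
Qed.

End Charts.

(** * The magnetic equation for a left invariant field *)

Section PhiFrame.
Context {R : realType} {n : nat}.
Variables (U : set 'rV[R]_n) (g E : 'rV[R]_n -> 'M[R]_n).
Variable (C : 'I_n -> 'I_n -> 'rV[R]_n).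
Hypothesis F : orthonormal_frame U g E C.
Variables (a : 'rV[R]_n) (X : 'rV[R]_n -> 'rV[R]_n).
Hypothesis a1 : dot a a = 1.
Hypothesis XE : forall z, U z -> X z = a *m E z.

Lemma hliftZ x z (b : R) Y : U x -> lsubmx z = x ->
  b *: hlift g z Y = hlift g z (b *: Y).
Proof.
move=> Ux zx; have dg := metric_differentiable F Ux.
rewrite /hlift scale_row_mx zx; congr row_mx.
have := christoffel_linl (rsubmx z) dg b Y 0.
by rewrite !addr0 christoffel0l // addr0 scalerN => ->.
Qed.

(** Jop turns the horizontal part X into the normal vector, which eta removes,
    and the vertical part nabla_X X into minus its horizontal lift. *)
Lemma phi_sect x : U x ->
  phi g (sect X x) ('d (sect X) x (X x)) =
  - hlift g (sect X x) (a *m connection C a *m E x).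
Proof.
move=> Ux; have dg := metric_differentiable F Ux.
have dE := frame_differentiable F Ux.
have near_U : \forall z \near x, U z by exact: open_nbhs_nbhs (conj (frame_open F) Ux).
have XEn : \forall z \near x, a *m E z = X z.
  by apply: filterS near_U => z Uz; rewrite XE.
have dX : differentiable X x.
  by apply: differentiable_near XEn _; exact: differentiable_mulmx.
have DX w : 'D_w X x = a *m 'D_w E x.
  by apply: etrans (esym (near_eq_derive w XEn)) (derive_mulmxl a w dE).
have -> : 'd (sect X) x (X x) = row_mx (X x) (a *m 'D_(X x) E x).
  have di : differentiable (fun y : 'rV[R]_n => y) x by exact: ex_diff.
  rewrite -DX -deriveE; last exact: differentiable_row_mx.
  by rewrite derive_row_mx // derive_id.
set V := row_mx _ _; set z := sect X x.
have lz : lsubmx z = x by rewrite /z /sect row_mxKl.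
have rz : rsubmx z = X x by rewrite /z /sect row_mxKr.
clearbody z.
have c0 w : christoffel g x 0 w = 0 by exact: christoffel0l.
have hV : hpart V = X x by rewrite /hpart row_mxKl.
have vV : vpart g z V = a *m connection C a *m E x.
  rewrite /vpart lz rz row_mxKl row_mxKr addrC XE //.
  by rewrite (christoffel_connection F).
have hU : hpart (unormal z) = 0 by rewrite /hpart /unormal /vlift row_mxKl.
have vU : vpart g z (unormal z) = X x.
  by rewrite /vpart /unormal /vlift row_mxKl row_mxKr lz rz c0 addr0.
have xiE : xi g z = hlift g z (X x).
  by rewrite /xi /Jop hU vU /vlift row_mx0 sub0r opprK.
have eta1 : Defs.eta g z V = 1.
  rewrite /Defs.eta /sasaki xiE hV lz /hlift /hpart row_mxKl /vpart row_mxKl row_mxKr.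
  rewrite addNr (bilE _ 0) mul0mx dot0l addr0 (metric_dot F) // XE // -mulmxA.
  by rewrite (frameK F) // mulmx1.
by rewrite /phi eta1 scale1r /Jop hV vV /unormal rz addrC addKr.
Qed.

End PhiFrame.

Section LeftInvariantFrame.
Context {R : realType} {n : nat} {T : topologicalType}.
Variables (M : smooth_manifold R n T) (g : T -> 'M[R]_n).
Hypothesis hg : riemannian_metric M g.
Variables (e : 'I_n -> T -> 'rV[R]_n) (C : 'I_n -> 'I_n -> 'rV[R]_n).
Hypothesis e_smooth : forall i, smooth_vf M (e i).
Hypothesis e_orth : forall p i j, bil (g p) (e i p) (e j p) = (i == j)%:R.
Hypothesis e_bracket : forall i j,
  lie_bracket M (e i) (e j) = \sum_k C i j ord0 k *: e k.

Definition chart_frame (c : chart R n T) (x : 'rV[R]_n) : 'M[R]_n :=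
  \matrix_(i, j) vf_in M c (e i) x ord0 j.

Lemma row_chart_frame c x i : row i (chart_frame c x) = vf_in M c (e i) x.
Proof. by apply/rowP => j; rewrite !mxE. Qed.

(** The hypotheses on the fields hold at every point, in the selected charts;
    the change of charts carries them to any chart. *)
Lemma chart_orthonormal_frame c : atlas M c ->
  orthonormal_frame (cimg c) (metric_in M c g) (chart_frame c) C.
Proof.
move=> ac; have oU := open_cimg ac; have [gs _ gsm] := hg.
have sE : smooth_on (cimg c) (chart_frame c).
  move=> k; apply: Ck_mx => // i j; under eq_fun do rewrite mxE.
  by apply: Ck_entry => //; exact: e_smooth.
split=> //.
- exact: gsm.
- move=> x cx; apply/matrixP => i j; rewrite !mxE.
  by rewrite !bilE dotC dot_mulmxl gs dotC.
- move=> x cx; apply/matrixP => i j; rewrite [RHS]mxE -(e_orth (cinv c x) i j).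
  rewrite -(metric_in_dot g _ _ ac cx) -/(vf_in M c (e i) x) -/(vf_in M c (e j) x).
  rewrite -!row_chart_frame bilE dotE mxE; apply: eq_bigr => k _.
  by rewrite -row_mul !mxE.
- move=> x cx i j.
  have dE : differentiable (chart_frame c) x by case: (sE 1) => + _; exact.
  have D k w : row k ('D_w (chart_frame c) x) = 'D_w (vf_in M c (e k)) x.
    have <- : (fun z => bvec k *m chart_frame c z) = vf_in M c (e k).
      by apply/funext => z; rewrite bvec_mul row_chart_frame.
    by rewrite -bvec_mul; exact: esym (derive_mulmxl (bvec k) w dE).
  rewrite !D !row_chart_frame.
  apply: etrans (chart_bracketE ac (e_smooth i) (e_smooth j) cx) _.
  rewrite e_bracket vf_in_sum mulmx_sum_row; apply: eq_bigr => k _.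
  by rewrite row_chart_frame.
Qed.

(** One chart is enough for the necessity of the condition, which does not
    depend on the chart; the point p0 provides that chart. *)
Lemma magneticP (a : 'rV[R]_n) q (p0 : T) : dot a a = 1 ->
  (forall j, \sum_k C j k ord0 k = 0) ->
  let X := \sum_i a ord0 i *: e i in
  smooth_vf M X -> unit_vf g X ->
  magnetic M g q X <->
  (forall t b, dot b a = 0 ->
     dot (- q *: (a *m connection C a)) t = tension_form C a t b).
Proof.
move=> a1 uni X sX uX.
have XE c z : vf_in M c X z = a *m chart_frame c z.
  rewrite vf_in_sum mulmx_sum_row; apply: eq_bigr => i _.
  by rewrite row_chart_frame.
have key c x : atlas M c -> cimg c x ->
    is_UM_tension (cimg c) (metric_in M c g) (vf_in M c X) x
      (q *: phi (metric_in M c g) (sect (vf_in M c X) x)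
              ('d (sect (vf_in M c X)) x (vf_in M c X x))) <->
    (forall t b, dot b a = 0 ->
      dot (- q *: (a *m connection C a)) t = tension_form C a t b).
  move=> ac cx; have F := chart_orthonormal_frame ac.
  rewrite (phi_sect F a1 (fun z _ => XE c z) cx).
  rewrite scalerN -scaleNr (hliftZ F _ _ cx) ?scalemxAl; last first.
    by rewrite /sect row_mxKl.
  exact: (is_UM_tensionP F a1 uni _ cx (fun z _ => XE c z)).
split=> [[_ _ H]|H].
  have [ac cp] := chart_atP M p0.
  by apply/(key _ _ ac (cimg_cmap cp)); exact: H (cimg_cmap cp).
by split=> // c ac x cx; apply/key.
Qed.

End LeftInvariantFrame.

(** * Unimodular structure constants in dimension 3 *)

Section Dimension3.
Context {R : realType}.

Definition vec3 (x y z : R) : 'rV[R]_3 := \row_i [:: x; y; z]`_i.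

Lemma vec3_eta (v : 'rV[R]_3) :
  v = vec3 (v ord0 ord0) (v ord0 (lift ord0 ord0)) (v ord0 (lift ord0 (lift ord0 ord0))).
Proof.
apply/rowP => -[[|[|[|//]]] hi]; rewrite !mxE /=;
  by congr (v _ _); apply/val_inj.
Qed.

Lemma dot_vec3 x y z x' y' z' :
  dot (vec3 x y z) (vec3 x' y' z') = x * x' + y * y' + z * z'.
Proof. by rewrite dotE !big_ord_recl big_ord0 !mxE /= addr0 addrA. Qed.

Lemma vec3D x y z x' y' z' : vec3 x y z + vec3 x' y' z' = vec3 (x + x') (y + y') (z + z').
Proof. by apply/rowP => -[[|[|[|//]]] hi]; rewrite !mxE. Qed.

Lemma vec3Z a x y z : a *: vec3 x y z = vec3 (a * x) (a * y) (a * z).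
Proof. by apply/rowP => -[[|[|[|//]]] hi]; rewrite !mxE. Qed.

Lemma vec3N x y z : - vec3 x y z = vec3 (- x) (- y) (- z).
Proof. by apply/rowP => -[[|[|[|//]]] hi]; rewrite !mxE. Qed.

Variables c1 c2 c3 : R.

Definition struct3 (i j : 'I_3) : 'rV[R]_3 :=
  match val i, val j with
  | 0%N, 1%N => vec3 0 0 c3 | 1%N, 0%N => vec3 0 0 (- c3)
  | 1%N, 2%N => vec3 c1 0 0 | 2%N, 1%N => vec3 (- c1) 0 0
  | 2%N, 0%N => vec3 0 c2 0 | 0%N, 2%N => vec3 0 (- c2) 0
  | _, _ => 0
  end.

Let mu1 := (c2 + c3 - c1) / 2.
Let mu2 := (c3 + c1 - c2) / 2.
Let mu3 := (c1 + c2 - c3) / 2.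

Lemma struct3_trace j : \sum_k struct3 j k ord0 k = 0.
Proof.
by rewrite !big_ord_recl big_ord0; case: j => [[|[|[|//]]] hj];
  rewrite /struct3 /= !mxE /= !addr0.
Qed.

(** The connection matrices are mu_k times the cross product with e_k. *)
Lemma mul_connection_coef (v : 'rV[R]_3) k x y z :
  v = vec3 x y z ->
  v *m connection_coef struct3 k =
  match val k with
  | 0%N => vec3 0 (- (mu1 * z)) (mu1 * y)
  | 1%N => vec3 (mu2 * z) 0 (- (mu2 * x))
  | _ => vec3 (- (mu3 * y)) (mu3 * x) 0
  end.
Proof.
move=> ->; apply/rowP => j; rewrite mxE !big_ord_recl big_ord0 !mxE.
case: k => [[|[|[|//]]] hk]; case: j => [[|[|[|//]]] hj];
  by rewrite /struct3 /= !mxE /= /mu1 /mu2 /mu3; field.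
Qed.

Lemma sum3 (F : 'I_3 -> R) : \sum_k F k =
  F ord0 + F (lift ord0 ord0) + F (lift ord0 (lift ord0 ord0)).
Proof. by rewrite !big_ord_recl big_ord0 addr0 addrA. Qed.

Lemma mul_connection (x y z x' y' z' : R) :
  vec3 x y z *m connection struct3 (vec3 x' y' z') =
  vec3 (y' * mu2 * z - z' * mu3 * y) (z' * mu3 * x - x' * mu1 * z)
       (x' * mu1 * y - y' * mu2 * x).
Proof.
rewrite /connection !big_ord_recl big_ord0 addr0 !mulmxDr -!scalemxAr.
rewrite !(mul_connection_coef _ erefl) /= !mxE /=.
by rewrite !(vec3Z, vec3D); congr vec3; ring.
Qed.

Lemma lie_op3 (x y z x' y' z' : R) :
  lie_op struct3 (vec3 x y z) (vec3 x' y' z') =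
  vec3 (c1 * (y * z' - z * y')) (c2 * (z * x' - x * z')) (c3 * (x * y' - y * x')).
Proof.
rewrite /lie_op !big_ord_recl !big_ord0 !mxE /struct3 /=.
by rewrite !scaler0 !(vec3Z, vec3D, add0r, addr0); congr vec3; ring.
Qed.

Lemma bvec3 : [/\ bvec (ord0 : 'I_3) = vec3 1 0 0,
  bvec (lift ord0 ord0 : 'I_3) = vec3 0 1 0 &
  bvec (lift ord0 (lift ord0 ord0) : 'I_3) = vec3 0 0 1].
Proof.
by split; apply/rowP => -[[|[|[|//]]] hi]; rewrite !mxE.
Qed.

Lemma tension_form3 a1 a2 a3 t1 t2 t3 b1 b2 b3 :
  tension_form struct3 (vec3 a1 a2 a3) (vec3 t1 t2 t3) (vec3 b1 b2 b3) =
  (c2 - c3) * mu2 * mu3 * a2 * a3 * t1 + (c3 - c1) * mu3 * mu1 * a3 * a1 * t2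
  + (c1 - c2) * mu1 * mu2 * a1 * a2 * t3
  - (mu1 ^+ 2 * (a2 * b2 + a3 * b3) + mu2 ^+ 2 * (a1 * b1 + a3 * b3)
     + mu3 ^+ 2 * (a1 * b1 + a2 * b2)).
Proof.
have [E1 E2 E3] := bvec3.
rewrite /tension_form sum3 E1 E2 E3 !(mul_connection_coef _ erefl) !lie_op3 !vec3N.
rewrite !mul_connection /= !vec3D !dot_vec3.
by rewrite /mu1 /mu2 /mu3; field.
Qed.

(** The conditions with factor c_k come from t = 0 and b = a_j e_i - a_i e_j;
    those with factor mu_i mu_j - q come from b = 0 and t = e_k. *)
Lemma magnetic_condition3 q a1 a2 a3 : a1 ^+ 2 + a2 ^+ 2 + a3 ^+ 2 = 1 ->
  let a := vec3 a1 a2 a3 in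
  (forall t b, dot b a = 0 ->
     dot (- q *: (a *m connection struct3 a)) t = tension_form struct3 a t b) <->
  [/\ (c1 - c2) * c3 * (a1 * a2) = 0 /\ (c1 - c2) * (mu1 * mu2 - q) * (a1 * a2) = 0,
      (c2 - c3) * c1 * (a2 * a3) = 0 /\ (c2 - c3) * (mu2 * mu3 - q) * (a2 * a3) = 0 &
      (c3 - c1) * c2 * (a3 * a1) = 0 /\ (c3 - c1) * (mu3 * mu1 - q) * (a3 * a1) = 0].
Proof.
move=> a1E a.
have lhs t1 t2 t3 : dot (- q *: (a *m connection struct3 a)) (vec3 t1 t2 t3) =
    - q * ((c3 - c2) * a2 * a3 * t1 + (c1 - c3) * a3 * a1 * t2 + (c2 - c1) * a1 * a2 * t3).
  by rewrite mul_connection vec3Z dot_vec3 /mu1 /mu2 /mu3; field.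
split=> [H|[[h1 k1] [h2 k2] [h3 k3]] t b].
- have Ht t1 t2 t3 := H (vec3 t1 t2 t3) (vec3 0 0 0).
  have Hb b1 b2 b3 := H (vec3 0 0 0) (vec3 b1 b2 b3).
  have ba0 : dot (vec3 0 0 0) a = 0 by rewrite dot_vec3; ring.
  have T1 := Ht 1 0 0 ba0; have T2 := Ht 0 1 0 ba0; have T3 := Ht 0 0 1 ba0.
  have B1 : dot (vec3 a2 (- a1) 0) a = 0 by rewrite dot_vec3; ring.
  have B2 : dot (vec3 0 a3 (- a2)) a = 0 by rewrite dot_vec3; ring.
  have B3 : dot (vec3 (- a3) 0 a1) a = 0 by rewrite dot_vec3; ring.
  move/Hb: B1 => B1; move/Hb: B2 => B2; move/Hb: B3 => B3.
  rewrite !lhs !tension_form3 in T1 T2 T3 B1 B2 B3.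
  split; split; rewrite /mu1 /mu2 /mu3 in T1 T2 T3 B1 B2 B3 *; lra.
- rewrite (vec3_eta t) (vec3_eta b) dot_vec3 lhs tension_form3.
  move: (t _ _) (t _ _) (t _ _) (b _ _) (b _ _) (b _ _) => t3 t2 t1 b3 b2 b1 ba.
  have S0 : mu1 ^+ 2 * (a1 * b1) + mu2 ^+ 2 * (a2 * b2) + mu3 ^+ 2 * (a3 * b3) = 0.
    (* Homogenized by |a|^2 = 1, the sum is a combination of the hypotheses. *)
    rewrite -[LHS]mulr1 -a1E.
    transitivity ((b1 * a1 + b2 * a2 + b3 * a3) *
        (mu1 ^+ 2 * a1 ^+ 2 + mu2 ^+ 2 * a2 ^+ 2 + mu3 ^+ 2 * a3 ^+ 2)
      + (c1 - c2) * c3 * (a1 * a2) * (a1 * b2 - a2 * b1)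
      + (c2 - c3) * c1 * (a2 * a3) * (a2 * b3 - a3 * b2)
      + (c3 - c1) * c2 * (a3 * a1) * (a3 * b1 - a1 * b3)).
      by rewrite /mu1 /mu2 /mu3; field.
    by rewrite ba h1 h2 h3; ring.
  have -> : mu1 ^+ 2 * (a2 * b2 + a3 * b3) + mu2 ^+ 2 * (a1 * b1 + a3 * b3)
     + mu3 ^+ 2 * (a1 * b1 + a2 * b2) = 0.
    transitivity ((mu1 ^+ 2 + mu2 ^+ 2 + mu3 ^+ 2) * (b1 * a1 + b2 * a2 + b3 * a3)
      - (mu1 ^+ 2 * (a1 * b1) + mu2 ^+ 2 * (a2 * b2) + mu3 ^+ 2 * (a3 * b3))).
      by ring.
    by rewrite S0 ba; ring.
  apply/eqP; rewrite -subr_eq0; apply/eqP.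
  transitivity (- ((c2 - c3) * (mu2 * mu3 - q) * (a2 * a3)) * t1
    - (c3 - c1) * (mu3 * mu1 - q) * (a3 * a1) * t2
    - (c1 - c2) * (mu1 * mu2 - q) * (a1 * a2) * t3); first by ring.
  by rewrite k1 k2 k3; ring.
Qed.

End Dimension3.

(** * Curves in real matrix groups *)

Section Curves.
Context {R : realType}.

Definition real_lie m (H : set 'M[R]_m) : set 'M[R]_m :=
  [set A | exists gamma : R -> 'M[R]_m,
     [/\ gamma 0 = 1%:M, forall t, H (gamma t) &
      forall i j, is_derive (0 : R) (1 : R) (fun t => gamma t i j) (A i j)]].

Lemma is_deriveC (c : R) : is_derive (0 : R) (1 : R) (fun _ : R => c) 0.
Proof. exact: is_derive_cst. Qed.

Lemma is_derive_unique (f : R -> R) d d' :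
  is_derive (0 : R) (1 : R) f d -> is_derive (0 : R) (1 : R) f d' -> d = d'.
Proof. by move=> /@derive_val <- /@derive_val <-. Qed.

Lemma is_derive_lin (c : R) : is_derive (0 : R) (1 : R) (fun t : R => t * c) c.
Proof.
have -> : (fun t : R => t * c) = c *: (id : R -> R).
  by apply/funext => t; rewrite /GRing.scale /= mulrC.
by apply: is_derive_eq; rewrite /GRing.scale /= mulr1.
Qed.

Lemma is_derive_add (f g : R -> R) df dg : is_derive (0 : R) (1 : R) f df ->
  is_derive (0 : R) (1 : R) g dg ->
  is_derive (0 : R) (1 : R) (fun t => f t + g t) (df + dg).
Proof. by move=> ? ?; exact: is_deriveD. Qed.

Lemma is_derive_opp (f : R -> R) df : is_derive (0 : R) (1 : R) f df ->
  is_derive (0 : R) (1 : R) (fun t => - f t) (- df).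
Proof. by move=> ?; exact: is_deriveN. Qed.

Lemma is_derive_mul (f g : R -> R) df dg : is_derive (0 : R) (1 : R) f df ->
  is_derive (0 : R) (1 : R) g dg ->
  is_derive (0 : R) (1 : R) (fun t => f t * g t) (df * g 0 + f 0 * dg).
Proof.
move=> hf hg; have := is_deriveM hf hg; rewrite /GRing.scale /=.
by move=> h; apply: is_derive_eq h _; ring.
Qed.

Lemma is_derive_inv (f : R -> R) df : f 0 != 0 -> is_derive (0 : R) (1 : R) f df ->
  is_derive (0 : R) (1 : R) (fun t => (f t)^-1) (- (f 0) ^- 2 * df).
Proof.
move=> f0 [hf <-]; apply: DeriveDef; first exact: derivableV.
by rewrite deriveV.
Qed.

Lemma is_derive_exp (f : R -> R) df : is_derive (0 : R) (1 : R) f df ->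
  is_derive (0 : R) (1 : R) (fun t => expR (f t)) (expR (f 0) * df).
Proof.
move=> [hf <-].
have f_diff : differentiable f (0 : R) by exact/derivable1_diffP.
have e_diff : differentiable (@expR R) (f 0).
  by apply/derivable1_diffP; exact: ex_derive.
apply: DeriveDef; first exact/diff_derivable/differentiable_comp.
rewrite (derive_comp (1 : R) f_diff e_diff).
have -> : 'D_(1 : R) f (0 : R) = 'D_(1 : R) f (0 : R) *: (1 : R).
  by rewrite /GRing.scale /= mulr1.
rewrite deriveZv // derive_val /GRing.scale /= mulr1; exact: mulrC.
Qed.

Lemma curve_derive m (gamma : R -> 'M[R]_m) (A : 'M[R]_m) :
  (forall i j, is_derive (0 : R) (1 : R) (fun t => gamma t i j) (A i j)) ->
  differentiable gamma (0 : R) /\ 'D_(1 : R) gamma (0 : R) = A.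
Proof.
move=> h; have d : derivable gamma (0 : R) (1 : R).
  by apply/derivable_mxP => i j; have [] := h i j.
split; first exact/derivable1_diffP.
rewrite derive_mx //; apply/matrixP => i j; rewrite mxE.
exact: (@derive_val _ _ _ _ _ _ _ (h i j)).
Qed.

Definition mx2 (S : nmodType) (a b c d : S) : 'M[S]_2 :=
  \matrix_(i, j) (if i == ord0 then (if j == ord0 then a else b)
                  else (if j == ord0 then c else d)).

Lemma mx2_eta (S : nmodType) (A : 'M[S]_2) :
  A = mx2 (A ord0 ord0) (A ord0 ord_max) (A ord_max ord0) (A ord_max ord_max).
Proof.
apply/matrixP => -[[|[|//]] hi] [[|[|//]] hj]; rewrite mxE /=;
  by congr (A _ _); apply/val_inj.
Qed.

Lemma mx2_inj (S : nmodType) (a b c d a' b' c' d' : S) :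
  mx2 a b c d = mx2 a' b' c' d' -> [/\ a = a', b = b', c = c' & d = d'].
Proof.
move/matrixP => h; split; [have := h ord0 ord0|have := h ord0 ord_max|
  have := h ord_max ord0|have := h ord_max ord_max]; by rewrite !mxE.
Qed.

Lemma mul_mx2 (S : pzRingType) (a b c d a' b' c' d' : S) :
  mx2 a b c d *m mx2 a' b' c' d' =
  mx2 (a * a' + b * c') (a * b' + b * d') (c * a' + d * c') (c * b' + d * d').
Proof.
by apply/matrixP => -[[|[|//]] hi] [[|[|//]] hj];
  rewrite !mxE !big_ord_recl big_ord0 !mxE /= addr0.
Qed.

Lemma det_mx2 (S : comPzRingType) (a b c d : S) : \det (mx2 a b c d) = a * d - b * c.
Proof.
rewrite (expand_det_row _ ord0) !big_ord_recl big_ord0 addr0 /cofactor !det_mx11 !mxE /=.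
by rewrite expr0 mul1r expr1 mulN1r mulrN.
Qed.

Lemma tr_mx2 (S : nmodType) (a b c d : S) : (mx2 a b c d)^T = mx2 a c b d.
Proof. by apply/matrixP => -[[|[|//]] hi] [[|[|//]] hj]; rewrite !mxE. Qed.

Lemma mx2_1 (S : pzSemiRingType) : 1%:M = mx2 1 0 0 1 :> 'M[S]_2.
Proof. by apply/matrixP => -[[|[|//]] hi] [[|[|//]] hj]; rewrite !mxE. Qed.

Lemma mx2D (S : nmodType) (a b c d a' b' c' d' : S) :
  mx2 a b c d + mx2 a' b' c' d' = mx2 (a + a') (b + b') (c + c') (d + d').
Proof. by apply/matrixP => -[[|[|//]] hi] [[|[|//]] hj]; rewrite !mxE. Qed.

Lemma mx2N (S : zmodType) (a b c d : S) : - mx2 a b c d = mx2 (- a) (- b) (- c) (- d).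
Proof. by apply/matrixP => -[[|[|//]] hi] [[|[|//]] hj]; rewrite !mxE. Qed.

Lemma mx2Z (S : pzRingType) (k a b c d : S) :
  k *: mx2 a b c d = mx2 (k * a) (k * b) (k * c) (k * d).
Proof. by apply/matrixP => -[[|[|//]] hi] [[|[|//]] hj]; rewrite !mxE. Qed.

Lemma map_mx2 (S S' : nmodType) (f : S -> S') (a b c d : S) :
  map_mx f (mx2 a b c d) = mx2 (f a) (f b) (f c) (f d).
Proof. by apply/matrixP => -[[|[|//]] hi] [[|[|//]] hj]; rewrite !mxE. Qed.

Lemma mx2_00 (S : nmodType) : mx2 0 0 0 0 = 0 :> 'M[S]_2.
Proof. by apply/matrixP => -[[|[|//]] hi] [[|[|//]] hj]; rewrite !mxE. Qed.

Lemma is_derive_mx2 (a b c d : R -> R) (X : 'M[R]_2) :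
  is_derive (0 : R) (1 : R) a (X ord0 ord0) ->
  is_derive (0 : R) (1 : R) b (X ord0 ord_max) ->
  is_derive (0 : R) (1 : R) c (X ord_max ord0) ->
  is_derive (0 : R) (1 : R) d (X ord_max ord_max) ->
  forall i j, is_derive (0 : R) (1 : R)
    (fun t => mx2 (a t) (b t) (c t) (d t) i j) (X i j).
Proof.
move=> ha hb hc hd i j.
have hij : (i = ord0 \/ i = ord_max) /\ (j = ord0 \/ j = ord_max).
  by split; [case: i|case: j] => -[|[|//]] h; [left|right|left|right]; apply/val_inj.
have E : (fun t => mx2 (a t) (b t) (c t) (d t) i j) =
  (if i == ord0 then (if j == ord0 then a else b) else (if j == ord0 then c else d)).
  by apply/funext => t; rewrite mxE; case: ifP; case: ifP.
by rewrite E; case: hij => -[] -> [] ->.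
Qed.

(** The curve is the product of an upper and a lower unipotent one-parameter
    group and the diagonal one, whose velocities add up. *)
Lemma real_lie_SL2 (X : 'M[R]_2) :
  real_lie [set A : 'M[R]_2 | \det A = 1] X <->
  exists x y z, X = mx2 x y z (- x).
Proof.
split=> [[ga [g0 gdet gX]]|[a [b [c ->]]]].
  rewrite (mx2_eta X); set a := X _ _; set b := X _ _; set c := X _ _; set d := X _ _.
  suff -> : d = - a by exists a, b, c.
  have h := is_derive_add (is_derive_mul (gX ord0 ord0) (gX ord_max ord_max))
    (is_derive_opp (is_derive_mul (gX ord0 ord_max) (gX ord_max ord0))).
  have E : (fun t => ga t ord0 ord0 * ga t ord_max ord_max +
      - (ga t ord0 ord_max * ga t ord_max ord0)) = (fun=> 1).
    by apply/funext => t; rewrite -det_mx2 -mx2_eta; exact: gdet.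
  rewrite E in h; have := is_derive_unique h (is_deriveC 1).
  rewrite g0 !mxE /= -/a -/d !mulr1n !mulr0n => e; lra.
exists (fun t => mx2 ((1 + t * b * (t * c)) * expR (t * a)) (t * b * expR (- (t * a)))
                     (t * c * expR (t * a)) (expR (- (t * a)))); split.
- by rewrite !mul0r oppr0 expR0 mx2_1; congr mx2; ring.
- move=> t /=; rewrite det_mx2.
  have e : expR (t * a) * expR (- (t * a)) = 1 by rewrite expRN divff // gt_eqF // expR_gt0.
  rewrite (_ : _ - _ = expR (t * a) * expR (- (t * a))) //; ring.
- have ea := is_derive_exp (is_derive_lin a).
  have ena := is_derive_exp (is_derive_opp (is_derive_lin a)).
  have tb := is_derive_lin b; have tc := is_derive_lin c.
  apply: is_derive_mx2; rewrite !mxE /=.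
  + apply: is_derive_eq (is_derive_mul (is_derive_add (is_deriveC 1) (is_derive_mul tb tc)) ea) _.
    by rewrite !mul0r expR0; ring.
  + apply: is_derive_eq (is_derive_mul tb ena) _.
    by rewrite !mul0r oppr0 expR0; ring.
  + apply: is_derive_eq (is_derive_mul tc ea) _.
    by rewrite !mul0r expR0; ring.
  + apply: is_derive_eq ena _.
    by rewrite !mul0r oppr0 expR0; ring.
Qed.

(** Derivative at 1 of the invariance of the form. *)
Lemma real_lie_SO_form m (S : 'M[R]_m) (X : 'M[R]_m) :
  real_lie (SO_form S) X -> X^T *m S + S *m X = 0.
Proof.
move=> [ga [g0 gS gX]]; have [dg Dg] := curve_derive gX.
have dgT := differentiable_trmx dg.
have dS := differentiable_mulmxr S dgT.
have h1 := derive_mulmx (1 : R) dS dg.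
have h2 := derive_mulmxr S (1 : R) dgT.
have h3 := derive_trmx (1 : R) dg.
have h0 : 'D_(1 : R) (fun y : R => (ga y)^T *m S *m ga y) (0 : R) = 0.
  have -> : (fun y : R => (ga y)^T *m S *m ga y) = cst S.
    by apply/funext => t; case: (gS t).
  exact: derive_cst.
by move: h1; rewrite h0 h2 h3 Dg g0 trmx1 mul1mx mulmx1 => <-.
Qed.

(** The rotations are written with rational functions of t, as in the Cayley
    transform. *)
Lemma real_lie_SO2 (X : 'M[R]_2) :
  real_lie (SO_form (1%:M : 'M[R]_2)) X <-> exists x, X = mx2 0 (- x) x 0.
Proof.
split=> [/real_lie_SO_form|[x ->]].
  rewrite mulmx1 mul1mx (mx2_eta X) tr_mx2 mx2D -mx2_00 => /mx2_inj[e1 e2 e3 e4].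
  by exists (X ord_max ord0); congr mx2; lra.
have cE := is_derive_lin (x / 2).
pose r t := 1 + t * (x / 2) * (t * (x / 2)).
have r0 t : r t != 0.
  by rewrite gt_eqF // ltr_pwDl // -expr2 sqr_ge0.
have dr := is_derive_add (is_deriveC 1) (is_derive_mul cE cE).
have dri := is_derive_inv (r0 0) dr.
pose p t := (1 + - (t * (x / 2) * (t * (x / 2)))) * (r t)^-1.
pose s t := (t * x) * (r t)^-1.
have dp := is_derive_mul (is_derive_add (is_deriveC 1) (is_derive_opp (is_derive_mul cE cE))) dri.
have ds := is_derive_mul (is_derive_lin x) dri.
exists (fun t => mx2 (p t) (- s t) (s t) (p t)); split.
- by rewrite /p /s /r !mul0r !(oppr0, addr0, invr1, mulr1) mx2_1.
- have ps t : p t * p t + s t * s t = 1.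
    rewrite /p /s; have := r0 t; rewrite /r => h; field.
    by rewrite (_ : _ + _ = 4 * (1 + t * (x / 2) * (t * (x / 2)))) ?mulf_neq0 //; field.
  move=> t; split.
    rewrite mulmx1 tr_mx2 mul_mx2 mx2_1; have := ps t.
    by move=> pst; congr mx2; lra.
  by rewrite det_mx2 mulNr opprK ps.
- apply: is_derive_mx2; rewrite !mxE /=.
  + by apply: is_derive_eq dp _; rewrite /r !mul0r; field.
  + by apply: is_derive_eq (is_derive_opp ds) _; rewrite /r !mul0r; field.
  + by apply: is_derive_eq ds _; rewrite /r !mul0r; field.
  + by apply: is_derive_eq dp _; rewrite /r !mul0r; field.
Qed.

(** The curve consists of hyperbolic rotations. *)
Lemma real_lie_SO11 (X : 'M[R]_2) :
  real_lie (SO_form (Defs.minkowski R)) X <-> exists x, X = mx2 0 x x 0.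
Proof.
have mE : Defs.minkowski R = mx2 1 0 0 (- 1).
  by apply/matrixP => -[[|[|//]] hi] [[|[|//]] hj]; rewrite !mxE //= ?expr0 ?expr1.
split=> [/real_lie_SO_form|[x ->]].
  rewrite mE (mx2_eta X) tr_mx2 !mul_mx2 mx2D -mx2_00 => /mx2_inj[e1 e2 e3 e4].
  by exists (X ord_max ord0); congr mx2; lra.
have e := is_derive_exp (is_derive_lin x).
have ne := is_derive_exp (is_derive_opp (is_derive_lin x)).
pose p t := (expR (t * x) + expR (- (t * x))) * 2^-1.
pose s t := (expR (t * x) + - expR (- (t * x))) * 2^-1.
have dp := is_derive_mul (is_derive_add e ne) (is_deriveC 2^-1).
have ds := is_derive_mul (is_derive_add e (is_derive_opp ne)) (is_deriveC 2^-1).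
have ee t : expR (t * x) * expR (- (t * x)) = 1.
  by rewrite expRN divff // gt_eqF // expR_gt0.
have ps t : p t * p t - s t * s t = 1.
  have := ee t; rewrite /p /s; move: (expR _) (expR _) => u v uv; lra.
exists (fun t => mx2 (p t) (s t) (s t) (p t)); split.
- by rewrite /p /s !mul0r oppr0 expR0 mx2_1; congr mx2; field.
- move=> t; split.
    rewrite mE tr_mx2 !mul_mx2; have := ps t.
    by move=> pst; congr mx2; lra.
  by rewrite det_mx2 ps.
- apply: is_derive_mx2; rewrite !mxE /=.
  + by apply: is_derive_eq dp _; rewrite !mul0r oppr0 expR0; field.
  + by apply: is_derive_eq ds _; rewrite !mul0r oppr0 expR0; field.
  + by apply: is_derive_eq ds _; rewrite !mul0r oppr0 expR0; field.
  + by apply: is_derive_eq dp _; rewrite !mul0r oppr0 expR0; field.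
Qed.

End Curves.

(** * Bases of the matrix Lie algebras *)

Section Groups.
Context {R : realType}.
Local Notation rc := (real_complex R).

Definition spans3 m (L : set 'M[R[i]]_m) (T1 T2 T3 : 'M[R[i]]_m) : Prop :=
  (forall B, L B <-> exists x y z : R, B = rc x *: T1 + rc y *: T2 + rc z *: T3)
  /\ (forall x y z : R, rc x *: T1 + rc y *: T2 + rc z *: T3 = 0 ->
        [/\ x = 0, y = 0 & z = 0]).

Definition real_spans3 m (L : set 'M[R]_m) (T1 T2 T3 : 'M[R]_m) : Prop :=
  (forall B, L B <-> exists x y z : R, B = x *: T1 + y *: T2 + z *: T3)
  /\ (forall x y z : R, x *: T1 + y *: T2 + z *: T3 = 0 -> [/\ x = 0, y = 0 & z = 0]).

(** The imaginary parts along a curve of real matrices vanish, and so do their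
    derivatives. *)
Lemma matrix_lie_of_real m (H : set 'M[R]_m) B :
  matrix_lie (of_real H) B <-> exists2 B0, real_lie H B0 & B = map_mx rc B0.
Proof.
split=> [[ga [g0 gH gB]]|[B0 [ga [g0 gH gB]] ->]].
  have [gr grE] : exists gr, forall t, H (gr t) /\ ga t = map_mx rc (gr t).
    have /choice[gr grE] : forall t, exists A, H A /\ ga t = map_mx rc A.
      by move=> t; have [A HA <-] := gH t; exists A.
    by exists gr.
  have ReE i j : (fun t => complex.Re (ga t i j)) = (fun t => gr t i j).
    by apply/funext => t; rewrite (grE t).2 mxE.
  have ImE i j : (fun t => complex.Im (ga t i j)) = (fun=> 0).
    by apply/funext => t; rewrite (grE t).2 mxE.
  exists (map_mx (@complex.Re R) B).
    exists gr; split=> [|t|i j]; last 1 first.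
    - by rewrite mxE -ReE; have [] := gB i j.
    - apply/matrixP => i j; have := congr1 (fun A : 'M[R[i]]_m => complex.Re (A i j)) g0.
      by rewrite (grE 0).2 !mxE; case: (i == j).
    - by have [] := grE t.
  apply/matrixP => i j; rewrite !mxE; have [_] := gB i j.
  rewrite ImE => /is_derive_unique/(_ (is_deriveC 0)).
  by case: (B i j) => x y /= ->.
exists (fun t => map_mx rc (ga t)); split=> [|t|i j].
- by rewrite g0 map_mx1.
- by exists (ga t).
- split.
    under eq_fun do rewrite mxE.
    by rewrite mxE; exact: gB.
  under eq_fun do rewrite mxE.
  rewrite mxE; exact: is_deriveC.
Qed.

Lemma real_complex_inj m n : injective (fun A : 'M[R]_(m, n) => map_mx rc A).
Proof.
by move=> A B /matrixP h; apply/matrixP => i j; have := h i j; rewrite !mxE => -[].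
Qed.

Lemma spans3_of_real m (H : set 'M[R]_m) T1 T2 T3 :
  real_spans3 (real_lie H) T1 T2 T3 ->
  spans3 (matrix_lie (of_real H)) (map_mx rc T1) (map_mx rc T2) (map_mx rc T3).
Proof.
have E (x y z : R) : rc x *: map_mx rc T1 + rc y *: map_mx rc T2 + rc z *: map_mx rc T3 =
    map_mx rc (x *: T1 + y *: T2 + z *: T3) by rewrite !map_mxD !map_mxZ.
move=> [sp ind]; split=> [B|x y z].
  split=> [/matrix_lie_of_real[B0 /sp[x [y [z ->]]] ->]|[x [y [z ->]]]].
    by exists x, y, z.
  apply/matrix_lie_of_real; exists (x *: T1 + y *: T2 + z *: T3) => //.
  by apply/sp; exists x, y, z.
rewrite E -(map_mx0 rc) => /real_complex_inj; exact: ind.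
Qed.

(** Cyclic relabelling, which moves a special axis of the group to the place
    where the structure constants require it. *)
Lemma spans3_rot m (L : set 'M[R[i]]_m) T1 T2 T3 :
  spans3 L T1 T2 T3 -> spans3 L T2 T3 T1.
Proof.
move=> [sp ind]; split=> [B|x y z].
  split=> [/sp[x [y [z ->]]]|[x [y [z ->]]]].
    by exists y, z, x; rewrite -addrA addrC.
  by apply/sp; exists z, x, y; rewrite addrC addrA.
by rewrite addrC addrA => /ind[-> -> ->].
Qed.

Lemma real_spans3_SL2 :
  real_spans3 (real_lie [set A : 'M[R]_2 | \det A = 1])
    (mx2 2^-1 0 0 (- 2^-1)) (mx2 0 2^-1 2^-1 0) (mx2 0 2^-1 (- 2^-1) 0).
Proof.
have E (x y z : R) : x *: mx2 2^-1 0 0 (- 2^-1) + y *: mx2 0 2^-1 2^-1 0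
    + z *: mx2 0 2^-1 (- 2^-1) 0 =
    mx2 (x / 2) ((y + z) / 2) ((y - z) / 2) (- (x / 2)).
  by rewrite !mx2Z !mx2D; congr mx2; field.
split=> [B|x y z].
  rewrite real_lie_SL2; split=> [[x [y [z ->]]]|[x [y [z ->]]]].
    by exists (x + x), (y + z), (y - z); rewrite E; congr mx2; field.
  by exists (x / 2), ((y + z) / 2), ((y - z) / 2); rewrite E.
by rewrite E -mx2_00 => /mx2_inj[e1 e2 e3 _]; split; lra.
Qed.

Definition affine_real k (H : set 'M[R]_k) : set 'M[R]_(k + 1) :=
  [set B | exists (A : 'M[R]_k) (b : 'cV[R]_k), H A /\ B = block_mx A b 0 1%:M].

Lemma real_lie_affine k (H : set 'M[R]_k) B :
  real_lie (affine_real H) B <->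
  exists X v, real_lie H X /\ B = block_mx X v 0 0.
Proof.
split=> [[ga [g0 gH gB]]|[X [v [[ga [g0 gH gX]] ->]]]].
  exists (ulsubmx B), (ursubmx B); split.
    exists (fun t => ulsubmx (ga t)); split=> [|t|i j].
    - by rewrite g0; apply/matrixP => i j; rewrite !mxE (inj_eq (@lshift_inj _ _)).
    - by have [A [b [HA ->]]] := gH t; rewrite block_mxKul.
    - by under eq_fun do rewrite !mxE; rewrite !mxE; exact: gB.
  rewrite -[LHS]submxK; congr block_mx; apply/matrixP => i j; rewrite !mxE.
    apply: is_derive_unique (gB _ _) _; have -> : (fun t => ga t (rshift k i) (lshift 1 j)) = (fun=> 0).
      by apply/funext => t; have [A [b [_ ->]]] := gH t; rewrite block_mxEdl mxE.
    exact: is_deriveC.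
  apply: is_derive_unique (gB _ _) _.
  have -> : (fun t => ga t (rshift k i) (rshift k j)) = (fun=> (i == j)%:R).
    by apply/funext => t; have [A [b [_ ->]]] := gH t; rewrite block_mxEdr mxE.
  exact: is_deriveC.
exists (fun t => block_mx (ga t) (t *: v) 0 1%:M); split=> [|t|i j].
- by rewrite g0 scale0r -scalar_mx_block.
- by exists (ga t), (t *: v).
- case: (split_ordP i) => i' ->; case: (split_ordP j) => j' ->.
  + by under eq_fun do rewrite block_mxEul; rewrite block_mxEul.
  + under eq_fun do rewrite block_mxEur mxE.
    by rewrite block_mxEur; exact: is_derive_lin.
  + under eq_fun do rewrite block_mxEdl mxE.
    by rewrite block_mxEdl mxE; exact: is_deriveC.
  + under eq_fun do rewrite block_mxEdr mxE.
    by rewrite block_mxEdr mxE; exact: is_deriveC.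
Qed.

Definition translation k (i : 'I_k) : 'M[R]_(k + 1) := block_mx 0 (delta_mx i ord0) 0 0.
Definition linear_part k (X : 'M[R]_k) : 'M[R]_(k + 1) := block_mx X 0 0 0.

(** Two translations and a generator J of the linear part; this covers the
    Euclidean and the Minkowski plane. *)
Lemma real_spans3_plane (H : set 'M[R]_2) J : J != 0 ->
  (forall X, real_lie H X <-> exists x, X = x *: J) ->
  real_spans3 (real_lie (affine_real H))
    (translation ord0) (translation ord_max) (linear_part J).
Proof.
move=> J0 HJ.
have E (x y z : R) : x *: translation (ord0 : 'I_2) + y *: translation ord_max
    + z *: linear_part J =
    block_mx (z *: J) (x *: delta_mx ord0 ord0 + y *: delta_mx ord_max ord0) 0 0.
  by rewrite !scale_block_mx !add_block_mx !(scaler0, add0r, addr0).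
have vE (v : 'cV[R]_2) : v = v ord0 ord0 *: delta_mx ord0 ord0 + v ord_max ord0 *: delta_mx ord_max ord0.
  apply/matrixP => i j; rewrite !ord1 !mxE /=.
  by case: i => -[|[|//]] hi; rewrite ?mulr1 ?mulr0 ?addr0 ?add0r;
    congr (v _ _); apply/val_inj.
split=> [B|x y z].
  rewrite real_lie_affine; split=> [[X [v [/HJ[x ->] ->]]]|[x [y [z ->]]]].
    by exists (v ord0 ord0), (v ord_max ord0), x; rewrite E -vE.
  rewrite E; exists (z *: J), (x *: delta_mx ord0 ord0 + y *: delta_mx ord_max ord0).
  by split=> //; apply/HJ; exists z.
rewrite E -(block_mx0 _ 2 1 2 1) => /eq_block_mx[/eqP + v0 _ _].
rewrite scaler_eq0 (negPf J0) orbF => /eqP ->.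
have := v0; move/matrixP => h; have := h ord0 ord0; have := h ord_max ord0.
by rewrite !mxE /= !(mulr1, mulr0, addr0, add0r) => -> ->.
Qed.

Lemma real_spans3_E2 : real_spans3 (real_lie (affine_real (SO_form (1%:M : 'M[R]_2))))
  (translation ord0) (translation ord_max) (linear_part (mx2 0 (- 1) 1 0)).
Proof.
apply: real_spans3_plane => [|X].
  by apply/eqP; rewrite -mx2_00 => /mx2_inj[_ _ /eqP]; rewrite oner_eq0.
rewrite real_lie_SO2; split=> -[x ->]; exists x; rewrite mx2Z; congr mx2; ring.
Qed.

Lemma real_spans3_E11 : real_spans3 (real_lie (affine_real (SO_form (Defs.minkowski R))))
  (translation ord0) (translation ord_max) (linear_part (mx2 0 1 1 0)).
Proof.
apply: real_spans3_plane => [|X].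
  by apply/eqP; rewrite -mx2_00 => /mx2_inj[_ _ /eqP]; rewrite oner_eq0.
rewrite real_lie_SO11; split=> -[x ->]; exists x; rewrite mx2Z; congr mx2; ring.
Qed.

Lemma real_spans3_R3 : real_spans3 (real_lie (affine_real [set (1%:M : 'M[R]_3)]))
  (translation ord0) (translation (lift ord0 ord0)) (translation (lift ord0 (lift ord0 ord0))).
Proof.
have E (x y z : R) : x *: translation (ord0 : 'I_3) + y *: translation (lift ord0 ord0)
    + z *: translation (lift ord0 (lift ord0 ord0)) =
    block_mx 0 (x *: delta_mx ord0 ord0 + y *: delta_mx (lift ord0 ord0) ord0
      + z *: delta_mx (lift ord0 (lift ord0 ord0)) ord0) 0 0.
  by rewrite !scale_block_mx !add_block_mx !(scaler0, add0r, addr0).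
have vE (v : 'cV[R]_3) : v = v ord0 ord0 *: delta_mx ord0 ord0
    + v (lift ord0 ord0) ord0 *: delta_mx (lift ord0 ord0) ord0
    + v (lift ord0 (lift ord0 ord0)) ord0 *: delta_mx (lift ord0 (lift ord0 ord0)) ord0.
  apply/matrixP => i j; rewrite !ord1 !mxE /=.
  by case: i => -[|[|[|//]]] hi; rewrite ?mulr1 ?mulr0 ?addr0 ?add0r;
    congr (v _ _); apply/val_inj.
have T X : real_lie [set (1%:M : 'M[R]_3)] X <-> X = 0.
  split=> [[ga [_ g1 gX]]|->].
    apply/matrixP => i j; rewrite [RHS]mxE; apply: is_derive_unique (gX i j) _.
    have -> : (fun t => ga t i j) = (fun=> (1%:M : 'M[R]_3) i j).
      by apply/funext => t; rewrite (g1 t).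
    exact: is_deriveC.
  by exists (fun=> 1%:M); split=> // i j; rewrite [X in is_derive _ _ _ X]mxE; exact: is_deriveC.
split=> [B|x y z].
  rewrite real_lie_affine; split=> [[X [v [/T -> ->]]]|[x [y [z ->]]]].
    by exists (v ord0 ord0), (v (lift ord0 ord0) ord0), (v (lift ord0 (lift ord0 ord0)) ord0); rewrite E -vE.
  by rewrite E; eexists; eexists; split; [apply/T|].
rewrite E -(block_mx0 _ 3 1 3 1) => /eq_block_mx[_ /matrixP h _ _].
have := h ord0 ord0; have := h (lift ord0 ord0) ord0; have := h (lift ord0 (lift ord0 ord0)) ord0.
by rewrite !mxE /= !(mulr1, mulr0, addr0, add0r) => -> -> ->.
Qed.

End Groups.

Section MoreGroups.
Context {R : realType}.
Local Notation rc := (real_complex R).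

Definition strictly_upper : set 'M[R]_3 :=
  [set A : 'M[R]_3 | forall i j : 'I_3, (j <= i)%N -> A i j = (i == j)%:R].

Lemma real_spans3_Heisenberg : real_spans3 (real_lie strictly_upper)
  (delta_mx ord0 (lift ord0 ord0)) (delta_mx (lift ord0 ord0) (lift ord0 (lift ord0 ord0)))
  (delta_mx ord0 (lift ord0 (lift ord0 ord0))).
Proof.
set T1 := delta_mx _ _; set T2 := delta_mx _ _; set T3 := delta_mx _ _.
have E (B : 'M[R]_3) : (forall i j : 'I_3, (j <= i)%N -> B i j = 0) <->
    exists x y z : R, B = x *: T1 + y *: T2 + z *: T3.
  split=> [B0|[x [y [z ->]]] i j].
    exists (B ord0 (lift ord0 ord0)), (B (lift ord0 ord0) (lift ord0 (lift ord0 ord0))),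
      (B ord0 (lift ord0 (lift ord0 ord0))).
    apply/matrixP => i j; rewrite !mxE.
    case: i => -[|[|[|//]]] hi; case: j => -[|[|[|//]]] hj;
      rewrite /= ?mulr1 ?mulr0 ?addr0 ?add0r;
      first [by rewrite B0 | by congr (B _ _); apply/val_inj].
  by case: i => -[|[|[|//]]] hi; case: j => -[|[|[|//]]] hj; rewrite !mxE //= => _;
    rewrite !mulr0 !addr0.
split=> [B|x y z h].
  rewrite -E; split=> [[ga [g0 gH gB]] i j ji|B0].
    apply: is_derive_unique (gB i j) _.
    have -> : (fun t => ga t i j) = (fun=> (i == j)%:R).
      by apply/funext => t; exact: gH.
    exact: is_deriveC.
  exists (fun t => 1%:M + t *: B); split=> [|t i j ji|i j].
  - by rewrite scale0r addr0.
  - by rewrite !mxE B0 // mulr0 addr0.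
  - have -> : (fun t => (1%:M + t *: B) i j) = (fun t => (i == j)%:R + t * B i j).
      by apply/funext => t; rewrite !mxE.
    by apply: is_derive_eq (is_derive_add (is_deriveC _) (is_derive_lin (B i j))) (add0r _).
have := congr1 (fun A : 'M[R]_3 => A ord0 (lift ord0 ord0)) h.
have := congr1 (fun A : 'M[R]_3 => A (lift ord0 ord0) (lift ord0 (lift ord0 ord0))) h.
have := congr1 (fun A : 'M[R]_3 => A ord0 (lift ord0 (lift ord0 ord0))) h.
by rewrite !mxE /= !(mulr1, mulr0, addr0, add0r) => -> -> ->.
Qed.

(** The matrix is unitary of determinant 1, so its adjoint is its adjugate. *)
Lemma SU2_entries (a b c d : R[i]) :
  @SU2 R (mx2 a b c d) <-> [/\ d = conjc a, c = - conjc b & a * conjc a + b * conjc b = 1].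
Proof.
rewrite /SU2 /= map_mx2 tr_mx2 mul_mx2 mx2_1 det_mx2.
split=> [[/mx2_inj[e1 e2 e3 e4] de]|[-> -> e]].
  split=> //.
    transitivity (d * (a * conjc a + b * conjc b)); first by rewrite e1 mulr1.
    transitivity (conjc a * (a * d - b * c) + b * (c * conjc a + d * conjc b)); first by ring.
    by rewrite de e3; ring.
  transitivity (c * (a * conjc a + b * conjc b)); first by rewrite e1 mulr1.
  transitivity (a * (c * conjc a + d * conjc b) - conjc b * (a * d - b * c)); first by ring.
  by rewrite de e3; ring.
have cc (x : R[i]) : conjc (- x) = - conjc x by rewrite rmorphN.
rewrite cc !conjcK; split; last by rewrite -e; ring.
by congr mx2; rewrite -?e; ring.
Qed.

Definition su2 (x y z : R) : 'M[R[i]]_2 :=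
  mx2 (Complex 0 x) (Complex y z) (Complex (- y) z) (Complex 0 (- x)).

(** By [SU2_entries] two entries determine the matrix, so it suffices to
    differentiate these relations; the one for the norm kills the real part of
    the diagonal. *)
Lemma matrix_lie_SU2 X : matrix_lie (@SU2 R) X <-> exists x y z, X = su2 x y z.
Proof.
split=> [[ga [g0 gH gX]]|[x [y [z ->]]]].
  pose p t := complex.Re (ga t ord0 ord0); pose q t := complex.Im (ga t ord0 ord0).
  pose r t := complex.Re (ga t ord0 ord_max); pose s t := complex.Im (ga t ord0 ord_max).
  have gE t : [/\ ga t ord_max ord_max = Complex (p t) (- q t),
      ga t ord_max ord0 = Complex (- r t) (s t) &
      p t * p t + q t * q t + (r t * r t + s t * s t) = 1].
    have := gH t; rewrite (mx2_eta (ga t)) => /SU2_entries[-> -> h].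
    rewrite /p /q /r /s; move: h.
    case: (ga t ord0 ord0) => a b; case: (ga t ord0 ord_max) => c d /= h.
    split; [by rewrite mxE|by rewrite mxE /= /GRing.opp /= opprK|].
    have := congr1 (@complex.Re R) h; rewrite /= => <-; ring.
  have [d00 e00] := gX ord0 ord0; have [d01 e01] := gX ord0 ord_max.
  have [d10 e10] := gX ord_max ord0; have [d11 e11] := gX ord_max ord_max.
  rewrite -/p in d00; rewrite -/q in e00; rewrite -/r in d01; rewrite -/s in e01.
  have f10 : complex.Re (X ord_max ord0) = - complex.Re (X ord0 ord_max).
    apply: is_derive_unique d10 _.
    rewrite (_ : (fun t => _) = (fun t => - r t)); first exact: is_derive_opp.
    by apply/funext => t; case: (gE t) => _ ->.
  have f10' : complex.Im (X ord_max ord0) = complex.Im (X ord0 ord_max).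
    apply: is_derive_unique e10 _.
    rewrite (_ : (fun t => _) = (fun t => s t)) //.
    by apply/funext => t; case: (gE t) => _ ->.
  have f11 : complex.Re (X ord_max ord_max) = complex.Re (X ord0 ord0).
    apply: is_derive_unique d11 _.
    rewrite (_ : (fun t => _) = (fun t => p t)) //.
    by apply/funext => t; case: (gE t) => ->.
  have f11' : complex.Im (X ord_max ord_max) = - complex.Im (X ord0 ord0).
    apply: is_derive_unique e11 _.
    rewrite (_ : (fun t => _) = (fun t => - q t)); first exact: is_derive_opp.
    by apply/funext => t; case: (gE t) => ->.
  have p0 : p 0 = 1 by rewrite /p g0 mxE.
  have q0 : q 0 = 0 by rewrite /q g0 mxE.
  have r0 : r 0 = 0 by rewrite /r g0 mxE.
  have s0 : s 0 = 0 by rewrite /s g0 mxE.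
  have f00 : complex.Re (X ord0 ord0) = 0.
    have h := is_derive_add (is_derive_add (is_derive_mul d00 d00) (is_derive_mul e00 e00))
      (is_derive_add (is_derive_mul d01 d01) (is_derive_mul e01 e01)).
    rewrite (_ : (fun t => _) = (fun=> 1)) in h; last first.
      by apply/funext => t; case: (gE t).
    by have := is_derive_unique h (is_deriveC 1); rewrite p0 q0 r0 s0 => e; lra.
  exists (complex.Im (X ord0 ord0)), (complex.Re (X ord0 ord_max)), (complex.Im (X ord0 ord_max)).
  rewrite [LHS]mx2_eta /su2; move: f00 f10 f10' f11 f11'.
  case: (X ord0 ord0) => ? ?; case: (X ord0 ord_max) => ? ?.
  by case: (X ord_max ord0) => ? ?; case: (X ord_max ord_max) => ? ? /= -> -> -> -> ->.
(* The point (1 - |v|^2 + 2 v) / (1 + |v|^2) of the unit quaternions, where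
   v = t (x i + y j + z k) / 2. *)
pose w := (x ^+ 2 + y ^+ 2 + z ^+ 2) / 4.
have w0 : 0 <= w by rewrite divr_ge0 // !addr_ge0 // sqr_ge0.
pose N t := 1 + t * w * (t * 1).
have N0 t : N t != 0.
  by rewrite gt_eqF // ltr_pwDl // mulr1 mulrAC -expr2 mulr_ge0 // sqr_ge0.
have dw := is_derive_mul (is_derive_lin w) (is_derive_lin 1).
have dN := is_derive_inv (N0 0) (is_derive_add (is_deriveC 1) dw).
have du := is_derive_mul (is_derive_add (is_deriveC 1) (is_derive_opp dw)) dN.
pose u t := (1 + - (t * w * (t * 1))) * (N t)^-1.
pose v a t := t * a * (N t)^-1.
have dv a := is_derive_mul (is_derive_lin a) dN.
exists (fun t => mx2 (Complex (u t) (v x t)) (Complex (v y t) (v z t))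
                     (Complex (- v y t) (v z t)) (Complex (u t) (- v x t))); split.
- rewrite /u /v /N !mul0r !(oppr0, addr0, invr1, mulr1) mx2_1; congr mx2.
- move=> t; apply/SU2_entries; split=> //.
    by rewrite /conjc /GRing.opp /= opprK.
  have uv : u t * u t + v x t * v x t + (v y t * v y t + v z t * v z t) = 1.
    rewrite /u /v; have := N0 t; rewrite /N /w => h; field.
    rewrite (_ : 4 + _ = 4 * (1 + t * ((x ^+ 2 + y ^+ 2 + z ^+ 2) / 4) * (t * 1))) ?mulf_neq0 //.
    by field.
  apply/eqP; rewrite eq_complex /=; apply/andP; split; apply/eqP; last by ring.
  by rewrite -uv; ring.
- have U0 : - N 0 ^- 2 * (0 + (w * (0 * 1) + 0 * w * 1)) = 0 by rewrite !mul0r mulr0 !addr0 mulr0.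
  have Nv : (N 0)^-1 = 1 by rewrite /N !mul0r addr0 invr1.
  have D0 : is_derive (0 : R) (1 : R) u 0.
    by apply: is_derive_eq du _; rewrite Nv U0 !mul0r; ring.
  have Dv a : is_derive (0 : R) (1 : R) (v a) a.
    by apply: is_derive_eq (dv a) _; rewrite Nv U0; ring.
  have hh (i : 'I_2) : i = ord0 \/ i = ord_max.
    by case: i => -[|[|//]] h; [left|right]; apply/val_inj.
  move=> i j; case: (hh i) => ->; case: (hh j) => ->; split;
    by [rewrite !mxE /=; under eq_fun do rewrite !mxE /=; (exact: D0 || exact: Dv || exact: is_derive_opp)].
Qed.

End MoreGroups.

(** * Types of the Lie algebra *)

Section Types.
Context {R : realType}.
Local Notation rc := (real_complex R).

Lemma commutator_expand (S : comNzRingType) m (T1 T2 T3 : 'M[S]_m) x y z x' y' z' :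
  let P := x *: T1 + y *: T2 + z *: T3 in
  let Q := x' *: T1 + y' *: T2 + z' *: T3 in
  P *m Q - Q *m P =
  (y * z' - z * y') *: (T2 *m T3 - T3 *m T2) + (z * x' - x * z') *: (T3 *m T1 - T1 *m T3)
  + (x * y' - y * x') *: (T1 *m T2 - T2 *m T1).
Proof.
rewrite /= !mulmxDl !mulmxDr -!scalemxAl -!scalemxAr.
move: (T1 *m T1) (T1 *m T2) (T1 *m T3) (T2 *m T1) (T2 *m T2) (T2 *m T3)
  (T3 *m T1) (T3 *m T2) (T3 *m T3) => A B C D E F G H I.
apply/matrixP => i j; rewrite !mxE; ring.
Qed.

Lemma comb3_eq m (T1 T2 T3 : 'M[R[i]]_m) (x y z x' y' z' : R) :
  x = x' -> y = y' -> z = z' ->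
  rc x *: T1 + rc y *: T2 + rc z *: T3 = rc x' *: T1 + rc y' *: T2 + rc z' *: T3.
Proof. by move=> -> -> ->. Qed.

Definition Lie_brackets m (T1 T2 T3 : 'M[R[i]]_m) (d1 d2 d3 : R) : Prop :=
  [/\ T2 *m T3 - T3 *m T2 = rc d1 *: T1, T3 *m T1 - T1 *m T3 = rc d2 *: T2 &
      T1 *m T2 - T2 *m T1 = rc d3 *: T3].

Lemma Lie_brackets_rot m (T1 T2 T3 : 'M[R[i]]_m) d1 d2 d3 :
  Lie_brackets T1 T2 T3 d1 d2 d3 -> Lie_brackets T2 T3 T1 d2 d3 d1.
Proof. by case. Qed.

Lemma Lie_brackets_of_real m (T1 T2 T3 : 'M[R]_m) (d1 d2 d3 : R) :
  T2 *m T3 - T3 *m T2 = d1 *: T1 -> T3 *m T1 - T1 *m T3 = d2 *: T2 ->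
  T1 *m T2 - T2 *m T1 = d3 *: T3 ->
  Lie_brackets (map_mx rc T1) (map_mx rc T2) (map_mx rc T3) d1 d2 d3.
Proof.
by move=> E1 E2 E3; split; rewrite -!map_mxM -map_mxB -map_mxZ ?E1 ?E2 ?E3.
Qed.

Lemma SU2_brackets : Lie_brackets (su2 (2^-1 : R) 0 0) (su2 0 2^-1 0) (su2 0 0 2^-1) 1 1 1.
Proof.
split; rewrite /su2 !mul_mx2 mx2N mx2D mx2Z; congr mx2; apply/eqP;
  rewrite eq_complex /=; apply/andP; split; apply/eqP; by field.
Qed.

Lemma SU2_spans : spans3 (matrix_lie (@SU2 R)) (su2 (2^-1 : R) 0 0) (su2 0 2^-1 0) (su2 0 0 2^-1).
Proof.
have E (x y z : R) : rc x *: su2 2^-1 0 0 + rc y *: su2 0 2^-1 0 + rc z *: su2 0 0 2^-1 =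
    su2 (x / 2) (y / 2) (z / 2).
  rewrite /su2 !mx2Z !mx2D; congr mx2; apply/eqP;
    rewrite eq_complex /=; apply/andP; split; apply/eqP; by field.
split=> [B|x y z].
  rewrite matrix_lie_SU2; split=> [[x [y [z ->]]]|[x [y [z ->]]]].
    by exists (x + x), (y + y), (z + z); rewrite E; congr su2; by field.
  by exists (x / 2), (y / 2), (z / 2); rewrite E.
rewrite E /su2 -mx2_00 => /mx2_inj[/eqP + /eqP + _ _].
rewrite !eq_complex /= => /andP[_ /eqP h1] /andP[/eqP h2 /eqP h3]; split; lra.
Qed.

Lemma SL2_brackets : Lie_brackets (map_mx rc (mx2 2^-1 0 0 (- 2^-1)))
  (map_mx rc (mx2 0 2^-1 2^-1 0)) (map_mx rc (mx2 0 2^-1 (- 2^-1) 0)) (- 1) (- 1) 1.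
Proof.
apply: Lie_brackets_of_real; rewrite !mul_mx2 mx2N mx2D mx2Z; congr mx2; by field.
Qed.

Lemma delta_mx2_col (a b c d : R) : mx2 a b c d *m delta_mx ord0 ord0 =
    a *: delta_mx ord0 ord0 + c *: delta_mx ord_max ord0 :> 'cV_2 /\
  mx2 a b c d *m delta_mx ord_max ord0 =
    b *: delta_mx ord0 ord0 + d *: delta_mx ord_max ord0 :> 'cV_2.
Proof.
split; apply/matrixP => -[[|[|//]] hi] j; rewrite !ord1 !mxE !big_ord_recl big_ord0 !mxE /=;
  ring.
Qed.

(** A translation by v and a linear part J have bracket J v. *)
Lemma plane_brackets (J : 'M[R]_2) (d1 d2 : R) : J = mx2 0 (- d1) d2 0 ->
  Lie_brackets (map_mx rc (translation ord0)) (map_mx rc (translation ord_max))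
    (map_mx rc (linear_part J)) d1 d2 0.
Proof.
move=> ->; have [C0 C1] := delta_mx2_col 0 (- d1) d2 0.
by apply: Lie_brackets_of_real;
  rewrite /translation /linear_part !mulmx_block ?scale_block_mx opp_block_mx add_block_mx
    ?C0 ?C1 !(mul0mx, mulmx0, addr0, add0r, scale0r, scaler0, oppr0, subrr, scaleNr, opprK).
Qed.

Lemma R3_brackets : Lie_brackets (map_mx rc (translation (ord0 : 'I_3)))
  (map_mx rc (translation (lift ord0 ord0)))
  (map_mx rc (translation (lift ord0 (lift ord0 ord0)))) 0 0 0.
Proof.
by apply: Lie_brackets_of_real; rewrite /translation !mulmx_block scale0r
  !(mul0mx, mulmx0, addr0) subrr.
Qed.

Lemma Heisenberg_brackets : Lie_brackets (map_mx rc (delta_mx (ord0 : 'I_3) (lift ord0 ord0)))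
  (map_mx rc (delta_mx (lift ord0 ord0) (lift ord0 (lift ord0 ord0))))
  (map_mx rc (delta_mx ord0 (lift ord0 (lift ord0 ord0)))) 0 0 1.
Proof.
by apply: Lie_brackets_of_real; rewrite !mul_delta_mx_cond /= ?mulr0n ?mulr1n
  ?subr0 ?scale0r ?scale1r.
Qed.

Variables (G : ptopGroupType) (M : smooth_manifold R 3 G).
Variables (comb : 'rV[R]_3 -> G -> 'rV[R]_3) (co : (G -> 'rV[R]_3) -> 'rV[R]_3).
Variables (c1 c2 c3 : R).
Hypothesis combP : forall X, lie_algebra M X <-> exists a, X = comb a.
Hypothesis combK : cancel comb co.
Hypothesis comb_lin : forall k a b, comb (k *: a + b) = k *: comb a + comb b.
Hypothesis comb_bracket : forall a b,
  lie_bracket M (comb a) (comb b) = comb (lie_op (struct3 c1 c2 c3) a b).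

(** The isomorphism maps e_i to l_i T_i, and the three equations say that it
    respects the brackets. *)
Lemma has_typeI m (H : set 'M[R[i]]_m) T1 T2 T3 d1 d2 d3 l1 l2 l3 :
  spans3 (matrix_lie H) T1 T2 T3 -> Lie_brackets T1 T2 T3 d1 d2 d3 ->
  l1 != 0 -> l2 != 0 -> l3 != 0 ->
  l2 * l3 * d1 = c1 * l1 -> l3 * l1 * d2 = c2 * l2 -> l1 * l2 * d3 = c3 * l3 ->
  has_type M H.
Proof.
move=> [sp ind] [B1 B2 B3] l10 l20 l30 E1 E2 E3.
pose i1 : 'I_3 := lift ord0 ord0; pose i2 : 'I_3 := lift ord0 (lift ord0 ord0).
pose f (v : 'rV[R]_3) : 'M[R[i]]_m := rc (l1 * v ord0 ord0) *: T1
  + rc (l2 * v ord0 i1) *: T2 + rc (l3 * v ord0 i2) *: T3.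
exists (fun X => f (co X)); split.
- split.
  + move=> X _; apply/sp; exists (l1 * co X ord0 ord0), (l2 * co X ord0 i1),
      (l3 * co X ord0 i2) => //.
  + move=> X Y; rewrite !inE => /combP[a ->] /combP[b ->]; rewrite !combK => ab.
    congr comb; suff : a - b = 0 by move/eqP; rewrite subr_eq0 => /eqP.
    have : f (a - b) = 0.
      have -> : f (a - b) = f a - f b.
        by rewrite /f !mxE !mulrBr !rmorphB !scalerBl; apply/matrixP => i j; rewrite !mxE; ring.
      by rewrite ab subrr.
    move/ind => [/eqP h1 /eqP h2 /eqP h3]; move: h1 h2 h3.
    rewrite !mulf_eq0 (negPf l10) (negPf l20) (negPf l30) /= => /eqP h1 /eqP h2 /eqP h3.
    rewrite [LHS]vec3_eta h1 h2 h3.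
    by apply/rowP => -[[|[|[|//]]] hi]; rewrite !mxE.
  + move=> B /sp[x [y [z ->]]]; exists (comb (vec3 (x / l1) (y / l2) (z / l3))).
      by apply/combP; eexists.
    rewrite combK /f !mxE /=.
    by apply: comb3_eq; rewrite mulrC divfK.
- move=> k X Y /combP[a ->] /combP[b ->]; rewrite -comb_lin !combK /f !mxE.
  by rewrite !mulrDr !rmorphD !(mulrCA _ k) !rmorphM /= -/rc;
    apply/matrixP => i j; rewrite !mxE; ring.
- move=> X Y /combP[a ->] /combP[b ->]; rewrite comb_bracket !combK.
  rewrite /f commutator_expand B1 B2 B3 !scalerA.
  rewrite (vec3_eta a) (vec3_eta b) lie_op3 !mxE /= -!rmorphM -!rmorphB -!rmorphM.
  move: (a _ _) (a _ _) (a _ _) (b _ _) (b _ _) (b _ _) => x z y x' y' z'.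
  apply: comb3_eq.
  + transitivity (l2 * l3 * d1 * (y * z' - z * y')); first by rewrite E1; ring.
    by ring.
  + transitivity (l3 * l1 * d2 * (z * x' - x * z')); first by rewrite E2; ring.
    by ring.
  + transitivity (l1 * l2 * d3 * (x * y' - y * x')); first by rewrite E3; ring.
    by ring.
Qed.

(** If the c_k have the signs of the d_k, up to a common sign, then rescaling by
    square roots gives l_k; the common sign s is absorbed in all three. *)
Lemma has_type_sqrt m (H : set 'M[R[i]]_m) T1 T2 T3 d1 d2 d3 s a1 a2 a3 :
  spans3 (matrix_lie H) T1 T2 T3 -> Lie_brackets T1 T2 T3 d1 d2 d3 ->
  s != 0 -> a1 != 0 -> a2 != 0 -> a3 != 0 ->
  c1 = s * d1 * a1 ^+ 2 -> c2 = s * d2 * a2 ^+ 2 -> c3 = s * d3 * a3 ^+ 2 ->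
  has_type M H.
Proof.
move=> sp br s0 a10 a20 a30 E1 E2 E3.
apply: (has_typeI (l1 := s * (a2 * a3)) (l2 := s * (a3 * a1)) (l3 := s * (a1 * a2)) sp br);
  rewrite ?mulf_neq0 //; [rewrite E1|rewrite E2|rewrite E3]; ring.
Qed.

Let sqrt_neq0 (x : R) : 0 < x -> Num.sqrt x != 0.
Proof. by move=> x0; rewrite gt_eqF // sqrtr_gt0. Qed.

Let sqr_sqrt (x : R) : 0 < x -> Num.sqrt x ^+ 2 = x.
Proof. by move=> x0; rewrite sqr_sqrtr // ltW. Qed.

Lemma has_type_SU2 : 0 < c1 /\ 0 < c2 /\ 0 < c3 \/ c1 < 0 /\ c2 < 0 /\ c3 < 0 ->
  has_type M (@SU2 R).
Proof.
case=> -[h1 [h2 h3]].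
  apply: (has_type_sqrt (s := 1) SU2_spans SU2_brackets (oner_neq0 _)
    (sqrt_neq0 h1) (sqrt_neq0 h2) (sqrt_neq0 h3)); by rewrite sqr_sqrt // !mul1r.
rewrite -oppr_gt0 in h1; rewrite -oppr_gt0 in h2; rewrite -oppr_gt0 in h3.
apply: (has_type_sqrt (s := -1) SU2_spans SU2_brackets _
    (sqrt_neq0 h1) (sqrt_neq0 h2) (sqrt_neq0 h3));
  by rewrite ?oppr_eq0 ?oner_neq0 // sqr_sqrt // mulr1 mulN1r opprK.
Qed.

Lemma has_type_SL2 : 0 < c1 /\ 0 < c2 /\ c3 < 0 \/ 0 < c1 /\ c2 < 0 /\ c3 < 0 ->
  has_type M (@SL2 R).
Proof.
have sp := spans3_of_real (@real_spans3_SL2 R).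
case=> -[h1 [h2 h3]].
  rewrite -oppr_gt0 in h3.
  apply: (has_type_sqrt (s := -1) sp SL2_brackets _
      (sqrt_neq0 h1) (sqrt_neq0 h2) (sqrt_neq0 h3));
    by rewrite ?oppr_eq0 ?oner_neq0 // sqr_sqrt // !(mulr1, mulN1r, opprK, mul1r).
rewrite -oppr_gt0 in h2; rewrite -oppr_gt0 in h3.
apply: (has_type_sqrt (s := 1) (spans3_rot (spans3_rot sp))
    (Lie_brackets_rot (Lie_brackets_rot SL2_brackets)) (oner_neq0 _)
    (sqrt_neq0 h1) (sqrt_neq0 h2) (sqrt_neq0 h3));
  by rewrite sqr_sqrt // !(mul1r, mulN1r, opprK).
Qed.

Let E2_brackets := @plane_brackets (mx2 0 (- 1) 1 0) 1 1 erefl.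

Lemma has_type_E2 : c3 = 0 /\ 0 < c1 * c2 \/ c1 = 0 /\ 0 < c2 * c3 ->
  has_type M (@E2 R).
Proof.
have sp := spans3_of_real (@real_spans3_E2 R).
case=> -[z p].
  apply: (has_typeI (l1 := Num.sqrt (c1 * c2)) (l2 := c1) (l3 := Num.sqrt (c1 * c2)) sp E2_brackets);
    rewrite ?sqrt_neq0 //.
  - by move: p; apply: contraTneq => ->; rewrite mul0r ltxx.
  - by ring.
  - by rewrite mulr1 -expr2 sqr_sqrt //; ring.
  - by rewrite z; ring.
apply: (has_typeI (l1 := Num.sqrt (c2 * c3)) (l2 := Num.sqrt (c2 * c3)) (l3 := c2)
    (spans3_rot (spans3_rot sp)) (Lie_brackets_rot (Lie_brackets_rot E2_brackets)));
  rewrite ?sqrt_neq0 //.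
- by move: p; apply: contraTneq => ->; rewrite mul0r ltxx.
- by rewrite z; ring.
- by ring.
- by rewrite mulr1 -expr2 sqr_sqrt //; ring.
Qed.

Lemma has_type_E11 : 0 < c1 -> c2 = 0 -> c3 < 0 -> has_type M (@E11 R).
Proof.
move=> h1 h2 h3; have sp := spans3_of_real (@real_spans3_E11 R).
have J : mx2 0 1 1 0 = mx2 0 (- - 1) 1 0 :> 'M[R]_2 by rewrite opprK.
have p : 0 < - (c1 * c3) by rewrite oppr_gt0 pmulr_rlt0.
apply: (has_typeI (l1 := Num.sqrt (- (c1 * c3))) (l2 := Num.sqrt (- (c1 * c3))) (l3 := c1)
    (spans3_rot sp) (Lie_brackets_rot (plane_brackets J)));
  rewrite ?sqrt_neq0 // ?(gt_eqF h1) //.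
- by ring.
- by rewrite h2; ring.
- by rewrite mulrN1 -expr2 sqr_sqrt //; ring.
Qed.

Lemma has_type_R3 : c1 = 0 -> c2 = 0 -> c3 = 0 -> has_type M (@R3 R).
Proof.
move=> h1 h2 h3; have sp := spans3_of_real (@real_spans3_R3 R).
apply: (has_typeI (l1 := 1) (l2 := 1) (l3 := 1) sp R3_brackets);
  by rewrite ?oner_neq0 // ?h1 ?h2 ?h3; ring.
Qed.

Lemma has_type_Heisenberg :
  [/\ c1 != 0, c2 = 0 & c3 = 0] \/ [/\ c1 = 0, c2 = 0 & c3 != 0] ->
  has_type M (@Heisenberg R).
Proof.
have sp := spans3_of_real (@real_spans3_Heisenberg R).
case=> -[h1 h2 h3].
  apply: (has_typeI (l1 := 1) (l2 := c1) (l3 := 1) (spans3_rot (spans3_rot sp))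
      (Lie_brackets_rot (Lie_brackets_rot Heisenberg_brackets)));
    by rewrite ?oner_neq0 // ?h2 ?h3; ring.
apply: (has_typeI (l1 := c3) (l2 := 1) (l3 := 1) sp Heisenberg_brackets);
  by rewrite ?oner_neq0 // ?h1 ?h2; ring.
Qed.

End Types.

(** * Signs of the structure constants *)

Section Signs.
Context {R : realType}.
Implicit Types (x y : R).

Lemma lt_neqs x y : y < x -> x <> y /\ y <> x.
Proof. by move=> xy; split=> h; move: xy; rewrite h ltxx. Qed.

Lemma sign_cases x : x != 0 -> x < 0 \/ 0 < x.
Proof. by case: ltgtP => // _ _; [left|right]. Qed.

Lemma mul_self_gt0 x : x != 0 -> 0 < x * x.
Proof. by move=> x0; rewrite -expr2 lt0r sqrf_eq0 x0 sqr_ge0. Qed.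

(** The sign patterns of simple algebras with three distinct constants. *)
Lemma generic_neqs (c1 c2 c3 : R) :
  (c1 > c2 /\ c2 > c3 /\ c3 > 0) \/ (c1 > c2 /\ c2 > 0 /\ 0 > c3) \/
  (c1 > 0 /\ 0 > c2 /\ c2 > c3) \/ (0 > c1 /\ c1 > c2 /\ c2 > c3) ->
  (c1 <> c2 /\ c2 <> c3) /\ c3 <> c1 /\ c1 <> 0 /\ c2 <> 0 /\ c3 <> 0.
Proof.
by move=> H; do ![split]; move=> h; move: H => [[? []]|[[? []]|[[? []]|[? []]]]] *; lra.
Qed.

End Signs.

(** * Left invariant fields of a unimodular Lie group of dimension 3 *)

Section LieGroup.
Context {R : realType} {G : ptopGroupType}.
Variables (M : smooth_manifold R 3 G) (g : G -> 'M[R]_3).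
Hypothesis hg : riemannian_metric M g.
Hypothesis hl : left_invariant_metric M g.
Variables (e1 e2 e3 : G -> 'rV[R]_3) (c1 c2 c3 : R).
Hypothesis he : orthonormal_basis M g [:: e1; e2; e3].
Hypothesis h12 : lie_bracket M e1 e2 = c3 *: e3.
Hypothesis h23 : lie_bracket M e2 e3 = c1 *: e1.
Hypothesis h31 : lie_bracket M e3 e1 = c2 *: e2.

Let e (i : 'I_3) : G -> 'rV[R]_3 := [:: e1; e2; e3]`_i.

Definition frame_comb (a : 'rV[R]_3) : G -> 'rV[R]_3 := \sum_i a ord0 i *: e i.

Lemma frame_comb_linear k a b :
  frame_comb (k *: a + b) = k *: frame_comb a + frame_comb b.
Proof.
rewrite /frame_comb scaler_sumr -big_split; apply: eq_bigr => i _ /=.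
by rewrite !mxE scalerDl scalerA.
Qed.

Lemma frame_comb3 x y z : frame_comb (vec3 x y z) = x *: e1 + y *: e2 + z *: e3.
Proof. by rewrite /frame_comb !big_ord_recl big_ord0 !mxE /= addr0 addrA. Qed.

Lemma lie_algebraP X : lie_algebra M X <-> exists a, X = frame_comb a.
Proof.
have [<- _] := he; split=> [[a ->]|[a ->]].
  by exists (\row_i a i); apply: eq_bigr => i _; rewrite mxE.
by exists (fun i => a ord0 i).
Qed.

Lemma lie_algebra_frame i : lie_algebra M (e i).
Proof.
apply/lie_algebraP; exists (bvec i); rewrite /frame_comb (bigD1 i) //= big1.
  by rewrite /bvec mxE !eqxx scale1r addr0.
by move=> j ji; rewrite /bvec mxE (negPf ji) andbF scale0r.
Qed.

Lemma left_invariant_dot X Y p : lie_algebra M X -> lie_algebra M Y ->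
  bil (g p) (X p) (Y p) = ip g X Y.
Proof.
move=> [_ lX] [_ lY]; have := hl p 1%g (X 1%g) (Y 1%g).
by rewrite lX lY mulg1.
Qed.

(** At any point p the values are carried from 1 by left translation. *)
Lemma frame_orth p i j : bil (g p) (e i p) (e j p) = (i == j)%:R.
Proof.
have [_ ho] := he.
by apply: etrans (left_invariant_dot p _ _) (ho i j); exact: lie_algebra_frame.
Qed.

Lemma ip_frame_comb a b : ip g (frame_comb a) (frame_comb b) = dot a b.
Proof.
rewrite /ip /frame_comb !fct_sumE bilE mulmx_suml dot_suml dotE.
apply: eq_bigr => i _; rewrite dot_sumr (bigD1 i) //= big1 => [|j ji].
  rewrite addr0 [(_ *: e i) _]/(_ *: e i 1%g) [X in dot _ X]/(_ *: e i 1%g).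
  by rewrite -scalemxAl dotZl dotZr -bilE frame_orth eqxx mulr1.
rewrite [(_ *: e i) _]/(_ *: e i 1%g) [X in dot _ X]/(_ *: e j 1%g).
by rewrite -scalemxAl dotZl dotZr -bilE frame_orth eq_sym (negPf ji) !mulr0.
Qed.

Lemma frame_combK : cancel frame_comb (fun X => \row_i ip g X (e i)).
Proof.
move=> a; apply/rowP => i; rewrite mxE.
have -> : e i = frame_comb (bvec i).
  rewrite /frame_comb (bigD1 i) //= big1 => [|j ji].
    by rewrite /bvec mxE !eqxx scale1r addr0.
  by rewrite /bvec mxE (negPf ji) andbF scale0r.
by rewrite ip_frame_comb dotC dot_bvec.
Qed.

Lemma frame_bracket3 i j :
  lie_bracket M (e i) (e j) = \sum_k struct3 c1 c2 c3 i j ord0 k *: e k.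
Proof.
have self X : lie_bracket M X X = 0 by apply/funext => p; rewrite /lie_bracket subrr.
have anti X Y : lie_bracket M X Y = - lie_bracket M Y X.
  by apply/funext => p; rewrite /lie_bracket fctE opprB.
rewrite !big_ord_recl big_ord0 addr0.
by case: i => -[|[|[|//]]] hi; case: j => -[|[|[|//]]] hj;
  rewrite /e /struct3 /= !mxE /= ?self ?h12 ?h23 ?h31 ?(anti e2 e1) ?(anti e3 e2)
    ?(anti e1 e3) ?h12 ?h23 ?h31 !scale0r ?addr0 ?add0r ?scaleNr.
Qed.

Let C := struct3 c1 c2 c3.

Let e_smooth i : smooth_vf M (e i). Proof. by case: (lie_algebra_frame i). Qed.

(** The bracket of two combinations with constant coefficients is computed in
    the selected chart, where the fields form a frame. *)
Lemma frame_comb_bracket a b :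
  lie_bracket M (frame_comb a) (frame_comb b) = frame_comb (lie_op C a b).
Proof.
apply/funext => p; have [ac cp] := chart_atP M p.
set c := chart_at M p in ac cp *.
have F := chart_orthonormal_frame hg e_smooth frame_orth frame_bracket3 ac.
have cimgx := cimg_cmap cp.
have dE := frame_differentiable F cimgx.
have vE a' : vf_in M c (frame_comb a') = fun x => a' *m chart_frame M e c x.
  apply/funext => x; rewrite vf_in_sum mulmx_sum_row; apply: eq_bigr => i _.
  by rewrite row_chart_frame.
have -> : frame_comb (lie_op C a b) p = vf_in M c (frame_comb (lie_op C a b)) (c p).
  by rewrite /vf_in (cinvK ac cp) /tcoord (transition_id _ ac cp).
rewrite /lie_bracket -/c !vE; apply: etrans _ (frame_lie_op F a b cimgx).
by rewrite !(derive_mulmxl _ _ dE).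
Qed.

Lemma unit_sphereP X : unit_sphere M g X <-> exists2 a, X = frame_comb a & dot a a = 1.
Proof.
split=> [[/lie_algebraP[a ->]]|[a -> a1]].
  by rewrite ip_frame_comb; exists a.
by split; [apply/lie_algebraP; exists a|rewrite ip_frame_comb].
Qed.

(** The subset of the unit sphere cut out by a condition on the components. All
    sets in the classification have this form, so that their equality is
    decided on components. *)
Definition sphere_set (P : R -> R -> R -> Prop) : set (G -> 'rV[R]_3) :=
  [set X | exists x y z, [/\ X = frame_comb (vec3 x y z),
                             x ^+ 2 + y ^+ 2 + z ^+ 2 = 1 & P x y z]].

Lemma eq_sphere_set P Q :
  (forall x y z, x ^+ 2 + y ^+ 2 + z ^+ 2 = 1 -> P x y z <-> Q x y z) ->
  sphere_set P = sphere_set Q.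
Proof.
move=> PQ; apply/seteqP; split=> X [x [y [z [-> n p]]]]; exists x, y, z; split=> //;
  exact/(PQ _ _ _ n).
Qed.

Lemma sphere_setU P Q : sphere_set P `|` sphere_set Q =
  sphere_set (fun x y z => P x y z \/ Q x y z).
Proof.
apply/seteqP; split=> X.
  by case=> -[x [y [z [-> n p]]]]; exists x, y, z; split=> //; [left|right].
by move=> [x [y [z [-> n [p|p]]]]]; [left|right]; exists x, y, z.
Qed.

Lemma dot_vec3_sq (x y z : R) : dot (vec3 x y z) (vec3 x y z) = x ^+ 2 + y ^+ 2 + z ^+ 2.
Proof. by rewrite dot_vec3. Qed.

Lemma unit_sphere_set : unit_sphere M g = sphere_set (fun _ _ _ => True).
Proof.
apply/seteqP; split=> X.
  move=> /unit_sphereP[a ->]; rewrite (vec3_eta a) dot_vec3_sq => n.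
  by do 3 eexists; split; [reflexivity| |].
by move=> [x [y [z [-> n _]]]]; apply/unit_sphereP; exists (vec3 x y z) => //; rewrite dot_vec3_sq.
Qed.

Lemma sqr1 (x : R) : x ^+ 2 = 1 -> x = 1 \/ x = -1.
Proof. by move/eqP; rewrite sqrf_eq1 => /orP[] /eqP ->; [left|right]. Qed.

Lemma pm_e1 : pm e1 = sphere_set (fun x y z => y = 0 /\ z = 0).
Proof.
apply/seteqP; split=> X.
  case=> ->; [exists 1, 0, 0|exists (-1), 0, 0];
    rewrite frame_comb3 !scale0r !addr0 ?scale1r ?scaleN1r; split=> //; ring.
move=> [x [y [z [-> + [y0 z0]]]]]; rewrite frame_comb3 y0 z0 !scale0r !addr0 => n.
by case: (@sqr1 x) => [|->|->]; [rewrite -n; ring|left|right]; rewrite ?scale1r ?scaleN1r.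
Qed.

Lemma pm_e2 : pm e2 = sphere_set (fun x y z => x = 0 /\ z = 0).
Proof.
apply/seteqP; split=> X.
  case=> ->; [exists 0, 1, 0|exists 0, (-1), 0];
    rewrite frame_comb3 !scale0r !addr0 ?add0r ?scale1r ?scaleN1r; split=> //; ring.
move=> [x [y [z [-> + [y0 z0]]]]]; rewrite frame_comb3 y0 z0 !scale0r !addr0 add0r => n.
by case: (@sqr1 y) => [|->|->]; [rewrite -n; ring|left|right]; rewrite ?scale1r ?scaleN1r.
Qed.

Lemma pm_e3 : pm e3 = sphere_set (fun x y z => x = 0 /\ y = 0).
Proof.
apply/seteqP; split=> X.
  case=> ->; [exists 0, 0, 1|exists 0, 0, (-1)];
    rewrite frame_comb3 !scale0r !add0r ?scale1r ?scaleN1r; split=> //; ring.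
move=> [x [y [z [-> + [y0 z0]]]]]; rewrite frame_comb3 y0 z0 !scale0r !add0r => n.
by case: (@sqr1 z) => [|->|->]; [rewrite -n; ring|left|right]; rewrite ?scale1r ?scaleN1r.
Qed.

Lemma frame_comb_inj : injective frame_comb.
Proof. exact: can_inj frame_combK. Qed.

Lemma vec3_inj (x y z x' y' z' : R) : vec3 x y z = vec3 x' y' z' ->
  [/\ x = x', y = y' & z = z'].
Proof.
move/rowP => h; split; [have := h ord0|have := h (lift ord0 ord0)|
  have := h (lift ord0 (lift ord0 ord0))]; by rewrite !mxE.
Qed.

Lemma sphere_lspan (u v : G -> 'rV[R]_3) (P : R -> R -> R -> Prop) :
  (forall x y z, P x y z <-> exists s t, frame_comb (vec3 x y z) = s *: u + t *: v) ->
  unit_sphere M g `&` lspan [:: u; v] = sphere_set P.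
Proof.
move=> H; rewrite unit_sphere_set; apply/seteqP; split=> X.
  move=> [[x [y [z [XE n _]]]] [a aE]]; exists x, y, z; split=> //.
  apply/H; exists (a ord0), (a (lift ord0 ord0)).
  by rewrite -XE aE !big_ord_recl big_ord0 /= addr0.
move=> [x [y [z [-> n /H[s [t E]]]]]]; split; first by exists x, y, z.
exists (fun i : 'I_2 => if i == ord0 then s else t).
by rewrite E !big_ord_recl big_ord0 /= addr0.
Qed.

Lemma sphere_lspan23 : unit_sphere M g `&` lspan [:: e2; e3] =
  sphere_set (fun x y z => x = 0).
Proof.
apply: sphere_lspan => x y z; split=> [->|[s [t]]].
  by exists y, z; rewrite frame_comb3 scale0r add0r.
have -> : s *: e2 + t *: e3 = frame_comb (vec3 0 s t) by rewrite frame_comb3 scale0r add0r.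
by move/frame_comb_inj/vec3_inj => [].
Qed.

Lemma sphere_lspan12 : unit_sphere M g `&` lspan [:: e1; e2] =
  sphere_set (fun x y z => z = 0).
Proof.
apply: sphere_lspan => x y z; split=> [->|[s [t]]].
  by exists x, y; rewrite frame_comb3 scale0r addr0.
have -> : s *: e1 + t *: e2 = frame_comb (vec3 s t 0) by rewrite frame_comb3 scale0r addr0.
by move/frame_comb_inj/vec3_inj => [].
Qed.

Lemma sphere_lspan13 : unit_sphere M g `&` lspan [:: e1; e3] =
  sphere_set (fun x y z => y = 0).
Proof.
apply: sphere_lspan => x y z; split=> [->|[s [t]]].
  by exists x, z; rewrite frame_comb3 scale0r addr0.
have -> : s *: e1 + t *: e3 = frame_comb (vec3 s 0 t) by rewrite frame_comb3 scale0r addr0.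
by move/frame_comb_inj/vec3_inj => [].
Qed.

(** Each line is one pair of indices: mu_i mu_j = - (c_i - c_j)^2 / 4 as soon as
    c_k = 0, so the two conditions of [magnetic_condition3] on that pair hold
    together exactly in the listed cases. *)
Lemma magnetic_setE q : magnetic_set M g q = sphere_set (fun x y z =>
  (c1 = c2 \/ c3 = 0 /\ q = - ((c1 - c2) ^+ 2 / 4) \/ x = 0 \/ y = 0) /\
  (c2 = c3 \/ c1 = 0 /\ q = - ((c2 - c3) ^+ 2 / 4) \/ y = 0 \/ z = 0) /\
  (c3 = c1 \/ c2 = 0 /\ q = - ((c3 - c1) ^+ 2 / 4) \/ z = 0 \/ x = 0)).
Proof.
have pairP (c c' d u v : R) : (c - c') * d * (u * v) = 0 /\
    (c - c') * ((c' + d - c) / 2 * ((d + c - c') / 2) - q) * (u * v) = 0 <->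
    c = c' \/ d = 0 /\ q = - ((c - c') ^+ 2 / 4) \/ u = 0 \/ v = 0.
  split=> [[/eqP + /eqP]|[->|[[-> ->]|[] ->]]]; last 4 first.
  - by rewrite subrr !mul0r.
  - by rewrite mulr0 mul0r; split=> //; field.
  - by rewrite mul0r !mulr0.
  - by rewrite !mulr0.
  rewrite !mulf_eq0 subr_eq0; have [->|_] /= := eqVneq c c'; first by left.
  have [->|_] /= := eqVneq u 0; first by do 2 right; left.
  have [->|_] /= := eqVneq v 0; first by do 3 right.
  rewrite !orbF => /eqP -> /eqP qE; right; left; split=> //.
  move/eqP: qE; rewrite subr_eq0 => /eqP <-; by field.
have -> : magnetic_set M g q = sphere_set (fun x y z =>
    magnetic M g q (frame_comb (vec3 x y z))).
  apply/seteqP; split=> X.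
    by rewrite /magnetic_set unit_sphere_set => -[[x [y [z [-> n _]]]] m]; exists x, y, z.
  move=> [x [y [z [-> n m]]]]; split=> //.
  by rewrite unit_sphere_set; exists x, y, z.
apply: eq_sphere_set => x y z n.
have a1 : dot (vec3 x y z) (vec3 x y z) = 1 by rewrite dot_vec3_sq.
have lX : lie_algebra M (frame_comb (vec3 x y z)) by apply/lie_algebraP; eexists.
have uX : unit_vf g (frame_comb (vec3 x y z)).
  by move=> p; rewrite left_invariant_dot // ip_frame_comb.
rewrite (magneticP hg e_smooth frame_orth frame_bracket3 q 1%g a1
  (struct3_trace c1 c2 c3) lX.1 uX).
rewrite magnetic_condition3 //.
by rewrite -!pairP; split=> [[]|[? []]].
Qed.

End LieGroup.

Theorem theorem5p1 (R : realType) (G : ptopGroupType)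
    (M : smooth_manifold R 3 G) (hG : lie_group M) (hu : unimodular R G)
    (g : G -> 'M[R]_3) (hg : riemannian_metric M g)
    (hl : left_invariant_metric M g)
    (e1 e2 e3 : G -> 'rV[R]_3) (c1 c2 c3 : R)
    (he : orthonormal_basis M g [:: e1; e2; e3])
    (h12 : lie_bracket M e1 e2 = c3 *: e3)
    (h23 : lie_bracket M e2 e3 = c1 *: e1)
    (h31 : lie_bracket M e3 e1 = c2 *: e2)
    (hc12 : c1 >= c2) (hc23 : c2 >= c3) :
  (c1 = c2 /\ c2 = c3 /\ c3 != 0 ->
     has_type M (@SU2 R) /\
     forall q : R, magnetic_set M g q = unit_sphere M g)
  /\
  (c1 = 0 /\ c2 = 0 /\ c3 = 0 ->
     has_type M (@R3 R) /\
     forall q : R, magnetic_set M g q = unit_sphere M g)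
  /\
  (c1 > c2 /\ c2 = c3 /\ c3 != 0 ->
     (c1 != 0 -> has_type M (@SU2 R) \/ has_type M (@SL2 R)) /\
     (c1 = 0 -> has_type M (@E2 R)) /\
     forall q : R, magnetic_set M g q =
       pm e1 `|` (unit_sphere M g `&` lspan [:: e2; e3]))
  /\
  (c1 > c2 /\ c2 = 0 /\ c3 = 0 ->
     has_type M (@Heisenberg R) /\
     (forall q : R, q != - (c1 ^+ 2 / 4) -> magnetic_set M g q =
       pm e1 `|` (unit_sphere M g `&` lspan [:: e2; e3])) /\
     (forall q : R, q = - (c1 ^+ 2 / 4) ->
       magnetic_set M g q = unit_sphere M g))
  /\
  (c1 != 0 /\ c1 = c2 /\ c2 > c3 ->
     (c3 != 0 -> has_type M (@SU2 R) \/ has_type M (@SL2 R)) /\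
     (c3 = 0 -> has_type M (@E2 R)) /\
     forall q : R, magnetic_set M g q =
       pm e3 `|` (unit_sphere M g `&` lspan [:: e1; e2]))
  /\
  (c1 = 0 /\ c2 = 0 /\ c2 > c3 ->
     has_type M (@Heisenberg R) /\
     (forall q : R, q != - (c3 ^+ 2 / 4) -> magnetic_set M g q =
       pm e3 `|` (unit_sphere M g `&` lspan [:: e1; e2])) /\
     (forall q : R, q = - (c3 ^+ 2 / 4) ->
       magnetic_set M g q = unit_sphere M g))
  /\
  ((c1 > c2 /\ c2 > c3 /\ c3 > 0 -> has_type M (@SU2 R)) /\
   (c1 > c2 /\ c2 > 0 /\ 0 > c3 -> has_type M (@SL2 R)) /\
   (c1 > 0 /\ 0 > c2 /\ c2 > c3 -> has_type M (@SL2 R)) /\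
   (0 > c1 /\ c1 > c2 /\ c2 > c3 -> has_type M (@SU2 R)) /\
   ((c1 > c2 /\ c2 > c3 /\ c3 > 0) \/ (c1 > c2 /\ c2 > 0 /\ 0 > c3) \/
    (c1 > 0 /\ 0 > c2 /\ c2 > c3) \/ (0 > c1 /\ c1 > c2 /\ c2 > c3) ->
      forall q : R, magnetic_set M g q = pm e1 `|` pm e2 `|` pm e3))
  /\
  (c1 > c2 /\ c2 > c3 /\ c3 = 0 ->
     has_type M (@E2 R) /\
     (forall q : R, q != - ((c1 - c2) ^+ 2 / 4) ->
       magnetic_set M g q = pm e1 `|` pm e2 `|` pm e3) /\
     (forall q : R, q = - ((c1 - c2) ^+ 2 / 4) -> magnetic_set M g q =
       pm e3 `|` (unit_sphere M g `&` lspan [:: e1; e2])))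
  /\
  (c1 > c2 /\ c2 = 0 /\ 0 > c3 ->
     has_type M (@E11 R) /\
     (forall q : R, q != - ((c3 - c1) ^+ 2 / 4) ->
       magnetic_set M g q = pm e1 `|` pm e2 `|` pm e3) /\
     (forall q : R, q = - ((c3 - c1) ^+ 2 / 4) -> magnetic_set M g q =
       pm e2 `|` (unit_sphere M g `&` lspan [:: e1; e3])))
  /\
  (c1 = 0 /\ c1 > c2 /\ c2 > c3 ->
     has_type M (@E2 R) /\
     (forall q : R, q != - ((c2 - c3) ^+ 2 / 4) ->
       magnetic_set M g q = pm e1 `|` pm e2 `|` pm e3) /\
     (forall q : R, q = - ((c2 - c3) ^+ 2 / 4) -> magnetic_set M g q =
       pm e1 `|` (unit_sphere M g `&` lspan [:: e2; e3]))).

Proof.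
have combP := lie_algebraP he.
have combK := frame_combK hl he.
have comb_lin := frame_comb_linear e1 e2 e3.
have comb_br := frame_comb_bracket hg hl he h12 h23 h31.
have S3 := has_type_SU2 combP combK comb_lin comb_br.
have SL := has_type_SL2 combP combK comb_lin comb_br.
have TE2 := has_type_E2 combP combK comb_lin comb_br.
have TE11 := has_type_E11 combP combK comb_lin comb_br.
have TR3 := has_type_R3 combP combK comb_lin comb_br.
have TH := has_type_Heisenberg combP combK comb_lin comb_br.
have ms := magnetic_setE hg hl he h12 h23 h31.
rewrite (pm_e1 e1 e2 e3) (pm_e2 e1 e2 e3) (pm_e3 e1 e2 e3).
rewrite (sphere_lspan12 hl he) (sphere_lspan23 hl he) (sphere_lspan13 hl he).
rewrite (unit_sphere_set hl he) !sphere_setU.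
split; [|split; [|split; [|split; [|split; [|split; [|split; [|split; [|split]]]]]]]].
- move=> [E12 [E23 n3]]; have E31 : c3 = c1 by rewrite E12.
  split=> [|q]; last by rewrite ms; apply: eq_sphere_set => x y z _; tauto.
  by apply: S3; rewrite E12 E23; case: (sign_cases n3); [right|left].
- move=> [h1 [h2 h3]].
  have E12 : c1 = c2 by rewrite h1. have E23 : c2 = c3 by rewrite h2.
  have E31 : c3 = c1 by rewrite h3.
  split=> [|q]; first exact: TR3.
  by rewrite ms; apply: eq_sphere_set => x y z _; tauto.
- move=> [h [E23 n3]]; have [n12 n21] := lt_neqs h.
  have /eqP N3 := n3; have N2 : c2 <> 0 by rewrite E23.
  have n31 : c3 <> c1 by rewrite -E23.
  split; [move=> n1|split=> [h1|q]].
  + rewrite E23 in h; case: (sign_cases n3) => h3; last first.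
      by left; apply: S3; left; rewrite E23; split=> //; exact: lt_trans h.
    case: (sign_cases n1) => h1; first by left; apply: S3; right; rewrite E23.
    by right; apply: SL; right; rewrite E23.
  + by apply: TE2; right; rewrite E23; split=> //; exact: mul_self_gt0.
  + by rewrite ms; apply: eq_sphere_set => x y z _; tauto.
- move=> [h [h2 h3]]; have [n12 n21] := lt_neqs h.
  have [E23 E31] : c2 = c3 /\ c3 <> c1 by rewrite h3 -h2.
  have n1 : c1 != 0 by move: h; rewrite h2 => /gt_eqF ->.
  have K1 : (c1 - c2) ^+ 2 = c1 ^+ 2 by rewrite h2 subr0.
  have K3 : (c3 - c1) ^+ 2 = c1 ^+ 2 by rewrite h3 sub0r sqrrN.
  split; first by apply: TH; left.
  split=> q; [move/eqP|] => hq; rewrite ms K1 K3; apply: eq_sphere_set => x y z _; tauto.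
- move=> [n1 [E12 h]]; have [n23 n32] := lt_neqs h.
  have /eqP N1 := n1; have N2 : c2 <> 0 by rewrite -E12.
  have n31 : c3 <> c1 by rewrite E12.
  split; [move=> n3|split=> [h3|q]].
  + rewrite -E12 in h; case: (sign_cases n1) => h1.
      by left; apply: S3; right; rewrite -E12; split=> //; split=> //; exact: lt_trans h1.
    case: (sign_cases n3) => h3; last by left; apply: S3; left; rewrite -E12.
    by right; apply: SL; left; rewrite -E12.
  + by apply: TE2; left; rewrite -E12; split=> //; exact: mul_self_gt0.
  + by rewrite ms; apply: eq_sphere_set => x y z _; tauto.
- move=> [h1 [h2 h]]; have [n23 n32] := lt_neqs h.
  have [E12 n31] : c1 = c2 /\ c3 <> c1 by rewrite h1 -h2.
  have n3 : c3 != 0 by move: h; rewrite h2 => /lt_eqF ->.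
  have K2 : (c2 - c3) ^+ 2 = c3 ^+ 2 by rewrite h2 sub0r sqrrN.
  have K3 : (c3 - c1) ^+ 2 = c3 ^+ 2 by rewrite h1 subr0.
  split; first by apply: TH; right.
  split=> q; [move/eqP|] => hq; rewrite ms K2 K3; apply: eq_sphere_set => x y z _; tauto.
- split=> [[h [h' h3]]|].
    have h2 := lt_trans h3 h'; have h1 := lt_trans h2 h.
    by apply: S3; left.
  split=> [[h [h2 h3]]|].
    by apply: SL; left; split=> //; exact: lt_trans h.
  split=> [[h1 [h2 h]]|].
    by apply: SL; right; split=> //; split=> //; exact: lt_trans h2.
  split=> [[h1 [h h']]|].
    have h2 := lt_trans h h1; have h3 := lt_trans h' h2.
    by apply: S3; right.
  move=> H q.
  have [[n12 n23] [n31 [N1 [N2 N3]]]] := generic_neqs H.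
  by rewrite ms; apply: eq_sphere_set => x y z _; tauto.
- move=> [h [h' h3]]; have [n12 n21] := lt_neqs h; have [n23 n32] := lt_neqs h'.
  have h2 : 0 < c2 by rewrite -h3.
  have h1 := lt_trans h2 h.
  have [N1 _] := lt_neqs h1; have [N2 _] := lt_neqs h2.
  have n31 : c3 <> c1 by rewrite h3 => /esym.
  split; first by apply: TE2; left; split=> //; exact: mulr_gt0.
  split=> q; [move/eqP|] => hq; rewrite ms; apply: eq_sphere_set => x y z _; tauto.
- move=> [h [h2 h3]]; have [n12 n21] := lt_neqs h; have [n32 n23] := lt_neqs h3.
  rewrite h2 in h; have [N1 _] := lt_neqs h.
  have [n13 n31] := lt_neqs (lt_trans h3 h).
  have n23' : c2 <> c3 by rewrite h2.
  split; first exact: TE11.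
  split=> q; [move/eqP|] => hq; rewrite ms; apply: eq_sphere_set => x y z _; tauto.
- move=> [h1 [h h']]; have [n12 n21] := lt_neqs h; have [n23 n32] := lt_neqs h'.
  have h2 : c2 < 0 by rewrite -h1.
  have h3 := lt_trans h' h2.
  have [_ N2] := lt_neqs h2; have [_ N3] := lt_neqs h3.
  have n31 : c3 <> c1 by rewrite h1.
  split; first by apply: TE2; right; split=> //; rewrite nmulr_rgt0.
  split=> q; [move/eqP|] => hq; rewrite ms; apply: eq_sphere_set => x y z _; tauto.
Qed.
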